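(* Under the standing assumptions in the context, let $d_0=d_1=:d$, let $u^0\ll\lambda^d$ with density $U^0:=\frac{du^0}{d\lambda^d}\in L^\infty(\omega_0)$, and let $c(x,\xi)=\frac1\gamma\|\xi-x\|^\gamma$ for some $\gamma\in(1,2]$. Let $\bar u\in\mathfrak M(\omega_1)$ be an optimal control of (P) with associated adjoint state $p\in W^{1,q'}_0(\Omega)$, and suppose that $p\in W^{2,r}_{\mathrm{loc}}(\operatorname{int}(\omega_1))$ with $r\in(d,\infty]$. Then the restriction of $\bar u$ to $\operatorname{int}(\omega_1)$ is absolutely continuous with respect to $\lambda^d$, and its density satisfies $$\bar U_{\operatorname{int}(\omega_1)}:=\frac{d\,\bar u|_{\operatorname{int}(\omega_1)}}{d\lambda^d}\in L^{r/d}_{\mathrm{loc}}(\operatorname{int}(\omega_1)).$$ If $\operatorname{int}(\omega_1)$ satisfies the cone condition and $p\in W^{2,r}(\operatorname{int}(\omega_1))$ with $r\in(d,\infty]$, then even $\bar U_{\operatorname{int}(\omega_1)}\in L^{r/d}(\operatorname{int}(\omega_1))$. (Here $\infty/d=\infty$.)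
   Context: For a compact set $X\subset\mathbb R^n$, $\mathfrak M(X)=C(X)^*$ denotes the finite signed Borel measures on $X$. $r'$ denotes the conjugate exponent of $r$; $\lambda^d$ is the Lebesgue measure. Standing assumptions. $d_0\in\mathbb N$, $d_1\in\{2,3\}$; $\Omega\subset\mathbb R^{d_1}$ is a bounded Lipschitz domain; $\omega_0\subset\mathbb R^{d_0}$ and $\omega_1\subset\overline\Omega$ are nonempty compact sets; $u^0\in\mathfrak M(\omega_0)$, $u^0\ge 0$; $c\in C(\omega_0\times\omega_1)$; $\alpha>0$. $p_\Omega>d_1$ is an exponent (provided by Theorem 0.5(a) of Jerison–Kenig 1995) such that for every $p\in(p_\Omega',p_\Omega)$ and every $f\in W^{-1,p}(\Omega)$ the equation $-\Delta y=f$ (weak Laplacian, $-\langle\Delta y,v\rangle=\int_\Omega\nabla y\cdot\nabla v\,d\lambda^{d_1}$) has a unique solution $y\in W^{1,p}_0(\Omega)$. The exponent $q$ is fixed with $q'\in(d_1,p_\Omega)$ and, if $d_1=3$, additionally $q'<6$. $J:W^{1,q}_0(\Omega)\to\mathbb R$ is continuous and Gâteaux differentiable. $E:W^{1,q'}_0(\Omega)\to C(\omega_1)$ is the Sobolev embedding into $C_0(\Omega)\subset C(\overline\Omega)$ followed by restriction to $\omega_1$; $\langle E^*u,v\rangle=\int_{\omega_1}v\,du$. $S:=(-\Delta)^{-1}E^*:\mathfrak M(\omega_1)\to W^{1,q}_0(\Omega)$. $\mathrm D^c_{u^0}(u):=\inf\{\int c\,d\pi:\pi\in\mathfrak M(\omega_0\times\omega_1),\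 \pi\ge0,\ (P_0)_\#\pi=u^0,\ (P_1)_\#\pi=u\}$ with coordinate projections $P_0,P_1$ and $\inf\emptyset=\infty$. Problem (P): minimize $J(Su)+\alpha\,\mathrm D^c_{u^0}(u)$ over $u\in\mathfrak M(\omega_1)$; an optimal control is a (global) minimizer. The adjoint state associated with $\bar u$ is the unique $p\in W^{1,q'}_0(\Omega)\hookrightarrow C(\overline\Omega)$ with $-\Delta p=J'(S\bar u)$ in $W^{-1,q'}(\Omega)$. *)

(* Defs.v *)
From HB Require Import structures.
From mathcomp Require Import all_boot all_order all_algebra.
From mathcomp Require Import all_classical all_reals all_analysis.
From mathcomp Require Import measurable_realfun lra.
Set Implicit Arguments.
Unset Strict Implicit.
Unset Printing Implicit Defensive.
Import Order.TTheory GRing.Theory Num.Theory.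
Import numFieldNormedType.Exports.
Local Open Scope classical_set_scope.
Local Open Scope ring_scope.

(* Borel sigma-algebra on matrices, hence on R^n seen as 'rV[R]_n. *)
#[warnings="-redundant-canonical-projection"]
HB.instance Definition _ (R : realType) (m n : nat) :=
  @isMeasurable.Build (sigma_display (@open 'M[R]_(m, n))) 'M[R]_(m, n)
    <<s @open 'M[R]_(m, n) >> (@sigma_algebra0 _ setT _)
    (@sigma_algebraC _ _) (@sigma_algebra_bigcup _ setT _).

Section borel_rV.
Variables (R : realType) (d : measure_display) (X : measurableType d).

Lemma measurable_fun_rV (n : nat) (f : X -> 'rV[R]_n) :
  (forall i, measurable_fun setT (fun x => f x 0 i)) -> measurable_fun setT f.
Proof.
move=> mf; apply: (@measurability _ _ _ _ setT f (@open 'rV[R]_n)) => //.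
move=> _ [U oU <-]; rewrite setTI.
pose rball (c : 'rV[rat]_n * nat) : set 'rV[R]_n :=
  ball (map_mx ratr c.1 : 'rV[R]_n) c.2.+1%:R^-1.
pose F (k : nat) : set 'rV[R]_n :=
  if unpickle k is Some c then
    if `[< rball c `<=` U >] then rball c else set0 else set0.
have UF : U = \bigcup_k F k.
  rewrite eqEsubset; split => [x Ux|x [k _]]; last first.
    by rewrite /F; case: unpickle => [c|//]; case: asboolP => // + xc; apply.
  have /nbhs_ballP[e /= e0 xeU] : nbhs x U by exact: open_nbhs_nbhs.
  have e20 : 0 < e / 2 by rewrite divr_gt0.
  have [k _ kh] := near_infty_natSinv_lt (PosNum e20).
  have {}kh : k.+1%:R^-1 < e / 2 := kh _ (leqnn k).
  have k0 : 0 < k.+1%:R^-1 :> R by rewrite invr_gt0.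
  have hc i : {c : rat | `|x 0 i - ratr c| < k.+1%:R^-1}.
    apply: cid.
    have : x 0 i - k.+1%:R^-1 < x 0 i + k.+1%:R^-1.
      by rewrite ltrBlDr -addrA ltrDl addr_gt0.
    move=> /rat_in_itvoo[c]; rewrite in_itv/= => /andP[c1 c2].
    by exists c; rewrite ltr_distl ltrBlDr c2 /= -ltrBlDr.
  pose c := \row_i sval (hc i).
  exists (pickle (c, k)) => //; rewrite /F pickleK.
  have cx : rball (c, k) x.
    split => // i j; rewrite (ord1 i) !mxE /ball/= distrC.
    exact: svalP (hc j).
  case: asboolP => // -[] y [_ cy]; apply: xeU; split => // i j.
  case: cx => _ /(_ i j) cx; have {}cy := cy i j.
  have -> : e = e / 2 + e / 2 by lra.
  apply: (@ball_triangle _ _ (map_mx ratr c i j : R)).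
    exact/ball_sym/(le_ball (ltW kh)).
  exact: (le_ball (ltW kh)).
rewrite UF preimage_bigcup; apply: bigcup_measurable => k _.
rewrite /F; case: unpickle => [c|]; last by rewrite preimage_set0.
case: asboolP => _; last by rewrite preimage_set0.
have -> : f @^-1` rball c = \bigcap_(i in [set: 'I_n])
    [set x | ball (map_mx ratr c.1 0 i : R) c.2.+1%:R^-1 (f x 0 i)].
  rewrite eqEsubset; split => x /=.
    by move=> [_ h] i _; exact: h.
  move=> h; split; first by rewrite invr_gt0.
  by move=> i j; rewrite (ord1 i); exact: h.
apply: fin_bigcap_measurable => // i _.
rewrite -[X in measurable X]setTI; apply: mf => //.
exact: measurable_ball.
Unshelve. all: by end_near.
Qed.

End borel_rV.

Lemma measurable_coord (R : realType) (n : nat) (i : 'I_n) :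
  measurable_fun setT (fun x : 'rV[R]_n => x 0 i).
Proof.
apply: (@measurability _ _ _ _ _ _ (@RGenOpens.G R)).
  exact: RGenOpens.measurableE.
move=> _ [_ [a [b ->]] <-]; rewrite setTI; apply: sub_sigma_algebra.
apply: open_comp => [x _|]; last exact: interval_open.
exact: coord_continuous.
Qed.

Section lebesgue_rV.
Variable R : realType.

Definition rV_cons (n : nat) (vx : 'rV[R]_n * R) : 'rV[R]_n.+1 :=
  \row_i oapp (fun j => vx.1 0 j) vx.2 (unlift ord0 i).

Lemma measurable_rV_cons (n : nat) : measurable_fun setT (@rV_cons n).
Proof.
apply: measurable_fun_rV => i; under eq_fun do rewrite mxE.
case: (unlift ord0 i) => [j|] /=; last exact: measurable_snd.
exact: measurableT_comp (measurable_coord j) measurable_fst.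
Qed.

Definition lebesgue_step (n : nat) (mu : {measure set 'rV[R]_n -> \bar R}) :
    {measure set 'rV[R]_n.+1 -> \bar R} :=
  measure_function_pushforward__canonical__measure_function_Measure
    (mu \x @lebesgue_measure R)%E (@measurable_rV_cons n).

(* Lebesgue measure on the Borel sets of R^n: n-fold product of the
   one-dimensional one, transported to 'rV[R]_n. *)
Fixpoint lebesgue_rV (n : nat) : {measure set 'rV[R]_n -> \bar R} :=
  if n is m.+1 then lebesgue_step (lebesgue_rV m) else dirac (0 : 'rV[R]_0).

Definition rV_box (n : nat) (a b : 'I_n -> R) : set 'rV[R]_n :=
  [set x | forall i, x 0 i \in `[a i, b i]].

Lemma measurable_rV_box (n : nat) (a b : 'I_n -> R) : measurable (rV_box a b).
Proof.
have -> : rV_box a b = \bigcap_(i in [set: 'I_n])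
    ((fun x : 'rV[R]_n => x 0 i) @^-1` `[a i, b i]).
  by rewrite eqEsubset; split => x h i; [move=> _|]; exact: h.
apply: fin_bigcap_measurable => // i _.
rewrite -[X in measurable X]setTI.
exact: measurable_coord.
Qed.

Lemma lebesgue_rV_box (n : nat) (a b : 'I_n -> R) : (forall i, a i <= b i) ->
  lebesgue_rV n (rV_box a b) = (\prod_(i < n) (b i - a i))%:E.
Proof.
elim: n a b => [|n ih] a b ab.
  rewrite big_ord0 /= diracE mem_set//.
  by case.
rewrite big_ord_recl /= /pushforward.
have -> : @rV_cons n @^-1` rV_box a b =
    rV_box (a \o lift ord0) (b \o lift ord0) `*` `[a ord0, b ord0].
  rewrite eqEsubset; split => -[v x] /=.
    move=> h; split => [i|]; last first.
      by have := h ord0; rewrite mxE unlift_none.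
    by have := h (lift ord0 i); rewrite mxE liftK.
  move=> [hv hx] i; rewrite mxE; case: unliftP => [j ->|->] /=; last exact: hx.
  exact: hv.
rewrite product_measure1E//; last exact: measurable_rV_box.
rewrite ih; last by move=> i; exact: ab.
rewrite [X in (_ * X)%E](lebesgue_measure_itv `[a ord0, b ord0])/=.
rewrite lte_fin -EFinB.
case: ltP => [_|ba]; first by rewrite -EFinM mulrC.
have -> : b ord0 = a ord0 by apply/eqP; rewrite eq_le ba ab.
by rewrite subrr mul0r mule0.
Qed.

End lebesgue_rV.

Section euclidean_geometry.
Context {R : realType} {n : nat}.
Implicit Types (x y : 'rV[R]_n) (D : set 'rV[R]_n).

Definition dotp x y : R := \sum_(i < n) x 0 i * y 0 i.

(* The norm `|x| of the library on 'rV[R]_n is the sup norm. *)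
Definition enorm x : R := Num.sqrt (dotp x x).

End euclidean_geometry.

(* Near each boundary point x, after the orthogonal change of coordinates Q and
   the choice of a distinguished coordinate i, D is the strict epigraph of a
   Lipschitz function of the other coordinates. *)
Definition lipschitz_boundary (R : realType) (n : nat) (D : set 'rV[R]_n) :=
  forall x, (closure D `\` D°) x ->
  exists (Q : 'M[R]_n) (i : 'I_n) (phi : 'rV[R]_n.-1 -> R) (L r : R),
    [/\ Q *m Q^T = 1%:M, 0 < r,
        forall a b, `|phi a - phi b| <= L * enorm (a - b) &
        forall y, enorm (y - x) < r ->
          (D y <-> phi (col' i (y *m Q)) < (y *m Q) 0 i)].

Definition bounded_lipschitz_domain (R : realType) (n : nat)
    (D : set 'rV[R]_n) :=
  [/\ D !=set0, open D, connected D, bounded_set D & lipschitz_boundary D].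

(* Every point of D is the vertex of a cone contained in D and congruent to a
   fixed finite cone of height rho and aperture angle kappa. *)
Definition cone_condition (R : realType) (n : nat) (D : set 'rV[R]_n) :=
  exists rho kappa : R, [/\ 0 < rho, 0 < kappa <= pi &
    forall x, D x -> exists2 v : 'rV[R]_n, enorm v = 1 &
      forall y, enorm y <= rho -> cos (kappa / 2) * enorm y <= dotp y v ->
        D (x + y)].

(* Sobolev spaces are handled through representatives: a class of functions on
   an open set D is given by any f : 'rV[R]_n -> R, whose values outside D play
   no role.  Exponents range over the extended reals. *)
Section sobolev.
Context {R : realType} {n : nat}.
Local Notation V := 'rV[R]_n.
Local Notation mu := (lebesgue_rV R n).
Implicit Types (D : set V) (f g y v : V -> R) (p : \bar R).

Definition Lp p D f :=
  measurable_fun D f /\ (Lnorm mu p (EFin \o (f \_ D)) < +oo)%E.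

Definition Lp_loc p D f :=
  forall K : set V, compact K -> K `<=` D -> Lp p K f.

Definition partial (s : seq 'I_n) f : V -> R :=
  foldr (fun i g => 'D_(delta_mx 0 i) g) f s.

Definition smooth f := forall s : seq 'I_n,
  continuous (partial s f) /\
  forall i x, derivable (partial s f) x (delta_mx 0 i).

Definition closed_support f : set V := closure [set x | f x != 0].

Definition test_function D f :=
  [/\ smooth f, compact (closed_support f) & closed_support f `<=` D].

Definition weak_partial D (s : seq 'I_n) f g :=
  [/\ Lp_loc 1%E D f, Lp_loc 1%E D g &
      forall phi, test_function D phi ->
        (\int[mu]_(x in D) (f x * partial s phi x) =
         (-1) ^+ size s * \int[mu]_(x in D) (g x * phi x))%R].

Definition sobolev (k : nat) p D f :=
  forall s : seq 'I_n, (size s <= k)%N ->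
    exists2 g, Lp p D g & weak_partial D s f g.

Definition sobolev_loc (k : nat) p D f :=
  forall D' : set V, open D' -> compact (closure D') -> closure D' `<=` D ->
    sobolev k p D' f.

(* A representative of the i-th weak partial derivative of f (0 if none). *)
Definition wgrad D f (i : 'I_n) : V -> R :=
  xget (cst 0) [set g | weak_partial D [:: i] f g].

Definition W1norm p D f : \bar R :=
  (Lnorm mu p (EFin \o (f \_ D)) +
   \sum_(i < n) Lnorm mu p (EFin \o (wgrad D f i \_ D)))%E.

Definition W10 p D f := sobolev 1 p D f /\
  forall e : R, 0 < e -> exists2 phi, test_function D phi &
    (W1norm p D (f \- phi)%R < e%:E)%E.

(* Continuous linear functionals on W^{1,p}_0(D), i.e. W^{-1,p'}(D). *)
Definition W10_dual p D (F : (V -> R) -> R) :=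
  (forall (a : R) f g, W10 p D f -> W10 p D g ->
     F (fun x => a * f x + g x) = a * F f + F g) /\
  exists C : R, forall f, W10 p D f -> (`|F f|%:E <= C%:E * W1norm p D f)%E.

(* y in W^{1,p}_0(D) and -Delta y = F in W^{-1,p}(D). *)
Definition poisson_solution p D y (F : (V -> R) -> R) :=
  W10 p D y /\
  forall v, W10 (hoelder_conjugate p) D v ->
    \int[mu]_(x in D) (\sum_(i < n) wgrad D y i x * wgrad D v i x) = F v.

Definition poisson_uniquely_solvable p D :=
  forall F, W10_dual (hoelder_conjugate p) D F ->
    (exists y, poisson_solution p D y F) /\
    forall y1 y2, poisson_solution p D y1 F -> poisson_solution p D y2 F ->
      ae_eq mu D y1 y2.

(* The representative of v in C_0(D), extended by 0 to the boundary of D. *)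
Definition C0_representative D v w :=
  [/\ {within closure D, continuous w},
      forall x, (closure D `\` D) x -> w x = 0 &
      ae_eq mu D v w].

Definition embed_C0 D v : V -> R :=
  xget (cst 0) [set w | C0_representative D v w].

Definition W10_continuous p D (J : (V -> R) -> R) :=
  forall y, W10 p D y -> forall e : R, 0 < e -> exists2 dl : R, 0 < dl &
    forall z, W10 p D z -> (W1norm p D (z \- y)%R < dl%:E)%E ->
      `|J z - J y| < e.

Definition gateaux_quotient (J : (V -> R) -> R) y v (t : R) : R :=
  t^-1 * (J (fun x => y x + t * v x) - J y).

Definition gateaux (J : (V -> R) -> R) y v : R :=
  lim (gateaux_quotient J y v @ 0^').

Definition gateaux_differentiable p D (J : (V -> R) -> R) :=
  forall y, W10 p D y ->
    (forall v, W10 p D v -> cvg (gateaux_quotient J y v @ 0^')) /\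
    W10_dual p D (gateaux J y).

End sobolev.

Section charge_integral.
Context d (T : measurableType d) (R : realType).
Variable u : {charge set T -> \bar R}.

Definition hahn_pos : set T := projT1 (cid (Hahn_decomposition u)).
Definition hahn_neg : set T :=
  projT1 (cid (projT2 (cid (Hahn_decomposition u)))).
Definition hahn_posneg : hahn_decomposition u hahn_pos hahn_neg :=
  projT2 (cid (projT2 (cid (Hahn_decomposition u)))).

Definition charge_integral (D : set T) (f : T -> R) : R :=
  \int[jordan_pos hahn_posneg]_(x in D) f x -
  \int[jordan_neg hahn_posneg]_(x in D) f x.

End charge_integral.

(* The measures on a compact set w are represented by the measures on the whole
   space that vanish off w. *)
Definition concentrated_on d (T : measurableType d) (R : realType)
    (u : set T -> \bar R) (w : set T) :=
  forall A, measurable A -> A `&` w = set0 -> u A = 0%E.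

(* U is a density on D of the restriction of u to D. *)
Definition is_density (R : realType) (n : nat) (u : set 'rV[R]_n -> \bar R)
    (D : set 'rV[R]_n) (U : 'rV[R]_n -> R) :=
  (lebesgue_rV R n).-integrable D (EFin \o U) /\
  forall A, measurable A ->
    u (A `&` D) = (\int[lebesgue_rV R n]_(x in A `&` D) (U x)%:E)%E.

Section control_problem.
Context {R : realType} {n : nat}.
Local Notation V := 'rV[R]_n.

Definition Estar (Omega w1 : set V) (u : {charge set V -> \bar R})
    (v : V -> R) : R :=
  charge_integral u w1 (embed_C0 Omega v).

Definition control_to_state (Omega w1 : set V) (q : \bar R)
    (u : {charge set V -> \bar R}) : V -> R :=
  xget (cst 0) [set y | poisson_solution q Omega y (Estar Omega w1 u)].

Definition transport_plan (w0 w1 : set V) (u0 u : set V -> \bar R)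
    (pi : {finite_measure set (V * V)%type -> \bar R}) :=
  [/\ concentrated_on pi (w0 `*` w1),
      forall A, measurable A -> pushforward pi fst A = u0 A &
      forall A, measurable A -> pushforward pi snd A = u A].

Definition transport_cost (w0 w1 : set V) (c : V -> V -> R)
    (u0 u : set V -> \bar R) : \bar R :=
  ereal_inf [set (\int[pi]_(z in w0 `*` w1) (c z.1 z.2)%:E)%E
            | pi in transport_plan w0 w1 u0 u].

Definition control_cost (Omega w0 w1 : set V) (q : \bar R)
    (J : (V -> R) -> R) (alpha : R) (c : V -> V -> R) (u0 : set V -> \bar R)
    (u : {charge set V -> \bar R}) : \bar R :=
  ((J (control_to_state Omega w1 q u))%:E +
   alpha%:E * transport_cost w0 w1 c u0 u)%E.

Definition optimal_control (Omega w0 w1 : set V) (q : \bar R)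
    (J : (V -> R) -> R) (alpha : R) (c : V -> V -> R) (u0 : set V -> \bar R)
    (ubar : {charge set V -> \bar R}) :=
  concentrated_on ubar w1 /\
  forall u : {charge set V -> \bar R}, concentrated_on u w1 ->
    (control_cost Omega w0 w1 q J alpha c u0 ubar <=
     control_cost Omega w0 w1 q J alpha c u0 u)%E.

Definition adjoint_state (Omega w1 : set V) (q : \bar R) (J : (V -> R) -> R)
    (u : {charge set V -> \bar R}) (p : V -> R) :=
  poisson_solution (hoelder_conjugate q) Omega p
    (gateaux J (control_to_state Omega w1 q u)).

Definition power_cost (gamma : R) (x xi : V) : R :=
  gamma^-1 * (enorm (xi - x)) `^ gamma.

End control_problem.

(* Main.v *)
(* Write Phi(x, xi) = p(xi) + alpha c(x, xi).  Comparing the optimal control with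
   convex combinations of controls transported by other plans shows that an
   optimal plan only charges pairs (x, xi) for which xi minimizes Phi(x, .) over
   omega1.  Only almost optimal plans are needed for this: it is quantified with
   Markov's inequality, and yields ubar(K) <= u0(P(K)), where P(K) is the set of
   the x whose function Phi(x, .) has a minimizer in K.

   If xi is such a minimizer in the interior of omega1, then
   |xi - x|^(gamma-2) (xi - x) = - grad p(xi) / alpha.  By Morrey's inequality
   applied to grad p, the right-hand side oscillates on a cube Q of side l by at
   most om = C (int_Q |D^2 p|^r)^(1/r) l^(1 - d/r); as the left-hand side is an
   injective function of xi - x with Lipschitz inverse on bounded sets, P(Q) has
   diameter at most C (l + om).  Since U0 is bounded, for every b >= 1
     ubar(Q) <= C (l + om)^d <= C int_Q (b^d + b^(d-r) h^r),   h = 1 + |D^2 p|.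
   This inequality extends from cubes to Borel sets, which gives absolute
   continuity; letting b be of the size of h gives Ubar <= C h^d a.e., and h^d
   belongs to L^(r/d). *)
Require Import Defs.
From HB Require Import structures.
From mathcomp Require Import all_boot all_order all_algebra.
From mathcomp Require Import all_classical all_reals all_analysis.
From mathcomp Require Import measurable_realfun ess_sup_inf ring lra.
Set Implicit Arguments.
Unset Strict Implicit.
Unset Printing Implicit Defensive.
Import Order.TTheory GRing.Theory Num.Theory.
Import numFieldNormedType.Exports.
Local Open Scope classical_set_scope.
Local Open Scope ring_scope.

(** * Smooth steps *)

(** A pointwise gradient of [p] is never formed, weak derivatives being classes of functions.
    Morrey's inequality is used in the form [morrey_affine]: along each axis the continuous
    representative of [p] is affine on a cube up to [|s| * om], with one slope for the whole cube.
    The first order conditions of all minimizers in the cube then involve the same vector.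

    For gamma < 2 the cost is not twice differentiable at xi = x. One-sided information suffices:
    |z|^gamma is a concave function of |z|^2, hence has a quadratic upper expansion away from 0, and
    at 0 it is o(|z|).

    The quantity (l + om)^d is not additive in Q. The weighted inequality with the parameter b
    replaces it by a measure, which permits the passage to Borel sets; b stays free so that it can
    be fitted to h afterwards, on the sets where h is at most an integer b.

    A minimizer must have room to move, so the estimate on a cube uses a slightly larger one; the
    excess is removed by monotone limits. The Lipschitz boundary keeps the interior of omega1 inside
    Omega, where [p] agrees with its continuous representative. *)

Section smooth_real_functions.
Context {R : realType}.
Implicit Types (f g : R -> R) (k : nat).

Fixpoint nderivable k f : Prop :=
  if k is k'.+1 then (forall x : R, derivable f x 1) /\ nderivable k' (derive1 f)
  else True.

Definition smooth1 f := forall k, nderivable k f.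

Lemma nderivableW k f : nderivable k.+1 f -> nderivable k f.
Proof.
elim: k f => [//|k ih] f [df dk]; split => //; exact: ih.
Qed.

Lemma smooth1_derivable f (x : R) : smooth1 f -> derivable f x 1.
Proof. by move=> /(_ 1%N)[+ _]; apply. Qed.

Lemma smooth1_derive f : smooth1 f -> smooth1 (derive1 f).
Proof. by move=> sf k; have [_] := sf k.+1. Qed.

Lemma smooth1_is_derive f (x : R) : smooth1 f -> is_derive x 1 f (derive1 f x).
Proof.
by move=> sf; rewrite derive1E; apply: DeriveDef => //; exact: smooth1_derivable.
Qed.

Lemma smooth1_continuous f : smooth1 f -> continuous f.
Proof.
move=> sf x; apply/differentiable_continuous/derivable1_diffP.
exact: smooth1_derivable.
Qed.

Lemma derive1_is_derive f f' : (forall x : R, is_derive x 1 f (f' x)) ->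
  (derive1 f) = f' /\ forall x : R, derivable f x 1.
Proof.
move=> df; split=> [|x]; last by have [] := df x.
by apply/funext => x; rewrite derive1E; have [_ ->] := df x.
Qed.

Lemma nderivable_cst k c : nderivable k (cst c).
Proof.
elim: k c => [//|k ih] c; split=> [x|]; first exact: derivable_cst.
have [-> _] := @derive1_is_derive (cst c) (cst 0) (fun x => is_derive_cst _ _ _).
exact: ih.
Qed.

Lemma nderivableD k f g : nderivable k f -> nderivable k g ->
  nderivable k (fun x => f x + g x).
Proof.
elim: k f g => [//|k ih] f g [df kf] [dg kg].
have [E dfg] : derive1 (fun x => f x + g x) = (fun x => derive1 f x + derive1 g x) /\
    forall x : R, derivable (fun x => f x + g x) x 1.
  apply: derive1_is_derive => x; rewrite !derive1E.
  by apply: is_deriveD; apply: DeriveDef.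
by rewrite /= E; split => //; exact: ih.
Qed.

Lemma nderivableM k f g : nderivable k f -> nderivable k g ->
  nderivable k (fun x => f x * g x).
Proof.
elim: k f g => [//|k ih] f g [df kf] [dg kg].
have [E dfg] : derive1 (fun x => f x * g x) =
    (fun x => f x * derive1 g x + g x * derive1 f x) /\
    forall x : R, derivable (fun x => f x * g x) x 1.
  apply: derive1_is_derive => x; rewrite !derive1E.
  by apply: is_deriveM; apply: DeriveDef.
rewrite /= E; split => //; apply: nderivableD; apply: ih => //; exact: nderivableW.
Qed.

Lemma nderivable_affine k f a b : nderivable k f ->
  nderivable k (fun x => f (a * x + b)).
Proof.
elim: k f => [//|k ih] f [df kf].
have [E dfg] : derive1 (fun x => f (a * x + b)) =
    (fun x => derive1 f (a * x + b) * a) /\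
    forall x : R, derivable (fun x => f (a * x + b)) x 1.
  apply: derive1_is_derive => x; rewrite derive1E.
  have -> : (fun x => f (a * x + b)) = f \o (fun x => a * x + b) by [].
  apply: is_derive1_comp; first exact: DeriveDef.
  have h : is_derive x 1 (fun y : R => a * y) a.
    have h := is_deriveZ a (is_derive_id x 1).
    by rewrite -[X in is_derive _ _ _ X]mulr1.
  by rewrite -[X in is_derive _ _ _ X]addr0; exact: is_deriveD.
rewrite /= E; split => //; apply: nderivableM; [exact: ih|exact: nderivable_cst].
Qed.

(** The derivative of 1/f is - (1/f)^2 f', which involves 1/f itself: the induction bears on the
    order [k] with [f] fixed. *)
Lemma nderivableV k f : (forall x, f x != 0) -> nderivable k f ->
  nderivable k (fun x => (f x)^-1).
Proof.
move=> f0; elim: k => [//|k ih] /[dup] kSf [df kf].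
have [E dfg] : derive1 (fun x => (f x)^-1) =
    (fun x => - 1 * ((f x)^-1 * (f x)^-1) * derive1 f x) /\
    forall x : R, derivable (fun x => (f x)^-1) x 1.
  apply: derive1_is_derive => x; rewrite derive1E.
  have -> : - 1 * ((f x)^-1 * (f x)^-1) * 'D_1 f x = - f x ^- 2 *: 'D_1 f x.
    by rewrite /GRing.scale/= mulN1r -invfM -expr2.
  by apply: is_deriveV => //; apply: DeriveDef.
rewrite /= E; split => //; have {}ih := ih (nderivableW kSf).
apply: nderivableM => //; apply: nderivableM; first exact: nderivable_cst.
exact: nderivableM.
Qed.

Lemma smooth1_cst c : smooth1 (cst c).
Proof. by move=> k; exact: nderivable_cst. Qed.

Lemma smooth1D f g : smooth1 f -> smooth1 g -> smooth1 (fun x => f x + g x).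
Proof. by move=> sf sg k; exact: nderivableD. Qed.

Lemma smooth1M f g : smooth1 f -> smooth1 g -> smooth1 (fun x => f x * g x).
Proof. by move=> sf sg k; exact: nderivableM. Qed.

Lemma smooth1_affine f a b : smooth1 f -> smooth1 (fun x => f (a * x + b)).
Proof. by move=> sf k; exact: nderivable_affine. Qed.

Lemma smooth1V f : (forall x, f x != 0) -> smooth1 f ->
  smooth1 (fun x => (f x)^-1).
Proof. by move=> f0 sf k; exact: nderivableV. Qed.

(* The class of functions p(1/x) exp(-1/x) on x > 0, extended by 0, is stable
   under derivation. *)
Definition flat (p : {poly R}) (x : R) : R :=
  if 0 < x then p.[x^-1] * expR (- x^-1) else 0.

(** One term of the exponential series, exp u >= u^(n+2) / (n+2)!, gives the constant; the two extra
    powers leave the decay [u ^- 2]. *)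
Lemma expRN_decay n : exists C : R, 0 <= C /\ forall u : R, 0 < u ->
  u ^+ n * expR (- u) <= C * u ^- 2.
Proof.
exists (n.+2`!%:R); split => // u u0.
have := expR_ge1Dxn n.+1 (ltW u0); set e := expR u => ue.
have e0 : 0 < e by exact: expR_gt0.
have {ue} : u ^+ n.+2 <= n.+2`!%:R * e.
  rewrite mulrC -ler_pdivrMr ?ltr0n ?fact_gt0//.
  by apply: le_trans ue; rewrite lerDr.
rewrite expRN ler_pdivrMr// mulrAC ler_pdivlMr ?exprn_gt0//.
by rewrite -exprD addn2.
Qed.

(** With u = 1/x, each monomial of [p] contributes a term of order x^2. A quadratic bound is what
    makes the difference quotient at 0 tend to 0. *)
Lemma flat_decay p : exists C : R, 0 <= C /\ forall x : R,
  `|flat p x| <= C * x ^+ 2.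
Proof.
have /choice[C hC] : forall n, exists C : R, 0 <= C /\ forall u : R, 0 < u ->
    u ^+ n * expR (- u) <= C * u ^- 2 by move=> n; exact: expRN_decay.
exists (\sum_(i < size p) `|p`_i| * C i); split.
  by apply: sumr_ge0 => i _; apply: mulr_ge0 => //; have [] := hC i.
move=> x; rewrite /flat; case: ltP => [x0|_]; last first.
  rewrite normr0 mulr_ge0 ?sqr_ge0//.
  by apply: sumr_ge0 => i _; apply: mulr_ge0 => //; have [] := hC i.
rewrite horner_coef !mulr_suml (le_trans (ler_norm_sum _ _ _))//.
apply: ler_sum => i _; rewrite !normrM -!mulrA ler_wpM2l//.
have [_ /(_ x^-1)] := hC i; rewrite invr_gt0 => /(_ x0) {}hC.
rewrite -normrM ger0_norm; last first.
  by rewrite mulr_ge0 ?expR_ge0// exprn_ge0// invr_ge0 ltW.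
by rewrite (le_trans hC)// -exprVn invrK.
Qed.

(** For x > 0 the derivative of p(1/x) exp(-1/x) is x^-2 (p - p')(1/x) exp(-1/x), and x^-2 is the
    value of ['X^2] at 1/x. For x < 0 the function is locally 0, and at 0 [flat_decay] applies. *)
Lemma is_derive_flat p (x : R) :
  is_derive x 1 (flat p) (flat ('X^2 * (p - p^`())) x).
Proof.
have [x0|x0|x0] := ltgtP 0 x.
- rewrite {2}/flat x0.
  apply: (@near_eq_is_derive _ _ _ (fun x : R => p.[x^-1] * expR (- x^-1) : R)).
    near=> y; rewrite /flat ifT//; near: y; exact: lt_nbhsr.
  have dV : is_derive x 1 (fun y : R => y^-1) (- x ^- 2).
    have -> : - x ^- 2 = - x ^- 2 *: (1 : R) by rewrite /GRing.scale/= mulr1.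
    by apply: is_deriveV; rewrite gt_eqF.
  have dp : is_derive x 1 (fun y : R => p.[y^-1]) (p^`().[x^-1] * - x ^- 2).
    exact: (@is_derive1_comp _ (horner p) (fun y => y^-1)).
  have de : is_derive x 1 (fun y : R => expR (- y^-1)) (expR (- x^-1) * x ^- 2).
    apply: (@is_derive1_comp _ expR (fun y => - y^-1)).
    by rewrite -[X in is_derive _ _ _ X]opprK; exact: is_deriveN.
  have := is_deriveM dp de; set l := (X in is_derive _ _ _ X -> _).
  have -> // : l = ('X^2 * (p - p^`())).[x^-1] * expR (- x^-1).
  rewrite /l !hornerE/= /GRing.scale/= exprVn; ring.
- rewrite {2}/flat ltNge (ltW x0)/=.
  apply: (@near_eq_is_derive _ _ _ (cst 0)) => //.
  near=> y; rewrite /flat ltNge ifF//; apply/negbF/ltW; near: y.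
  exact: lt_nbhsl.
- rewrite -{}x0 {2}/flat ltxx.
  have [C [C0 hC]] := flat_decay p.
  suff h : h^-1 *: ((flat p \o shift 0) (h *: (1 : R)) - flat p 0) @[h --> 0^']
      --> (0 : R).
    by apply: DeriveDef; [apply/cvg_ex; exists 0|exact: cvg_lim].
  have f0 : flat p 0 = 0 by rewrite /flat ltxx.
  apply/cvgr0Pnorm_lt => e e0; near=> h.
  rewrite f0 subr0 /= addr0 /GRing.scale/= mulr1 normrM normfV.
  have h0 : 0 < `|h| by rewrite normr_gt0; near: h; exact: nbhs_dnbhs_neq.
  rewrite mulrC ltr_pdivrMr// (le_lt_trans (hC _))//.
  rewrite -[h ^+ 2]real_normK ?num_real// expr2 mulrA ltr_pM2r//.
  rewrite (@le_lt_trans _ _ ((C + 1) * `|h|))//.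
    by rewrite ler_wpM2r// lerDl.
  rewrite mulrC -ltr_pdivlMr ?ltr_pwDr//.
  near: h; apply: dnbhs0_lt; rewrite divr_gt0// ltr_pwDr//.
Unshelve. all: by end_near. Qed.

Lemma smooth1_flat p : smooth1 (flat p).
Proof.
move=> k; elim: k p => [//|k ih] p.
have [E dp] := derive1_is_derive (is_derive_flat p); rewrite /= E; split => //.
Qed.

Lemma flat1_ge0 x : 0 <= flat 1 x.
Proof. by rewrite /flat; case: ifP => // _; rewrite hornerC mul1r expR_ge0. Qed.

Lemma flat1_gt0 x : 0 < x -> 0 < flat 1 x.
Proof. by rewrite /flat => ->; rewrite hornerC mul1r expR_gt0. Qed.

Lemma flat1_eq0 x : x <= 0 -> flat 1 x = 0.
Proof. by rewrite /flat ltNge => ->. Qed.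

(** The classical transition f(x) / (f(x) + f(1 - x)) with f(x) = exp(-1/x) on x > 0; 1 - x is
    written in the affine form handled by [smooth1_affine]. *)
Definition sstep (x : R) : R := flat 1 x * (flat 1 x + flat 1 (- 1 * x + 1))^-1.

Lemma sstep_den_gt0 x : 0 < flat 1 x + flat 1 (- 1 * x + 1).
Proof.
have [x0|x0] := ltP 0 x; first by rewrite ltr_pwDl ?flat1_gt0 ?flat1_ge0.
by rewrite ltr_wpDl ?flat1_ge0// flat1_gt0//; lra.
Qed.

Lemma smooth1_sstep : smooth1 sstep.
Proof.
apply: smooth1M; first exact: smooth1_flat.
apply: smooth1V; first by move=> x; rewrite gt_eqF// sstep_den_gt0.
apply: smooth1D; first exact: smooth1_flat.
by apply: smooth1_affine; exact: smooth1_flat.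
Qed.

Lemma sstep0 x : x <= 0 -> sstep x = 0.
Proof. by move=> x0; rewrite /sstep flat1_eq0// mul0r. Qed.

Lemma sstep1 x : 1 <= x -> sstep x = 1.
Proof.
move=> x1; rewrite /sstep (@flat1_eq0 (- 1 * x + 1)); last by lra.
by rewrite addr0 divff// gt_eqF// flat1_gt0//; lra.
Qed.

Lemma sstep_ge0 x : 0 <= sstep x.
Proof. by rewrite divr_ge0 ?flat1_ge0// ltW// sstep_den_gt0. Qed.

Lemma sstep_le1 x : sstep x <= 1.
Proof.
rewrite /sstep ler_pdivrMr ?sstep_den_gt0// mul1r lerDl flat1_ge0//.
Qed.

Lemma derive1_out f a b c : {in `]-oo, a[, forall x, f x = c} ->
  {in `]b, +oo[, forall x, f x = c} -> forall x : R, ~~ (a <= x <= b) ->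
  derive1 f x = 0.
Proof.
move=> fa fb x; rewrite negb_and -!ltNge => xab; rewrite derive1E.
rewrite (@near_eq_derive _ _ _ f (cst c)) ?derive_cst//.
case/orP: xab => h; near=> y.
- by apply: fa; rewrite in_itv/=; near: y; exact: lt_nbhsl.
- by apply: fb; rewrite in_itv/= andbT; near: y; exact: lt_nbhsr.
Unshelve. all: by end_near. Qed.

Lemma derive1_vanish f a b : (forall x, ~~ (a <= x <= b) -> f x = 0) ->
  forall x, ~~ (a <= x <= b) -> derive1 f x = 0.
Proof.
move=> fab; apply: (@derive1_out f a b 0) => x; rewrite in_itv/= => h; apply: fab.
  by rewrite negb_and -ltNge h.
by rewrite negb_and -!ltNge; move: h; rewrite andbT => ->; rewrite orbT.
Qed.

Lemma compact_support_bounded f a b : a <= b -> continuous f ->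
  (forall x, ~~ (a <= x <= b) -> f x = 0) ->
  exists2 B : R, 0 < B & forall x, `|f x| <= B.
Proof.
move=> ab cf f0.
have cf' : {within `[a, b], continuous (fun x => `|f x|)}.
  apply: continuous_subspaceT => x; apply: cvg_norm; exact: cf.
have [c _ hc] := EVT_max ab cf'.
exists (`|f c| + 1); first by rewrite ltr_pwDr.
move=> x; case: (boolP (a <= x <= b)) => xab; last by rewrite f0// normr0 addr_ge0.
by rewrite ler_wpDr// hc// in_itv.
Qed.

End smooth_real_functions.

Section smooth_step_derivative.
Context {R : realType}.

Lemma dsstep_out (x : R) : ~~ (0 <= x <= 1) -> derive1 (@sstep R) x = 0.
Proof.
move=> x01; rewrite -[RHS](addr0 0); move: x01; rewrite negb_and -!ltNge derive1E.
case/orP => h.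
  rewrite (@near_eq_derive _ _ _ sstep (cst 0)) ?derive_cst ?addr0//.
  near=> y; apply: sstep0; apply/ltW; near: y; exact: lt_nbhsl.
rewrite (@near_eq_derive _ _ _ sstep (cst 1)) ?derive_cst ?addr0//.
near=> y; apply: sstep1; apply/ltW; near: y; exact: lt_nbhsr.
Unshelve. all: by end_near. Qed.

(** This bound controls the size of the kernels below; the bound on the second derivative, in the
    next lemma, controls the Taylor remainder when a kernel is translated. *)
Lemma dsstep_bounded : exists2 B : R, 0 < B & forall x, `|derive1 (@sstep R) x| <= B.
Proof.
apply: (@compact_support_bounded _ _ 0 1) => //; last exact: dsstep_out.
by apply: smooth1_continuous; apply: smooth1_derive; exact: smooth1_sstep.
Qed.

Lemma ddsstep_bounded :
  exists2 B : R, 0 < B & forall x, `|derive1 (derive1 (@sstep R)) x| <= B.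
Proof.
apply: (@compact_support_bounded _ _ 0 1) => //; last first.
  by apply: derive1_vanish; exact: dsstep_out.
apply: smooth1_continuous; do 2 apply: smooth1_derive; exact: smooth1_sstep.
Qed.

End smooth_step_derivative.

(** * Lebesgue measure and test functions on row vectors *)

Section row_vectors.
Context {R : realType}.
Implicit Types n : nat.

Definition evec n (i : 'I_n) : 'rV[R]_n := delta_mx 0 i.

Lemma evecE n (i j : 'I_n) : evec i 0 j = (j == i)%:R.
Proof. by rewrite /evec mxE eqxx. Qed.

Lemma ball_rV n (x y : 'rV[R]_n) e : 0 < e ->
  ball x e y <-> forall i, `|x 0 i - y 0 i| < e.
Proof.
move=> e0; split => [[_ h] i|h]; first exact: h.
by split => // i j; rewrite (ord1 i); exact: h.
Qed.

Lemma continuous_rV (T : topologicalType) n (f : T -> 'rV[R]_n) :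
  (forall i, continuous (fun t => f t 0 i)) -> continuous f.
Proof.
move=> cf t; apply/cvg_ballP => e e0.
have : \forall s \near t, forall i, `|f t 0 i - f s 0 i| < e.
  apply: filter_forall => i.
  by have /cvg_ballP := cf i t; apply.
by apply: filterS => s h; exact/ball_rV.
Qed.

Lemma measurable_continuous n (f : 'rV[R]_n -> R) :
  continuous f -> measurable_fun setT f.
Proof.
move=> cf; apply: (@measurability _ _ _ _ _ _ (@RGenOpens.G R)).
  exact: RGenOpens.measurableE.
move=> _ [_ [a [b ->]] <-]; rewrite setTI; apply: sub_sigma_algebra.
by apply: open_comp => [x _|]; [exact: cf|exact: interval_open].
Qed.

Lemma measurable_openV n (A : set 'rV[R]_n) : open A -> measurable A.
Proof. by move=> oA; exact: sub_sigma_algebra. Qed.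

Lemma measurable_closedV n (A : set 'rV[R]_n) : closed A -> measurable A.
Proof.
move=> cA; rewrite -[A]setCK; apply: measurableC; apply: measurable_openV.
exact: closed_openC.
Qed.

Lemma measurable_compactV n (A : set 'rV[R]_n) : compact A -> measurable A.
Proof.
by move=> cA; apply: measurable_closedV; apply: compact_closed => //;
   exact: norm_hausdorff.
Qed.

Lemma compact_rV_box n (a b : 'I_n -> R) : compact (rV_box a b).
Proof. by apply: (@rV_compact R n (fun i => [set` `[a i, b i]])) => i; exact: segment_compact. Qed.

Lemma rV_consEr n (v : 'rV[R]_n) (x : R) : rV_cons (v, x) 0 ord0 = x.
Proof. by rewrite mxE unlift_none. Qed.

Lemma rV_consEl n (v : 'rV[R]_n) (x : R) j : rV_cons (v, x) 0 (lift ord0 j) = v 0 j.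
Proof. by rewrite mxE liftK. Qed.

(** Incrementing a slice variable is moving along a basis vector: difference quotients of a slice
    are those of the function, so partial derivatives can be treated by induction on the
    dimension. *)
Lemma rV_cons_addr n (v : 'rV[R]_n) (x h : R) :
  rV_cons (v, h + x) = h *: evec ord0 + rV_cons (v, x).
Proof.
apply/rowP => j; rewrite [RHS]mxE [X in _ = X + _]mxE evecE.
case: (unliftP ord0 j) => [k|] ->; last by rewrite !rV_consEr eqxx mulr1.
by rewrite !rV_consEl -(inj_eq (@ord_inj _)) /= mulr0 add0r.
Qed.

Lemma rV_cons_addl n (v : 'rV[R]_n) (x h : R) i :
  rV_cons (h *: evec i + v, x) = h *: evec (lift ord0 i) + rV_cons (v, x).
Proof.
apply/rowP => j; rewrite [RHS]mxE [X in _ = X + _]mxE evecE.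
case: (unliftP ord0 j) => [k|] ->; last by rewrite !rV_consEr mulr0 add0r.
rewrite !rV_consEl !mxE eqxx (inj_eq (@lift_inj _ _)).
by [].
Qed.

Lemma continuous_rV_consr n (v : 'rV[R]_n) : continuous (fun x => rV_cons (v, x)).
Proof.
apply: continuous_rV => i; case: (unliftP ord0 i) => [k|] ->.
  by under eq_fun do rewrite rV_consEl; exact: cst_continuous.
by under eq_fun do rewrite rV_consEr; move=> x; exact: cvg_id.
Qed.

Lemma continuous_rV_consl n (x : R) : continuous (fun v : 'rV[R]_n => rV_cons (v, x)).
Proof.
apply: continuous_rV => i; case: (unliftP ord0 i) => [k|] ->.
  by under eq_fun do rewrite rV_consEl; move=> v; exact: coord_continuous.
by under eq_fun do rewrite rV_consEr; exact: cst_continuous.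
Qed.

Lemma derive_rV_consr n (f : 'rV[R]_n.+1 -> R) v x :
  derivable f (rV_cons (v, x)) (evec ord0) ->
  is_derive x 1 (fun y => f (rV_cons (v, y))) ('D_(evec ord0) f (rV_cons (v, x))).
Proof.
have E : (fun h : R => h^-1 *: (((fun y => f (rV_cons (v, y))) \o shift x)
    (h *: (1 : R)) - f (rV_cons (v, x)))) =
  (fun h => h^-1 *: ((f \o shift (rV_cons (v, x))) (h *: evec ord0) -
    f (rV_cons (v, x)))).
  by apply/funext => h /=; rewrite -rV_cons_addr /GRing.scale/= mulr1.
by move=> df; apply: DeriveDef; rewrite /derivable /derive E.
Qed.

Lemma derive_rV_consl n (f : 'rV[R]_n.+1 -> R) v x i :
  derivable f (rV_cons (v, x)) (evec (lift ord0 i)) ->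
  is_derive v (evec i) (fun w => f (rV_cons (w, x)))
    ('D_(evec (lift ord0 i)) f (rV_cons (v, x))).
Proof.
have E : (fun h : R => h^-1 *: (((fun w => f (rV_cons (w, x))) \o shift v)
    (h *: evec i) - f (rV_cons (v, x)))) =
  (fun h => h^-1 *: ((f \o shift (rV_cons (v, x))) (h *: evec (lift ord0 i)) -
    f (rV_cons (v, x)))).
  by apply/funext => h /=; rewrite -rV_cons_addl.
by move=> df; apply: DeriveDef; rewrite /derivable /derive E.
Qed.

Lemma near_outside_box n (x : 'rV[R]_n) (M : R) j : M < `|x 0 j| ->
  \forall y \near x, M < `|(y : 'rV[R]_n) 0 j|.
Proof.
move=> Mx; have cf : continuous (fun y : 'rV[R]_n => `|y 0 j|).
  by move=> y; apply: continuous_comp; [exact: coord_continuous|exact: norm_continuous].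
exact: (cf x) (lt_nbhsr Mx).
Qed.

Lemma derive_outside n (f : 'rV[R]_n -> R) M v :
  (forall x : 'rV[R]_n, (exists j, M < `|x 0 j|) -> f x = 0) ->
  forall x : 'rV[R]_n, (exists j, M < `|x 0 j|) -> 'D_v f x = 0.
Proof.
move=> f0 x [j Mx]; rewrite (@near_eq_derive _ _ _ f (cst 0)) ?derive_cst//.
by near=> y; apply: f0; exists j; near: y; exact: near_outside_box.
Unshelve. all: by end_near. Qed.

End row_vectors.
Arguments evec {R n} i.

Section lebesgue_row_vectors.
Context {R : realType}.
Implicit Types n : nat.

Lemma rV_boxM n (M : R) (x : 'rV[R]_n) :
  rV_box (fun=> - M) (fun=> M) x <-> forall i, `|x 0 i| <= M.
Proof.
by split => h i; have := h i; rewrite /= in_itv/= ler_norml.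
Qed.

Lemma lebesgue_rV_sigma_finite n :
  sigma_finite [set: 'rV[R]_n] (lebesgue_rV R n).
Proof.
exists (fun k => rV_box (fun=> - k%:R) (fun=> k%:R)); last first.
  move=> k; split; first exact: measurable_rV_box.
  by rewrite lebesgue_rV_box ?ltry// => i; rewrite ge0_cp.
rewrite eqEsubset; split => x // _.
have [k _ hk] : exists2 k : nat, True & `|x| <= k%:R.
  by exists (Num.truncn `|x|).+1 => //; rewrite ltW// truncnS_gt.
exists k => //; apply/rV_boxM => i; apply: le_trans hk.
by rewrite [leRHS]/Num.norm/= mx_normrE; apply: (le_bigmax _ (fun ij => `|x ij.1 ij.2|) (0, i)).
Qed.

(** An alias that carries the sigma-finiteness used by Fubini's theorem and by the Radon-Nikodym
    theorem. *)
Definition leb n : set 'rV[R]_n -> \bar R := lebesgue_rV R n.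
HB.instance Definition _ n := Measure.on (@leb n).
HB.instance Definition _ n := @Measure_isSigmaFinite.Build _ _ R (@leb n)
  (lebesgue_rV_sigma_finite n).

Let pm n : {measure set (_ * _)%type -> \bar R} :=
  (@leb n \x @lebesgue_measure R)%E.

(** Both orders of integration are kept: the head coordinate is integrated inside when it is the
    differentiated one, and outside otherwise. *)
Lemma integral_rV_lr n (f : 'rV[R]_n.+1 -> R) : measurable_fun setT f ->
  (lebesgue_rV R n.+1).-integrable setT (EFin \o f) ->
  (\int[lebesgue_rV R n.+1]_x (f x)%:E =
   \int[lebesgue_rV R n]_v \int[lebesgue_measure]_x (f (rV_cons (v, x)))%:E)%E /\
  (\int[lebesgue_rV R n.+1]_x (f x)%:E =
   \int[lebesgue_measure]_x \int[lebesgue_rV R n]_v (f (rV_cons (v, x)))%:E)%E.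
Proof.
move=> mf intf; pose g z := (f (@rV_cons R n z))%:E.
have mg : measurable_fun setT g.
  by apply/measurable_EFinP; exact: measurableT_comp mf (@measurable_rV_cons R n).
have mef : measurable_fun setT (EFin \o f) by exact/measurable_EFinP.
have intg : (@leb n \x @lebesgue_measure R)%E.-integrable setT g.
  apply/integrableP; split => //.
  have /integrableP[_] := intf.
  have h := (fun phi mphi => @ge0_integral_pushforward _ _ _ _ R phi mphi
    (@pm n) setT (fun x => `|(f x)%:E|)%E measurableT)
    _ (@measurable_rV_cons R n).
  rewrite [X in (X < _)%E -> _]h//; last exact: measurableT_comp.
have E : (\int[lebesgue_rV R n.+1]_x (f x)%:E =
    \int[(@leb n \x @lebesgue_measure R)%E]_z g z)%E.
  exact: ((fun phi mphi => @integral_pushforward _ _ _ _ R phi mphi (@pm n) setT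
    (EFin \o f) mef) _ (@measurable_rV_cons R n) intg measurableT).
split; rewrite E; first by rewrite -integral12_prod_meas1.
by rewrite -integral21_prod_meas1.
Qed.

Lemma integrable_box n (f : 'rV[R]_n -> R) (M : R) : measurable_fun setT f ->
  (exists C, forall x, `|f x| <= C) ->
  (forall x : 'rV[R]_n, (exists j, M < `|x 0 j|) -> f x = 0) ->
  (lebesgue_rV R n).-integrable setT (EFin \o f).
Proof.
move=> mf [C fC] f0; have [M0|M0] := leP 0 M; last first.
  (* For [M < 0] the hypothesis forces [f = 0] as soon as [n > 0]. For [n = 0] it is vacuous, but
     the measure is a Dirac mass and a bounded function is integrable. *)
  have -> : f = if n is 0%N then f else cst 0.
    case: n f mf fC f0 => //= n f _ _ f0; apply/funext => x; apply: f0.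
    by exists ord0; exact: lt_le_trans M0 _.
  case: n f mf fC f0 => [|n] f mf fC f0; last exact: integrable0.
  apply: (@measurable_bounded_integrable _ _ _ (lebesgue_rV R 0)) => //.
    by rewrite /= diracE; case: (_ \in _); rewrite ltry.
  by exists C; split; [exact: num_real|move=> y /ltW Cy x _ /=; exact: le_trans Cy].
have mB : measurable (rV_box (fun=> - M) (fun=> M) : set 'rV[R]_n).
  exact: measurable_rV_box.
have -> : EFin \o f = (EFin \o f) \_ (rV_box (fun=> - M) (fun=> M)).
  apply/funext => x; rewrite patchE; case: ifPn => // /negP xB.
  rewrite /= f0//; apply/not_existsP => h; apply: xB; rewrite inE.
  by apply/rV_boxM => i; rewrite leNgt; apply/negP; exact: h.
apply/(integrable_mkcond _ mB).
apply: (@measurable_bounded_integrable _ _ _ (lebesgue_rV R n)) => //.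
- by rewrite lebesgue_rV_box ?ltry// => i; rewrite ge0_cp.
- exact: measurable_funTS.
- by exists C; split; [exact: num_real|move=> y /ltW Cy x _ /=; exact: le_trans Cy].
Qed.

Lemma continuous_box_bounded n (f : 'rV[R]_n -> R) (M : R) : continuous f ->
  (forall x : 'rV[R]_n, (exists j, M < `|x 0 j|) -> f x = 0) ->
  exists C, forall x, `|f x| <= C.
Proof.
move=> cf f0; have cB := @compact_rV_box R n (fun=> - M) (fun=> M).
have outB x : ~ rV_box (fun=> - M) (fun=> M) x -> f x = 0.
  move=> xB; apply: f0; apply/not_existsP => h; apply: xB.
  by apply/rV_boxM => i; rewrite leNgt; apply/negP; exact: h.
have [B0|/set0P B0] := eqVneq (rV_box (fun=> - M) (fun=> M) : set 'rV[R]_n) set0.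
  by exists 0 => x; rewrite outB ?normr0// B0.
have cf' : {within (rV_box (fun=> - M) (fun=> M)), continuous (fun x => `|f x|)}.
  by apply: continuous_subspaceT => x; apply: continuous_comp; [exact: cf|exact: norm_continuous].
have [c _ hc] := EVT_max_rV B0 cB cf'.
exists `|f c| => x; have [xB|xB] := pselect (rV_box (fun=> - M) (fun=> M) x).
  by apply: hc; rewrite inE.
by rewrite outB// normr0.
Qed.

Lemma integrable_continuous_box n (f : 'rV[R]_n -> R) (M : R) : continuous f ->
  (forall x : 'rV[R]_n, (exists j, M < `|x 0 j|) -> f x = 0) ->
  (lebesgue_rV R n).-integrable setT (EFin \o f).
Proof.
move=> cf f0; apply: (integrable_box (measurable_continuous cf) _ f0).
exact: continuous_box_bounded f0.
Qed.

(** The end values may differ: 0 and 0 give the vanishing integral of a derivative with compact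
    support, 0 and 1 the unit mass of the kernels. *)
Lemma integral_derive1 (g g' : R -> R) a b c1 c2 : a < b ->
  (forall x : R, is_derive x 1 g (g' x)) -> continuous g' ->
  (forall x, x <= a -> g x = c1) -> (forall x, b <= x -> g x = c2) ->
  (\int[lebesgue_measure]_x (g' x)%:E = (c2 - c1)%:E)%E.
Proof.
move=> ab dg cg' ga gb.
have [E dg'] := derive1_is_derive dg.
have E0 x : ~~ (a <= x <= b) -> g' x = 0.
  rewrite -E negb_and -!ltNge derive1E => /orP[h|h].
    rewrite (@near_eq_derive _ _ _ g (cst c1)) ?derive_cst//.
    by near=> y; apply: ga; apply: ltW; near: y; exact: lt_nbhsl.
  rewrite (@near_eq_derive _ _ _ g (cst c2)) ?derive_cst//.
  by near=> y; apply: gb; apply: ltW; near: y; exact: lt_nbhsr.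
transitivity (\int[lebesgue_measure]_(x in `[a, b]) (g' x)%:E)%E.
  rewrite [RHS]integral_mkcond; apply: eq_integral => x _; rewrite patchE.
  by case: ifPn => //; rewrite mem_setE in_itv/= => /E0 ->.
rewrite (continuous_FTC2 ab (F := g)).
- by rewrite (ga _ (lexx a)) (gb _ (lexx b)).
- by apply: continuous_subspaceT => x; exact: cg'.
- have cg : continuous g.
    by move=> x; apply/differentiable_continuous/derivable1_diffP.
  split.
  + by move=> x _.
  + exact/cvg_at_right_filter/cg.
  + exact/cvg_at_left_filter/cg.
- by move=> x _; rewrite E.
Unshelve. all: by end_near. Qed.

(** If the head variable is the differentiated one, the inner integral vanishes by the fundamental
    theorem of calculus; otherwise the head variable is frozen and the induction hypothesis applies
    to the slice. *)
Lemma integral_partial0 n (i : 'I_n) (f : 'rV[R]_n -> R) (M : R) :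
  (forall x, derivable f x (evec i)) -> continuous ('D_(evec i) f) ->
  (forall x : 'rV[R]_n, (exists j, M < `|x 0 j|) -> f x = 0) ->
  (\int[lebesgue_rV R n]_x ('D_(evec i) f x)%:E = 0)%E.
Proof.
elim: n i f => [[]//|n ih] i f df cf f0.
have D0 := derive_outside (evec i) f0.
have [E1 E2] := integral_rV_lr (measurable_continuous cf)
  (integrable_continuous_box cf D0).
case: (unliftP ord0 i) df cf D0 E1 E2 => [j|] -> df cf D0 E1 E2.
  rewrite E2; apply: integral0_eq => x _.
  have [Mx|Mx] := ltP M `|x|.
    by apply: integral0_eq => v _; rewrite D0//; exists ord0; rewrite rV_consEr.
  have dE v := derive_rV_consl (df (rV_cons (v, x))).
  have E : (fun v => 'D_(evec (lift ord0 j)) f (rV_cons (v, x))) =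
      'D_(evec j) (fun v => f (rV_cons (v, x))).
    by apply/funext => v; have [_ ->] := dE v.
  have {}ih := ih j (fun v => f (rV_cons (v, x))).
  under eq_integral do rewrite (congr1 (fun g => g _) E).
  apply: ih.
  - by move=> v; have [] := dE v.
  - rewrite -E => v; apply: (@continuous_comp _ _ _ (fun v => rV_cons (v, x)) ('D_(evec (lift ord0 j)) f)).
      exact: continuous_rV_consl.
    exact: cf.
  - by move=> v [k hk]; apply: f0; exists (lift ord0 k); rewrite rV_consEl.
rewrite E1; apply: integral0_eq => v _.
have dE x := derive_rV_consr (df (rV_cons (v, x))).
(* A strictly positive radius above [M]: [M] may be negative, and the interval must be
   nondegenerate. *)
pose N := `|M| + 1.
have MN : M < N by rewrite /N (le_lt_trans (ler_norm _))// ltrDl.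
have N0 : 0 < N by rewrite ltr_pwDr.
rewrite (@integral_derive1 (fun x => f (rV_cons (v, x))) _ (- N) N 0 0)//.
- by rewrite subrr.
- by rewrite gtrN.
- move=> x; apply: (@continuous_comp _ _ _ (fun x => rV_cons (v, x)) ('D_(evec ord0) f)).
    exact: continuous_rV_consr.
  exact: cf.
- move=> x xN; apply: f0; exists ord0; rewrite rV_consEr.
  by rewrite (lt_le_trans MN)// -normrN (le_trans _ (ler_norm _))// lerNr.
- move=> x xN; apply: f0; exists ord0; rewrite rV_consEr.
  by rewrite (lt_le_trans MN)// (le_trans xN)// ler_norm.
Qed.

End lebesgue_row_vectors.

(** * Test functions built as products of one-variable functions *)

Section tensor_products.
Context {R : realType} {n : nat}.
Implicit Types beta : 'I_n -> R -> R.
Local Notation V := 'rV[R]_n.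

Definition tensor beta (y : V) : R := \prod_(i < n) beta i (y 0 i).

Definition upd beta (i : 'I_n) (g : R -> R) : 'I_n -> R -> R :=
  fun j => if j == i then g else beta j.

Lemma updE beta i g : upd beta i g i = g.
Proof. by rewrite /upd eqxx. Qed.

Lemma tensor_split beta i y :
  tensor beta y = beta i (y 0 i) * \prod_(j < n | j != i) beta j (y 0 j).
Proof. by rewrite /tensor (bigD1 i). Qed.

Lemma tensor_upd beta i g y : tensor (upd beta i g) y =
  g (y 0 i) * \prod_(j < n | j != i) beta j (y 0 j).
Proof.
rewrite (tensor_split _ i) updE; congr (_ * _).
by apply: eq_bigr => j /negbTE ji; rewrite /upd ji.
Qed.

Lemma is_derive_tensor beta i (y : V) l : is_derive (y 0 i) 1 (beta i) l ->
  is_derive y (evec i) (tensor beta)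
    (l * \prod_(j < n | j != i) beta j (y 0 j)).
Proof.
set P := \prod_(j < n | j != i) _ => db.
have E : (fun h : R => h^-1 *: ((tensor beta \o shift y) (h *: evec i) -
      tensor beta y)) =
    (fun h : R => P *: (h^-1 *: ((beta i \o shift (y 0 i)) (h *: (1 : R)) -
      beta i (y 0 i)))).
  apply/funext => h; rewrite /= !(tensor_split _ i).
  have -> : \prod_(j < n | j != i) beta j ((h *: evec i + y) 0 j) = P.
    apply: eq_bigr => j /negbTE ji.
    by rewrite mxE [X in X + _]mxE evecE ji mulr0 add0r.
  have -> : (h *: evec i + y) 0 i = h + y 0 i by rewrite !mxE !eqxx mulr1.
  rewrite -/P /GRing.scale/= mulr1; ring.
have [dbeta Dbeta] := db.
have h : h^-1 *: ((tensor beta \o shift y) (h *: evec i) - tensor beta y)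
    @[h --> 0^'] --> l * P.
  rewrite E mulrC -[P * l]/(P *: l); apply: cvgZr.
  by rewrite -Dbeta; exact: dbeta.
by apply: DeriveDef; [apply/cvg_ex; exists (l * P)|exact: cvg_lim].
Qed.

Definition smooths beta := forall i, smooth1 (beta i).

Lemma smooths_upd beta i g : smooths beta -> smooth1 g -> smooths (upd beta i g).
Proof. by move=> sb sg j; rewrite /upd; case: ifP. Qed.

Lemma derive_tensor beta i : smooths beta ->
  'D_(evec i) (tensor beta) = tensor (upd beta i (derive1 (beta i))).
Proof.
move=> sb; apply/funext => y; rewrite tensor_upd.
by have [_ ->] := is_derive_tensor (smooth1_is_derive (y 0 i) (sb i)).
Qed.

Lemma derivable_tensor beta i y : smooths beta ->
  derivable (tensor beta) y (evec i).
Proof.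
by move=> sb; have [] := is_derive_tensor (smooth1_is_derive (y 0 i) (sb i)).
Qed.

Lemma continuous_tensor beta : (forall i, continuous (beta i)) ->
  continuous (tensor beta).
Proof.
rewrite /tensor => cb; elim: (index_enum _) => [|i r ih] y.
  have -> : (fun y : V => \prod_(i <- [::]) beta i (y 0 i)) = cst 1.
    by apply/funext => z; rewrite big_nil.
  exact: cst_continuous.
have -> : (fun y : V => \prod_(j <- i :: r) beta j (y 0 j)) =
    (fun y : V => beta i (y 0 i) * \prod_(j <- r) beta j (y 0 j)).
  by apply/funext => z; rewrite big_cons.
have h : continuous (beta i \o (fun y : V => y 0 i)).
  by move=> z; apply: continuous_comp; [exact: coord_continuous|exact: cb].
by apply: cvgM; [exact: (nbhs_filter y)|exact: h|exact: ih].
Qed.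

(** Products of smooth factors are stable under every partial derivative, so that smoothness reduces
    to continuity and derivability of such products. *)
Lemma partial_tensor beta s : smooths beta ->
  exists2 beta', smooths beta' & partial s (tensor beta) = tensor beta'.
Proof.
move=> sb; elim: s => [|i s [b' sb' E]] /=; first by exists beta.
exists (upd b' i (derive1 (b' i))).
  by apply: smooths_upd => //; exact: smooth1_derive.
by rewrite E; exact: derive_tensor.
Qed.

Lemma smooth_tensor beta : smooths beta -> smooth (tensor beta).
Proof.
move=> sb s; have [b' sb' ->] := partial_tensor s sb; split.
  by apply: continuous_tensor => i; exact: smooth1_continuous.
by move=> i x; exact: derivable_tensor.
Qed.

Definition supported beta (a b : 'I_n -> R) :=
  forall i x, ~~ (a i <= x <= b i) -> beta i x = 0.

Lemma supported_upd beta a b i g : supported beta a b ->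
  (forall x, ~~ (a i <= x <= b i) -> g x = 0) -> supported (upd beta i g) a b.
Proof. by move=> sb sg j x; rewrite /upd; case: eqP => [->|_]; [exact: sg|exact: sb]. Qed.

Lemma tensor_out beta a b y : supported beta a b -> ~ rV_box a b y ->
  tensor beta y = 0.
Proof.
move=> sb /existsNP[i yi]; rewrite (tensor_split _ i) sb ?mul0r//.
by apply/negP => h; apply: yi; rewrite /= in_itv.
Qed.

Lemma closed_rV_box (a b : 'I_n -> R) : closed (rV_box a b).
Proof. by apply: compact_closed; [exact: norm_hausdorff|exact: compact_rV_box]. Qed.

Lemma closed_support_tensor beta a b : supported beta a b ->
  closed_support (tensor beta) `<=` rV_box a b.
Proof.
move=> sb; rewrite /closed_support closureE => y; apply; split.
  exact: closed_rV_box.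
move=> z /= /eqP z0; apply: contrapT => /(tensor_out sb); exact: z0.
Qed.

Lemma test_function_tensor (D : set V) beta a b : smooths beta ->
  supported beta a b -> rV_box a b `<=` D -> test_function D (tensor beta).
Proof.
move=> sm sb abD; have sup := closed_support_tensor sb; split.
- exact: smooth_tensor.
- apply: subclosed_compact sup; [exact: closed_closure|exact: compact_rV_box].
- exact: subset_trans abD.
Qed.

End tensor_products.

Section integral_tensor.
Context {R : realType}.

Lemma integral_tensor n (beta : 'I_n -> R -> R) (a b : 'I_n -> R) :
  (forall i, continuous (beta i)) -> supported beta a b ->
  (forall i, \int[lebesgue_measure]_x (beta i x)%:E = 1%:E)%E ->
  (\int[lebesgue_rV R n]_x (tensor beta x)%:E = 1)%E.
Proof.
elim: n beta a b => [|n ih] beta a b cb sb ib.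
  rewrite /= integral_dirac//= ?diracT ?mul1e /tensor ?big_ord0//.
  under eq_fun do rewrite /tensor big_ord0.
  exact/measurable_EFinP/measurable_cst.
have ct := continuous_tensor cb.
(* Radius of a centred box that contains the supporting box, whatever the signs of [a] and [b]. *)
pose M := \sum_i (`|a i| + `|b i|).
have t0 (x : 'rV[R]_n.+1) : (exists j, M < `|x 0 j|) -> tensor beta x = 0.
  move=> [j Mj]; apply: (tensor_out sb) => /(_ j); rewrite /= in_itv/= => xj.
  have : `|x 0 j| <= M.
    rewrite /M (bigD1 j)//= -[leLHS]addr0 lerD ?sumr_ge0//.
    have := ler_norm (- a j); have := ler_norm (b j); rewrite normrN.
    have := normr_ge0 (a j); have := normr_ge0 (b j).
    by rewrite ler_norml; lra.
  by rewrite leNgt Mj.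
have [-> _] := integral_rV_lr (measurable_continuous ct) (integrable_continuous_box ct t0).
rewrite -(ih (fun j => beta (lift ord0 j)) (fun j => a (lift ord0 j)) (fun j => b (lift ord0 j))); last 3 first.
- by move=> i; exact: cb.
- by move=> i x; exact: sb.
- by move=> i; exact: ib.
apply: eq_integral => v _.
have E x : tensor beta (rV_cons (v, x)) =
    tensor (fun j => beta (lift ord0 j)) v * beta ord0 x.
  rewrite /tensor big_ord_recl rV_consEr mulrC; congr (_ * _).
  by apply: eq_bigr => j _; rewrite rV_consEl.
under eq_integral do rewrite E EFinM.
rewrite integralZl//; first by rewrite ib mule1.
have : (@lebesgue_measure R).-integrable `[a ord0, b ord0] (EFin \o beta ord0).
  apply: continuous_compact_integrable; first exact: segment_compact.
  by apply: continuous_subspaceT => x; exact: cb.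
move/(integrable_mkcond _ _).1; move/(_ (measurable_itv _)).
congr (integrable _ _ _); apply/funext => x; rewrite patchE; case: ifPn => //.
by rewrite mem_setE in_itv/= => xab; rewrite /= sb.
Qed.

End integral_tensor.

(** * Comparison of measures on cubes *)

Section regularity.
Context {R : realType} {n : nat}.
Local Notation V := 'rV[R]_n.
Variable rho : {measure set V -> \bar R}.
Hypothesis rho_fin : (rho setT < +oo)%E.

Let regular (A : set V) := forall e : R, 0 < e ->
  exists F G : set V, [/\ closed F, open G, F `<=` A, A `<=` G &
    (rho (G `\` F) <= e%:E)%E].

Let fin A : measurable A -> (rho A < +oo)%E.
Proof.
by move=> mA; apply: le_lt_trans rho_fin; apply: le_measure; rewrite ?inE.
Qed.

Let mG (G : set V) : open G -> measurable G. Proof. exact: measurable_openV. Qed.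
Let mF (F : set V) : closed F -> measurable F. Proof. exact: measurable_closedV. Qed.

(** An open set is the increasing union of the closed sets [F k] of points at distance at least
    1/(k+1) from its complement; finiteness of [rho] gives continuity from above on the
    differences. *)
Let regular_open G : open G -> regular G.
Proof.
move=> oG e e0.
pose F (k : nat) : set V := ~` \bigcup_(y in ~` G) ball y k.+1%:R^-1.
have cF k : closed (F k).
  apply: open_closedC; apply: bigcup_open => y _; exact: ball_open.
have FG k : F k `<=` G.
  by move=> x Fx; apply: contrapT => nG; apply: Fx; exists x => //; exact: ballxx.
have dec : nonincreasing_seq (fun k => G `\` F k).
  apply/nonincreasing_seqP => k; apply/subsetPset => x [Gx nF]; split => // Fk.
  apply: nF => -[y ny yx]; apply: Fk; exists y => //.
  by apply: le_ball yx; rewrite lef_pV2 ?posrE// ler_nat.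
have I0 : \bigcap_k (G `\` F k) = set0.
  apply/seteqP; split => // x h; have [Gx _] := h 0%N I.
  have /nbhs_ballP[d /= d0 xdG] : nbhs x G by exact: open_nbhs_nbhs.
  have [k _ kh] := near_infty_natSinv_lt (PosNum d0).
  have [_ nF] := h k I; apply: nF => -[y ny yx]; apply: ny; apply: xdG.
  apply: ball_sym; apply: le_ball yx; apply: ltW; exact: (kh k (leqnn k)).
have := nonincreasing_cvg_mu (mu := rho) (F := fun k => G `\` F k).
rewrite I0 measure0 => cv.
have {}cv : (rho \o (fun k => G `\` F k)) k @[k --> \oo] --> (0%:E : \bar R).
  have mk k : measurable (G `\` F k) by apply: measurableD; [exact: mG|exact: mF].
  by apply: cv => //; exact: fin.
have /fine_cvgP[_ cv'] := cv.
have [N _ hN] : \forall k \near \oo, (rho (G `\` F k) < e%:E)%E.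
  have /cvgr0Pnorm_lt/(_ e e0) := cv'.
  apply: filterS => k /=; have mk : measurable (G `\` F k).
    by apply: measurableD; [exact: mG|exact: mF].
  rewrite ger0_norm ?fine_ge0// => h.
  by rewrite -[rho _]fineK ?lte_fin// ge0_fin_numE// fin.
exists (F N), G; split => //; apply/ltW/hN.
exact: leqnn.
Qed.

(** The regular sets form a sigma-algebra that contains the open sets. *)
Lemma regular_borel A : measurable A -> regular A.
Proof.
move: A; apply: smallest_sub; last by move=> G; exact: regular_open.
split.
- move=> e e0; exists set0, set0; split.
  + exact: closed0.
  + exact: open0.
  + by [].
  + by [].
  + by rewrite set0D measure0 lee_fin ltW.
- move=> A rA e e0; have [F [G [cF oG FA AG h]]] := rA e e0.
  rewrite setTD; exists (~` G), (~` F); split.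
  + exact: open_closedC.
  + exact: closed_openC.
  + exact: subsetC.
  + exact: subsetC.
  + by rewrite setDE setCK setIC -setDE.
- move=> A rA e e0.
  have e2 : 0 < e / 2 by rewrite divr_gt0.
  have ek k : 0 < (e / 2) / (2 ^ k.+1)%:R.
    by rewrite divr_gt0// ltr0n expn_gt0.
  have /choice[F hF] : forall k, exists F : set V, exists G : set V,
      [/\ closed F, open G, F `<=` A k, A k `<=` G &
      (rho (G `\` F) <= ((e / 2) / (2 ^ k.+1)%:R)%:E)%E].
    by move=> k; have [F [G h]] := rA k _ (ek k); exists F, G.
  have /choice[G hG] := hF.
  have cF k : closed (F k) by have [] := hG k.
  have oG k : open (G k) by have [] := hG k.
  (* The union of all the [F k] need not be closed. A finite union [UF N] is used, and the rest is
     small for large [N] by continuity from above; hence the two halves of [e]. *)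
  pose UG := \bigcup_k G k; pose UF m := \big[setU/set0]_(k < m) F k.
  have oUG : open UG by apply: bigcup_open.
  have cUF m : closed (UF m) by apply: closed_bigsetU.
  pose X := \bigcup_k F k.
  have mX : measurable X by apply: bigcupT_measurable => k; exact: mF.
  have h1 : (rho (UG `\` X) <= (e / 2)%:E)%E.
    apply: (le_trans _ (epsilon_trick0 xpredT (ltW e2))).
    apply: (@le_trans _ _ (\sum_(k <oo) rho (G k `\` F k))%E); last first.
      by apply: lee_nneseries => // k _; have [] := hG k.
    apply: measure_sigma_subadditive.
    - by move=> k; apply: measurableD; [exact: mG|exact: mF].
    - by apply: measurableD; [exact: mG|].
    - move=> x [[k _ Gx] nX]; exists k => //; split => // Fx.
      by apply: nX; exists k.
  have XE : X = \bigcup_m UF m.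
    apply/seteqP; split => x [k _]; rewrite ?/UF -?bigcup_mkord.
      by move=> Fx; exists k.+1 => //; rewrite /UF -bigcup_mkord; exists k => /=.
    by move=> [j _ Fx]; exists j.
  have dec : nonincreasing_seq (fun m => X `\` UF m).
    apply/nonincreasing_seqP => m; apply/subsetPset => x [Xx h]; split => // h'.
    by apply: h; rewrite /UF big_ord_recr/=; left.
  have I0 : \bigcap_m (X `\` UF m) = set0.
    apply/seteqP; split => // x h; have [Xx _] := h 0%N I.
    move: Xx; rewrite XE => -[m _ xm]; have [_] := h m I; exact.
  have mm m : measurable (X `\` UF m).
    by apply: measurableD => //; exact: mF.
  have cv : (rho \o (fun k => X `\` UF k)) k @[k --> \oo] --> (0%:E : \bar R).
    have := nonincreasing_cvg_mu (mu := rho) (F := fun k => X `\` UF k).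
    rewrite I0 measure0 => cv; apply: cv => //; exact: fin.
  have /fine_cvgP[_ cv'] := cv.
  have [N _ hN] : \forall k \near \oo, (rho (X `\` UF k) < (e / 2)%:E)%E.
    have /cvgr0Pnorm_lt/(_ _ e2) := cv'.
    apply: filterS => k /=; rewrite ger0_norm ?fine_ge0// => h.
    by rewrite -[rho _]fineK ?lte_fin// ge0_fin_numE// fin.
  exists (UF N), UG; split => //.
  + move=> x; rewrite /UF -bigcup_mkord => -[k _ Fx]; exists k => //.
    by have [_ _ + _ _] := hG k; apply.
  + by move=> x [k _ Ax]; exists k => //; have [_ _ _ + _] := hG k; apply.
  + have -> : e%:E = ((e / 2)%:E + (e / 2)%:E)%E by rewrite -EFinD -splitr.
    apply: (@le_trans _ _ (rho (UG `\` X) + rho (X `\` UF N))%E); last first.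
      by apply: leeD => //; apply/ltW/hN => /=.
    apply: (le_trans _ (measureU2 rho _ _)) => //; last first.
      by apply: measurableD => //; exact: mG.
    apply: le_measure; rewrite ?inE.
    * by apply: measurableD; [exact: mG|exact: mF].
    * by apply: measurableU => //; apply: measurableD => //; exact: mG.
    * move=> x [Gx nx]; have [Xx|Xx] := pselect (X x); first by right.
      by left.
Qed.

End regularity.

(** * From dyadic cubes to open sets and Borel sets *)

Section dyadic_cubes.
Context {R : realType} {n : nat}.
Local Notation V := 'rV[R]_n.

Definition ccube (a : V) (l : R) : set V :=
  rV_box (fun i => a 0 i) (fun i => a 0 i + l).

(** Half-open, so that the dyadic cubes of one generation partition the space; [ccube] is the
    compact companion. *)
Definition hcube (a : V) (l : R) : set V :=
  [set y | forall i, a 0 i <= y 0 i < a 0 i + l].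

Lemma hcube_ccube a l : hcube a l `<=` ccube a l.
Proof. by move=> y h i; have /andP[h1 h2] := h i; rewrite /= in_itv/= h1 ltW. Qed.

Lemma measurable_hcube a l : measurable (hcube a l).
Proof.
have -> : hcube a l = \bigcap_(i in [set: 'I_n])
    ((fun x : V => x 0 i) @^-1` [set` `[a 0 i, a 0 i + l[]).
  rewrite eqEsubset; split => x h i; first by move=> _; have := h i; rewrite /= in_itv.
  by have := h i I; rewrite /= in_itv.
apply: fin_bigcap_measurable => // i _.
rewrite -[X in measurable X]setTI.
exact: measurable_coord.
Qed.

Let side k : R := 2 ^- k.
Let side_gt0 k : 0 < side k. Proof. by rewrite invr_gt0 exprn_gt0. Qed.

Let corner k (m : 'rV[int]_n) : V := \row_i ((m 0 i)%:~R * side k).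
Let idx k (x : V) : 'rV[int]_n := \row_i Num.floor (x 0 i * 2 ^+ k).

Let idxP k x m : hcube (corner k m) (side k) x <-> idx k x = m.
Proof.
have E i : (corner k m 0 i <= x 0 i < corner k m 0 i + side k) =
    (Num.floor (x 0 i * 2 ^+ k) == m 0 i).
  rewrite mxE -[X in _ + X]mul1r -mulrDl ler_pdivrMr ?exprn_gt0//.
  by rewrite ltr_pdivlMr ?exprn_gt0// floor_eq// intrD.
split => [h|E0 i]; last by rewrite E -E0 mxE.
by apply/rowP => i; rewrite mxE; apply/eqP; rewrite -E.
Qed.

(** An index of generation k+1 is 2m or 2m+1, with m the index of generation k: the closed dyadic
    cubes around a point are nested. *)
Let idxS k x : ccube (corner k.+1 (idx k.+1 x)) (side k.+1) `<=`
  ccube (corner k (idx k x)) (side k).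
Proof.
move=> y h i; have := h i; rewrite /= !in_itv/= !mxE.
set m' := Num.floor _; set m := Num.floor _.
have s2 : side k = 2 * side k.+1.
  by rewrite /side exprS invfM mulrA divff// mul1r.
have : (m * 2 <= m' <= m * 2 + 1)%R.
  rewrite floor_ge_int -ltzD1 -addrA floor_lt_int.
  have := floor_le_tmp (x 0 i * 2 ^+ k); have := floorD1_gt (x 0 i * 2 ^+ k).
  rewrite -/m exprS !intrD !intrM/= => h1 h2; apply/andP; split; lra.
rewrite -!(ler_int R) intrD intrM/= s2 => /andP[h1 h2] /andP[h3 h4].
have s0 := side_gt0 k.+1.
apply/andP; split; nra.
Qed.

Let csub k x : hcube (corner k (idx k x)) (side k) x.
Proof. exact/idxP. Qed.

Variables (mu nu : {measure set V -> \bar R}) (D : set V).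
Hypothesis cube_le : forall a l, 0 < l -> ccube a l `<=` D ->
  (mu (hcube a l) <= nu (hcube a l))%E.

(** The union [H k] of the cubes of generation k whose closure lies in [G] increases to [G]. Cubes
    of one generation are disjoint, so the comparison adds up, then passes to the limit by
    continuity from below. *)
Lemma open_measure_le G : open G -> G `<=` D -> (mu G <= nu G)%E.
Proof.
move=> oG GD.
pose A k (j : nat) : set V := if (pickle_inv j : option 'rV[int]_n) is Some m then
  if `[< ccube (corner k m) (side k) `<=` G >] then hcube (corner k m) (side k)
  else set0 else set0.
have mA k j : measurable (A k j).
  rewrite /A; case: pickle_inv => // m; case: asboolP => // _.
  exact: measurable_hcube.
pose H k := \bigcup_j A k j.
have HE k x : H k x <-> ccube (corner k (idx k x)) (side k) `<=` G.
  split => [[j _]|h].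
    rewrite /A; case: pickle_inv => // m; case: asboolP => // mG /idxP E.
    by rewrite E.
  exists (pickle (idx k x)) => //; rewrite /A pickleK_inv; case: asboolP => // _.
have mH k : measurable (H k) by apply: bigcupT_measurable.
have tA k : trivIset setT (A k).
  apply/trivIsetP => i j _ _ ij; apply/seteqP; split => // x [].
  rewrite /A; have := @pickle_invK 'rV[int]_n i; have := @pickle_invK 'rV[int]_n j.
  case: (pickle_inv j) => [m'|//] /= Ej; case: (pickle_inv i) => [m|//] /= Ei.
  case: asboolP => // _ /idxP Em; case: asboolP => // _ /idxP Em'.
  by move/eqP : ij; apply; rewrite -Ei -Ej -Em -Em'.
have ndH : nondecreasing_seq H.
  apply/nondecreasing_seqP => k; apply/subsetPset => x /HE h; apply/HE.
  exact: subset_trans (@idxS k x) h.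
have UH : \bigcup_k H k = G.
  apply/seteqP; split => [x [k _ /HE]|x Gx].
    by apply; apply: hcube_ccube; exact: csub.
  have /nbhs_ballP[d /= d0 xdG] : nbhs x G by exact: open_nbhs_nbhs.
  have [k _ kh] := near_infty_natSinv_lt (PosNum d0).
  exists k => //; apply/HE => y hy; apply: xdG; apply/ball_rV => // i.
  have hk : side k <= k.+1%:R^-1.
    rewrite /side lef_pV2 ?posrE ?exprn_gt0// -natrX ler_nat.
    exact: ltn_expl.
  have {}kh : k.+1%:R^-1 < d by exact: (kh k (leqnn k)).
  have := hy i; have := csub k x i; rewrite /= in_itv/=.
  set c := corner _ _ 0 i => /andP[h1 h2] /andP[h3 h4].
  have aux (c' s u v e : R) : s <= e -> e < d -> c' <= u -> u < c' + s ->
      c' <= v -> v <= c' + s -> `|u - v| < d.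
    by move=> *; rewrite ltr_norml; apply/andP; split; lra.
  exact: aux hk kh h1 h2 h3 h4.
have cmu : (mu \o H) k @[k --> \oo] --> mu G.
  by rewrite -UH; apply: nondecreasing_cvg_mu => //; rewrite UH; exact: measurable_openV.
rewrite -(cvg_lim _ cmu)//; apply: lime_le; first by apply/cvg_ex; exists (mu G).
apply: nearW => k /=; apply: (@le_trans _ _ (nu (H k))).
  rewrite !measure_bigcup//; apply: lee_nneseries => // j _.
  rewrite /A; case: pickle_inv => [m|]; last by rewrite !measure0.
  case: asboolP => [mG|_]; last by rewrite !measure0.
  by apply: cube_le => //; exact: subset_trans GD.
apply: le_measure; rewrite ?inE//; first exact: measurable_openV.
by rewrite -UH; exact: bigcup_sup.
Qed.

(** Regularity is asked of [nu] restricted to [D], which is finite: an open set around [A] has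
    little more mass than [A] for [nu], while [mu] of [A] is bounded by monotonicity. *)
Lemma borel_measure_le : open D -> (nu D < +oo)%E ->
  forall A, measurable A -> A `<=` D -> (mu A <= nu A)%E.
Proof.
move=> oD nuD A mA AD.
have mD : measurable D by exact: measurable_openV.
pose rho : {measure set V -> \bar R} := mrestr nu mD.
have rhoT : (rho setT < +oo)%E by rewrite /= /mrestr setTI.
apply/lee_addgt0Pr => e e0.
have [F [G [cF oG FA AG h]]] := regular_borel rhoT mA e0.
have mF : measurable F by exact: measurable_closedV.
have oGD : open (G `&` D) by exact: openI.
have mGD : measurable (G `&` D) by exact: measurable_openV.
apply: (@le_trans _ _ (mu (G `&` D))).
  by apply: le_measure; rewrite ?inE// => x Ax; split; [exact: AG|exact: AD].
apply: (le_trans (open_measure_le oGD _)); first exact: subIsetr.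
apply: (@le_trans _ _ (nu A + nu ((G `\` F) `&` D))%E); last exact: leeD.
have mGF : measurable ((G `\` F) `&` D).
  by apply: measurableI => //; apply: measurableD => //; exact: measurable_openV.
apply: (le_trans _ (measureU2 nu mA mGF)).
apply: le_measure; rewrite ?inE//; first exact: measurableU.
move=> x [Gx Dx]; have [Fx|Fx] := pselect (F x); first by left; exact: FA.
by right.
Qed.

End dyadic_cubes.

(** * The fundamental lemma of the calculus of variations *)

Section density_measure.
Context d (T : measurableType d) (R : realType).
Variables (mu : {measure set T -> \bar R}) (f : T -> \bar R).
Hypotheses (mf : measurable_fun setT f) (f0 : forall x, (0 <= f x)%E).

Definition density_measure (A : set T) : \bar R := (\int[mu]_(x in A) f x)%E.

Let density0 : density_measure set0 = 0%E.
Proof. by rewrite /density_measure integral_set0. Qed.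

Let density_ge0 A : (0 <= density_measure A)%E.
Proof. by apply: integral_ge0 => x _; exact: f0. Qed.

Let density_sigma_additive : semi_sigma_additive density_measure.
Proof.
move=> F mF tF mUF; rewrite /density_measure ge0_integral_bigcup//.
- by apply: is_cvg_ereal_nneg_natsum_cond => k _ _; exact: integral_ge0.
- exact: measurable_funTS.
Qed.

HB.instance Definition _ := isMeasure.Build _ _ _ density_measure
  density0 density_ge0 density_sigma_additive.

Lemma density_measureP : exists nu : {measure set T -> \bar R},
  forall A, nu A = (\int[mu]_(x in A) f x)%E.
Proof. by exists density_measure. Qed.

End density_measure.

Section Lp_facts.
Context {R : realType} {n : nat}.
Local Notation V := 'rV[R]_n.
Local Notation mu := (lebesgue_rV R n).
Implicit Types (D K : set V) (f g : V -> R).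

Lemma restrictE D f x : (f \_ D) x = if x \in D then f x else 0.
Proof. by rewrite patchE. Qed.

Lemma Lp1P K f : measurable K ->
  Lp 1%E K f <-> mu.-integrable K (EFin \o f).
Proof.
move=> mK; rewrite /Lp Lnorm1.
have -> : (\int[mu]_x `|(EFin \o f \_ K) x| = \int[mu]_(x in K) `|(f x)%:E|)%E.
  rewrite [RHS]integral_mkcond; apply: eq_integral => x _.
  by rewrite /= restrictE patchE; case: ifP => //; rewrite normr0.
split => [[mf foo]|/integrableP[mf foo]].
  by apply/integrableP; split => //; exact/measurable_EFinP.
by split => //; exact/measurable_EFinP.
Qed.

Lemma Lnorm_restrictE K f r : 0 < r ->
  (\int[mu]_x `|(EFin \o f \_ K) x| `^ r = \int[mu]_(x in K) (`|f x| `^ r)%:E)%E.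
Proof.
move=> r0; rewrite [RHS]integral_mkcond; apply: eq_integral => x _.
rewrite /= restrictE patchE; case: ifP => //=.
by rewrite normr0 powR0// gt_eqF.
Qed.

Lemma LpP K f r : 0 < r ->
  Lp r%:E K f <->
  measurable_fun K f /\ (\int[mu]_(x in K) (`|f x| `^ r)%:E < +oo)%E.
Proof.
move=> r0; rewrite /Lp -(Lnorm_restrictE _ _ r0) -poweR_Lnorm ?gt_eqF//.
split => -[mf h]; split => //; first exact: poweR_lty.
rewrite ltey; apply/eqP => E; move: h; rewrite E.
by rewrite poweRyr// gt_eqF.
Qed.

End Lp_facts.

Section fundamental_lemma.
Context {R : realType} {n : nat}.
Local Notation V := 'rV[R]_n.
Local Notation mu := (lebesgue_rV R n).
Implicit Types (D K : set V) (f g : V -> R).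

Definition obox (c : V) (r : R) : set V := [set y | forall i, `|y 0 i - c 0 i| < r].

Lemma open_obox c r : 0 < r -> open (obox c r).
Proof.
move=> r0; have -> : obox c r = ball c r; last exact: ball_open.
apply/seteqP; split => y; first by move=> h; apply/ball_rV => // i; rewrite distrC.
by move/ball_rV => h i; rewrite distrC; exact: h.
Qed.

Definition cbox (c : V) (r : R) : set V :=
  rV_box (fun i => c 0 i - r) (fun i => c 0 i + r).

Lemma cboxP c r y : cbox c r y <-> forall i, `|y 0 i - c 0 i| <= r.
Proof. by split => h i; have := h i; rewrite /= in_itv/= ler_distl. Qed.

(** Rational centres and radii 1/(k+1) give a countable cover, which reduces almost everywhere
    statements on [D] to boxes. An index that decodes to no admissible box receives a default box
    around a point of [D], hence the proviso on nonempty [D]. *)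
Lemma open_cover_boxes D : open D -> exists (c : nat -> V) (r : nat -> R),
  [/\ forall k, 0 < r k, forall k, D !=set0 -> cbox (c k) (r k) `<=` D &
      D `<=` \bigcup_k obox (c k) (r k)].
Proof.
move=> oD.
have [[x0 Dx0]|D0] := pselect (D !=set0); last first.
  by exists (fun=> 0), (fun=> 1); split => // x Dx; exfalso; apply: D0; exists x.
have [d d0 hd] : exists2 d : R, 0 < d & cbox x0 d `<=` D.
  have /nbhs_ballP[e /= e0 xe] : nbhs x0 D by exact: open_nbhs_nbhs.
  have e2 : 0 < e / 2 by rewrite divr_gt0.
  exists (e / 2) => // y /cboxP h; apply: xe; apply/ball_rV => // i.
  by rewrite distrC (le_lt_trans (h i))// ltr_pdivrMr// ltr_pMr// ltr1n.
pose P (k : nat) : option ('rV[rat]_n * nat) :=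
  if unpickle k is Some c then
    if `[< cbox (map_mx ratr c.1) c.2.+1%:R^-1 `<=` D >] then Some c else None
  else None.
exists (fun k => if P k is Some c then map_mx ratr c.1 else x0),
  (fun k => if P k is Some c then c.2.+1%:R^-1 else d).
split.
- by move=> k; case: (P k).
- move=> k _; rewrite /P; case: unpickle => [c|//].
  by case: asboolP.
- move=> x Dx.
  have /nbhs_ballP[e /= e0 xe] : nbhs x D by exact: open_nbhs_nbhs.
  have e20 : 0 < e / 2 by rewrite divr_gt0.
  have [k _ kh] := near_infty_natSinv_lt (PosNum e20).
  have {}kh : k.+1%:R^-1 < e / 2 := kh _ (leqnn k).
  have k0 : 0 < k.+1%:R^-1 :> R by rewrite invr_gt0.
  have hc i : {c : rat | `|x 0 i - ratr c| < k.+1%:R^-1}.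
    apply: cid.
    have : x 0 i - k.+1%:R^-1 < x 0 i + k.+1%:R^-1.
      by rewrite ltrBlDr -addrA ltrDl addr_gt0.
    move=> /rat_in_itvoo[c]; rewrite in_itv/= => /andP[c1 c2].
    by exists c; rewrite ltr_distl ltrBlDr c2 /= -ltrBlDr.
  pose c := \row_i sval (hc i).
  have cx i : `|x 0 i - map_mx ratr c 0 i| < k.+1%:R^-1.
    by rewrite !mxE; exact: svalP (hc i).
  exists (pickle (c, k)) => //; rewrite /P pickleK.
  case: asboolP => //= -[] y /cboxP cy; apply: xe; apply/ball_rV => // i.
  rewrite (le_lt_trans (ler_distD (map_mx ratr c 0 i) _ _))//.
  rewrite [e]splitr ltr_leD// ?(lt_trans (cx i))//.
  by rewrite distrC (le_trans (cy i))// ltW.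
Unshelve. all: by end_near. Qed.

(** A smooth bump that rises on [a - 1/m, a - 1/m + 1/m^2] and falls on [b - 1/m, b]. The asymmetry
    makes it converge pointwise to the indicator of the half-open interval [a, b[, in accordance
    with [hcube]. *)
Definition ramp (a b : R) (m : nat) (t : R) : R :=
  sstep (m%:R ^+ 2 * t + (m%:R - m%:R ^+ 2 * a)) * sstep (- m%:R * t + m%:R * b).

Lemma smooth1_ramp a b m : smooth1 (ramp a b m).
Proof. by apply: smooth1M; apply: smooth1_affine; exact: smooth1_sstep. Qed.

Lemma ramp_ge0 a b m t : 0 <= ramp a b m t.
Proof. by rewrite mulr_ge0// sstep_ge0. Qed.

Lemma ramp_le1 a b m t : ramp a b m t <= 1.
Proof. by rewrite mulr_ile1 ?sstep_ge0 ?sstep_le1. Qed.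

Lemma ramp_out a b m t : ~~ (a - m.+1%:R^-1 <= t <= b) -> ramp a b m.+1 t = 0.
Proof.
have m0 : 0 < m.+1%:R :> R by [].
rewrite negb_and -!ltNge /ramp => /orP[h|h].
  rewrite sstep0 ?mul0r//.
  have : m.+1%:R * (t - (a - m.+1%:R^-1)) <= 0.
    by rewrite pmulr_rle0// subr_le0 ltW.
  rewrite opprB addrA mulrBr mulrDr divff ?gt_eqF// => h1.
  have -> : m.+1%:R ^+ 2 * t + (m.+1%:R - m.+1%:R ^+ 2 * a) =
    m.+1%:R * (m.+1%:R * t + 1 - m.+1%:R * a) :> R by ring.
  by rewrite pmulr_rle0// mulrDr divff ?gt_eqF in h1 *.
rewrite [X in _ * X]sstep0 ?mulr0//.
by rewrite mulNr addrC subr_le0 ler_pM2l// ltW.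
Qed.

Lemma ramp_cvg a b t :
  \forall m \near \oo, ramp a b m t = ((a <= t < b)%R)%:R.
Proof.
have [at_|ta] := leP a t; have [tb|bt] := ltP t b => /=.
- have bt0 : 0 < b - t by rewrite subr_gt0.
  near=> m.
  have m1 : 1 <= m%:R :> R by rewrite ler1n; near: m; exact: nbhs_infty_ge.
  rewrite /ramp !sstep1 ?mulr1//.
    rewrite mulNr addrC -mulrBr -ler_pdivrMr//.
    by near: m; exact: nbhs_infty_ger.
  have -> : m%:R ^+ 2 * t + (m%:R - m%:R ^+ 2 * a) =
    m%:R + m%:R ^+ 2 * (t - a) by ring.
  by rewrite ler_wpDr// mulr_ge0 ?sqr_ge0// subr_ge0.
- near=> m; rewrite /ramp [X in _ * X]sstep0 ?mulr0//.
  by rewrite mulNr addrC -mulrBr mulr_ge0_le0// subr_le0.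
- near=> m; rewrite /ramp sstep0 ?mul0r//.
  have -> : m%:R ^+ 2 * t + (m%:R - m%:R ^+ 2 * a) =
    m%:R * (1 - m%:R * (a - t)) by ring.
  rewrite mulr_ge0_le0// subr_le0 -ler_pdivrMr ?subr_gt0//.
  by near: m; exact: nbhs_infty_ger.
- near=> m; rewrite /ramp [X in _ * X]sstep0 ?mulr0//.
  by rewrite mulNr addrC -mulrBr mulr_ge0_le0// subr_le0.
Unshelve. all: by end_near. Qed.

Definition box_ramp (a b : V) (m : nat) : V -> R :=
  tensor (fun i => ramp (a 0 i) (b 0 i) m).

Lemma box_ramp01 a b m y : 0 <= box_ramp a b m y <= 1.
Proof.
apply/andP; split; first by apply: prodr_ge0 => i _; exact: ramp_ge0.
by apply: prodr_ile1 => i _; rewrite ramp_ge0 ramp_le1.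
Qed.

Lemma box_ramp_cvg a l y :
  \forall m \near \oo, box_ramp a (a + const_mx l) m y = (\1_(hcube a l) y : R).
Proof.
have : \forall m \near \oo, forall i : 'I_n,
    ramp (a 0 i) ((a + const_mx l) 0 i) m (y 0 i) =
    ((a 0 i <= y 0 i < a 0 i + l)%R)%:R.
  apply: filter_forall => i.
  have := ramp_cvg (a 0 i) ((a + const_mx l) 0 i) (y 0 i).
  by rewrite !mxE.
apply: filterS => m h; rewrite /box_ramp /tensor indicE.
under eq_bigr do rewrite h.
case: (boolP (y \in hcube a l)) => [/set_mem yQ|/negP yQ].
  by rewrite big1// => i _; rewrite yQ.
have /existsNP[i /negP/negbTE yi] : ~ hcube a l y by move/mem_set.
by rewrite (bigD1 i)//= yi mul0r.
Qed.

(** The positive and negative parts of [g] are densities of two finite measures. Testing with ramps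
    and dominated convergence show that they agree on half-open cubes, [borel_measure_le] used in
    both directions that they agree on Borel sets, and then [g] vanishes almost everywhere. *)
Lemma fundamental_lemma_box c r g : 0 < r ->
  mu.-integrable (cbox c r) (EFin \o g) ->
  (forall phi, test_function (obox c r) phi ->
    (\int[mu]_(x in obox c r) (g x * phi x)%:E = 0)%E) ->
  ae_eq mu (obox c r) g (cst 0).
Proof.
move=> r0 ig g0; set B := obox c r.
have mB : measurable B by apply: measurable_openV; exact: open_obox.
have mC : measurable (cbox c r) by exact: measurable_rV_box.
have BC : B `<=` cbox c r by move=> y h; apply/cboxP => i; exact/ltW/h.
have igB : mu.-integrable B (EFin \o g) by exact: integrableS ig.
have mg : measurable_fun B g by apply/measurable_EFinP; exact: measurable_int igB.
pose gB : V -> \bar R := (EFin \o g) \_ B.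
have igT : mu.-integrable setT gB by exact/(integrable_mkcond _ mB).
have mgT : measurable_fun setT gB by exact: measurable_int igT.
have [nup Ep] := @density_measureP _ _ _ mu gB^\+%E (measurable_funepos mgT) (funepos_ge0 gB).
have [num Em] := @density_measureP _ _ _ mu gB^\-%E (measurable_funeneg mgT) (funeneg_ge0 gB).
have fin A : measurable A -> (nup A < +oo)%E /\ (num A < +oo)%E.
  move=> mA; rewrite Ep Em; split.
    have /integrableP[_] := integrable_funepos measurableT igT.
    apply: le_lt_trans; rewrite (eq_integral gB^\+%E); last first.
      by move=> x _; rewrite gee0_abs.
    by apply: ge0_subset_integral => //; exact: measurable_funepos.
  have /integrableP[_] := integrable_funeneg measurableT igT.
  apply: le_lt_trans; rewrite (eq_integral gB^\-%E); last first.
    by move=> x _; rewrite gee0_abs.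
  by apply: ge0_subset_integral => //; exact: measurable_funeneg.
have diff A : measurable A -> (nup A - num A = \int[mu]_(x in A) gB x)%E.
  by move=> mA; rewrite Ep Em [RHS]integralE.
have cubes a l : 0 < l -> ccube a l `<=` B ->
    (\int[mu]_(x in hcube a l) gB x = 0)%E.
  move=> l0 QB.
  (* A closed cube inside the open box leaves a positive margin; ramps with 1/m below the margin are
     test functions of the box. *)
  have hQ i : c 0 i - r < a 0 i /\ a 0 i + l < c 0 i + r.
    have h1 : ccube a l a by move=> j; rewrite /= in_itv/= lexx lerDl ltW.
    have h2 : ccube a l (a + const_mx l).
      by move=> j; rewrite /= in_itv/= !mxE lexx lerDl ltW.
    have := QB _ h1 i; have := QB _ h2 i; rewrite !mxE !ltr_distl.
    by move=> /andP[_ ->] /andP[-> _].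
  pose phi m := box_ramp a (a + const_mx l) m.
  have testphi : \forall m \near \oo, test_function B (phi m).
    have : \forall m \near \oo, forall i : 'I_n, (m%:R^-1 : R) < a 0 i - (c 0 i - r).
      apply: filter_forall => i.
      have e0 : 0 < a 0 i - (c 0 i - r) by rewrite subr_gt0; have [] := hQ i.
      have [k _ kh] := near_infty_natSinv_lt (PosNum e0).
      by exists k.+1 => //= -[//|m] /= km; apply: kh.
    move=> h; near=> m.
    have hm : forall i : 'I_n, (m%:R^-1 : R) < a 0 i - (c 0 i - r).
      by near: m.
    have m0 : (0 < m)%N by near: m; exact: nbhs_infty_gt.
    apply: (@test_function_tensor _ _ _ _ (fun i => a 0 i - m%:R^-1)
      (fun i => (a + const_mx l) 0 i)).
    - by move=> i; exact: smooth1_ramp.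
    - by move=> i x; rewrite -(prednK m0); exact: ramp_out.
    - move=> y hy i; have := hy i; have := hm i; have [] := hQ i.
      rewrite /= in_itv/= !mxE ltr_distl => h1 h2 h3 /andP[h4 h5].
      by apply/andP; split; lra.
  have intphi : \forall m \near \oo, (\int[mu]_(x in B) (g x * phi m x)%:E = 0)%E.
    by apply: filterS testphi => m; exact: g0.
  pose G m x := (g x * phi m x)%:E.
  have [_ _] : [/\ mu.-integrable B (fun x => (g x * \1_(hcube a l) x)%:E),
      [sequence \int[mu]_(x in B) `|G m x - (g x * \1_(hcube a l) x)%:E|]_m
        @ \oo --> 0%E &
      [sequence \int[mu]_(x in B) (G m x)]_m @ \oo -->
        (\int[mu]_(x in B) (g x * \1_(hcube a l) x)%:E)]%E.
    apply: (@dominated_convergence _ _ _ mu B mB G _ (fun x => `|(g x)%:E|%E)).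
    - move=> m; apply/measurable_EFinP; apply: measurable_funM => //.
      apply: measurable_funTS; apply: measurable_continuous.
      apply: continuous_tensor => i; apply: smooth1_continuous.
      exact: smooth1_ramp.
    - apply/measurable_EFinP; apply: measurable_funM => //.
      by apply: measurable_funTS; apply: measurable_indic; exact: measurable_hcube.
    - apply/aeW => x Bx.
      have h : \forall m \near \oo, G m x = (g x * \1_(hcube a l) x)%:E.
        by apply: filterS (box_ramp_cvg a l x) => m E; rewrite /G /phi E.
      apply: cvg_near_cst; exact: h.
    - exact: integrable_abse.
    - apply/aeW => x m Bx; rewrite /G /= lee_fin normrM ler_piMr//.
      by have /andP[h1 h2] := box_ramp01 a (a + const_mx l) m x; rewrite ger0_norm.
  have E0 : ([sequence \int[mu]_(x in B) (G m x)]_m @ \oo --> 0)%E.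
    by apply: cvg_near_cst; exact: intphi.
  move=> /cvg_lim => /(_ (@ereal_hausdorff R)); rewrite (cvg_lim _ E0)// => E1.
  rewrite [RHS]E1 [LHS]integral_mkcond [RHS]integral_mkcond.
  apply: eq_integral => x _; rewrite /gB !patchE indicE.
  case: ifPn => xQ; case: ifPn => xB //=; rewrite ?mulr1 ?mulr0//.
have eqcubes a l : 0 < l -> ccube a l `<=` B -> nup (hcube a l) = num (hcube a l).
  move=> l0 QB; have mQ := measurable_hcube a l; have [f1 f2] := fin _ mQ.
  have := diff _ mQ; rewrite cubes//.
  have : nup (hcube a l) \is a fin_num by rewrite ge0_fin_numE.
  have : num (hcube a l) \is a fin_num by rewrite ge0_fin_numE.
  move: (nup _) (num _) => [x||] [y||]//= _ _.
  by rewrite -EFinB => -[] /eqP; rewrite subr_eq0 => /eqP ->.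
have oB : open B by exact: open_obox.
have E A : measurable A -> A `<=` B -> nup A = num A.
  move=> mA AB; apply/eqP; rewrite eq_le; apply/andP; split.
    apply: (@borel_measure_le _ _ nup num B) => //; last by have [] := fin _ mB.
    by move=> a l l0 QB; rewrite eqcubes.
  apply: (@borel_measure_le _ _ num nup B) => //; last by have [] := fin _ mB.
  by move=> a l l0 QB; rewrite eqcubes.
have : ae_eq mu B (EFin \o g) (cst 0%E).
  apply: integral_ae_eq => //.
  move=> A AB mA; rewrite [RHS]integral0_eq//.
  transitivity (\int[mu]_(x in A) gB x)%E.
    by apply: eq_integral => x /set_mem Ax; rewrite /gB patchE mem_set//; exact: AB.
  by rewrite -diff// E// subee// ge0_fin_numE//; have [] := fin _ mA.
by apply: filterS => x h Bx; have [] := h Bx.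
Unshelve. all: by end_near. Qed.

Lemma test_function_subset D D' phi : D `<=` D' ->
  test_function D phi -> test_function D' phi.
Proof. by move=> DD' [h1 h2 h3]; split => //; exact: subset_trans DD'. Qed.

Lemma test_function_out D phi x : test_function D phi -> ~ D x -> phi x = 0.
Proof.
move=> [_ _ sD] nD; apply: contrapT => /eqP px; apply: nD; apply: sD.
exact: subset_closure.
Qed.

Lemma fundamental_lemma D g : open D -> Lp_loc 1%E D g ->
  (forall phi, test_function D phi -> (\int[mu]_(x in D) (g x * phi x)%:E = 0)%E) ->
  ae_eq mu D g (cst 0).
Proof.
move=> oD lg g0; have [c [r [r0 cD Dc]]] := open_cover_boxes oD.
have [D0|/set0P D0] := eqVneq D set0; first by rewrite D0; exact/aeW.
have h k : ae_eq mu (obox (c k) (r k)) g (cst 0).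
  have BD : obox (c k) (r k) `<=` D.
    apply: subset_trans (cD k D0) => y h; apply/cboxP => i; exact/ltW/h.
  apply: fundamental_lemma_box => //.
    apply/Lp1P; first exact: measurable_rV_box.
    apply: lg; [exact: compact_rV_box|exact: cD].
  move=> phi tphi; rewrite -[RHS](g0 phi); last exact: test_function_subset tphi.
  rewrite integral_mkcond [RHS]integral_mkcond; apply: eq_integral => x _.
  rewrite !patchE; case: ifPn => [/set_mem xB|/negP xB].
    by rewrite mem_set//; exact: BD.
  case: ifPn => // _; rewrite (test_function_out tphi) ?mulr0//.
  by move/mem_set.
have : {ae mu, forall x, forall k, obox (c k) (r k) x -> g x = cst 0 x}.
  apply/ae_foralln => k; exact: h.
by apply: filterS => x hx Dx; have [k _ xk] := Dc _ Dx; exact: hx xk.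
Qed.

End fundamental_lemma.

(** * Weak derivatives *)

Section weak_derivatives.
Context {R : realType} {n : nat}.
Local Notation V := 'rV[R]_n.
Local Notation mu := (lebesgue_rV R n).
Implicit Types (D K : set V) (f g phi : V -> R) (s : seq 'I_n).

Lemma le_coord_norm (x : V) i : `|x 0 i| <= `|x|.
Proof.
rewrite [leRHS]/Num.norm/= mx_normrE.
exact: (le_bigmax _ (fun ij : 'I_1 * 'I_n => `|x ij.1 ij.2|) (0, i)).
Qed.

Lemma partial_cat s t phi : partial s (partial t phi) = partial (s ++ t) phi.
Proof. by rewrite /partial foldr_cat. Qed.

Lemma smooth_partial s phi : smooth phi -> smooth (partial s phi).
Proof. by move=> sp t; rewrite partial_cat; exact: sp. Qed.

Lemma smooth_continuous phi : smooth phi -> continuous phi.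
Proof. by move=> /(_ [::])[]. Qed.

Lemma closed_supportP phi x : ~ closed_support phi x ->
  \forall y \near x, phi y = 0.
Proof.
move=> nx; have : nbhs x (~` closed_support phi).
  by apply: open_nbhs_nbhs; split => //; exact/closed_openC/closed_closure.
apply: filterS => y ny; apply: contrapT => /eqP py; apply: ny.
exact: subset_closure.
Qed.

Lemma closed_support_out phi x : ~ closed_support phi x -> phi x = 0.
Proof. by move/closed_supportP/nbhs_singleton. Qed.

Lemma closed_support_partial s phi :
  closed_support (partial s phi) `<=` closed_support phi.
Proof.
elim: s => [//|i s ih]; apply: subset_trans ih.
rewrite {1}/closed_support closureE => x; apply; split.
  exact: closed_closure.
move=> y /= /eqP dy; apply: contrapT => ny; apply: dy => /=.
rewrite (@near_eq_derive _ _ _ (partial s phi) (cst 0)) ?derive_cst//.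
exact: closed_supportP ny.
Qed.

Lemma test_function_partial D s phi : test_function D phi ->
  test_function D (partial s phi).
Proof.
move=> [sp cp sD]; have sub := @closed_support_partial s phi.
split; first exact: smooth_partial.
  by apply: subclosed_compact sub => //; exact: closed_closure.
exact: subset_trans sD.
Qed.

Lemma compact_in_box K : compact K ->
  exists M : R, forall x : V, (exists j, M < `|x 0 j|) -> ~ K x.
Proof.
move=> /compact_bounded[M [_ hM]]; exists (M + 1) => x [j Mj] Kx.
have /(_ _ _ Kx)/= := hM (M + 1); rewrite ltrDl ltr01 => /(_ isT).
by apply/negP; rewrite -ltNge (lt_le_trans Mj)// le_coord_norm.
Qed.

Lemma continuous_bounded_compact K f : compact K -> continuous f ->
  exists2 C : R, 0 <= C & forall x, K x -> `|f x| <= C.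
Proof.
move=> cK cf; have [K0|/set0P K0] := eqVneq K set0.
  by exists 0 => // x; rewrite K0.
have cf' : {within K, continuous (fun x => `|f x|)}.
  apply: continuous_subspaceT => x.
  by apply: continuous_comp; [exact: cf|exact: norm_continuous].
have [c _ hc] := EVT_max_rV K0 cK cf'.
by exists `|f c| => // x Kx; apply: hc; rewrite inE.
Qed.

Lemma continuous_integrable_compact K f : compact K -> continuous f ->
  mu.-integrable K (EFin \o f).
Proof.
move=> cK cf; have [M hM] := compact_in_box cK.
have [C C0 hC] := continuous_bounded_compact cK cf.
have mK := measurable_compactV cK.
apply/(integrable_mkcond _ mK).
have -> : ((EFin \o f) \_ K) = EFin \o (f \_ K).
  by apply/funext => x; rewrite /= !patchE; case: ifP.
apply: (@integrable_box _ _ _ M).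
- by apply/(measurable_restrictT f mK); apply: measurable_funTS; exact: measurable_continuous.
- exists C => x; rewrite restrictE; case: ifPn => [/set_mem|_]; first exact: hC.
  by rewrite normr0.
- move=> x /hM nK; rewrite restrictE memNset//.
Qed.

Lemma Lp_loc1_continuous D f : continuous f -> Lp_loc 1%E D f.
Proof.
move=> cf K cK KD; apply/Lp1P; first exact: measurable_compactV.
exact: continuous_integrable_compact.
Qed.

Lemma test_integrable D f phi : open D -> Lp_loc 1%E D f ->
  test_function D phi -> mu.-integrable D (EFin \o (fun x => f x * phi x)).
Proof.
move=> oD lf [sp cK KD]; set K := closed_support phi in cK KD.
have mD : measurable D by exact: measurable_openV.
have mK : measurable K by exact: measurable_compactV.
have cphi := smooth_continuous sp.
have [C C0 hC] := continuous_bounded_compact cK cphi.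
have : mu.-integrable K (EFin \o (fun x => f x * phi x)).
  have fK : mu.-integrable K (EFin \o f) by apply/Lp1P => //; exact: lf.
  apply: (@le_integrable _ _ _ mu K mK _ (fun x => (C%:E * (f x)%:E)%E)).
  - apply/measurable_EFinP; apply: measurable_funM.
      by apply/measurable_EFinP; exact: measurable_int fK.
    by apply: measurable_funTS; exact: measurable_continuous.
  - move=> x Kx /=; rewrite lee_fin !normrM mulrC ler_wpM2r//.
    by rewrite (ger0_norm C0) hC.
  - exact: integrableZl.
move/(integrable_mkcond _ mK) => h; apply/(integrable_mkcond _ mD).
congr (integrable _ _ _) : h; apply/funext => x; rewrite !patchE.
case: ifPn => [/set_mem xK|/negP xK]; first by rewrite mem_set//; exact: KD.
case: ifP => // _; rewrite /= (@closed_support_out phi) ?mulr0//.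
by move/mem_set.
Qed.

Lemma Lp_loc1D D a f g : Lp_loc 1%E D f -> Lp_loc 1%E D g ->
  Lp_loc 1%E D (fun x => a * f x + g x).
Proof.
move=> lf lg K cK KD; have mK := measurable_compactV cK.
apply/Lp1P => //.
have h1 : mu.-integrable K (EFin \o f) by apply/Lp1P => //; exact: lf.
have h2 : mu.-integrable K (EFin \o g) by apply/Lp1P => //; exact: lg.
have := integrableD mK (integrableZl mK a h1) h2.
by congr (integrable _ _ _).
Qed.

Lemma weak_partialD D s a f g f' g' : open D ->
  weak_partial D s f g -> weak_partial D s f' g' ->
  weak_partial D s (fun x => a * f x + f' x) (fun x => a * g x + g' x).
Proof.
move=> oD [lf lg h] [lf' lg' h']; have mD := measurable_openV oD.
split; [exact: Lp_loc1D|exact: Lp_loc1D|] => phi tphi.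
have tp := test_function_partial s tphi.
have E u u' psi : Lp_loc 1%E D u -> Lp_loc 1%E D u' -> test_function D psi ->
    \int[mu]_(x in D) ((a * u x + u' x) * psi x) =
    a * \int[mu]_(x in D) (u x * psi x) + \int[mu]_(x in D) (u' x * psi x).
  move=> lu lu' tpsi; have i1 := test_integrable oD lu tpsi.
  have i2 := test_integrable oD lu' tpsi.
  have -> : (fun x => (a * u x + u' x) * psi x) =
      (fun x => a * (u x * psi x) + u' x * psi x).
    by apply/funext => x; ring.
  rewrite RintegralD//; last exact: (integrableZl mD a i1).
  by rewrite RintegralZl.
rewrite !E// h// h'//; ring.
Qed.

Lemma weak_partial_unique D s f g g' : open D ->
  weak_partial D s f g -> weak_partial D s f g' -> ae_eq mu D g g'.
Proof.
move=> oD [lf lg h] [_ lg' h']; have mD := measurable_openV oD.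
have : ae_eq mu D (fun x => -1 * g' x + g x) (cst 0).
  apply: fundamental_lemma => //; first exact: Lp_loc1D.
  move=> phi tphi; have i1 := test_integrable oD lg tphi.
  have i2 := test_integrable oD lg' tphi.
  have E : \int[mu]_(x in D) (g x * phi x) = \int[mu]_(x in D) (g' x * phi x).
    have := h _ tphi; rewrite h'// => /esym /eqP.
    by rewrite (inj_eq (mulfI _)) ?signr_eq0// => /eqP.
  have f1 := integrable_fin_num mD i1; have f2 := integrable_fin_num mD i2.
  have -> : (\int[mu]_(x in D) ((- 1 * g' x + g x) * phi x)%:E =
      \int[mu]_(x in D) ((g x * phi x)%:E - (g' x * phi x)%:E))%E.
    by apply: eq_integral => x _; rewrite -EFinB; congr EFin; ring.
  rewrite integralB_EFin//.
  by rewrite -[X in (X - _)%E]fineK// -[X in (_ - X)%E]fineK// -EFinB [X in X - _]E subrr.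
by apply: filterS => x hx Dx; have := hx Dx; rewrite /= mulN1r addrC => /eqP; rewrite subr_eq0 => /eqP.
Qed.

(** Local integrability only speaks of compact sets; measurability on [D] follows from a countable
    cover by closed boxes. *)
Lemma Lp_loc1_measurable D f : open D -> Lp_loc 1%E D f -> measurable_fun D f.
Proof.
move=> oD lf; have [c [r [r0 cD Dc]]] := open_cover_boxes oD.
have [D0|/set0P D0] := eqVneq D set0; first by rewrite D0; exact: measurable_fun_set0.
have -> : D = \bigcup_k cbox (c k) (r k).
  apply/seteqP; split => [x /Dc[k _ xk]|x [k _]]; last exact: cD.
  by exists k => //; apply/cboxP => i; exact/ltW/xk.
apply/measurable_fun_bigcup => [k|k]; first exact: measurable_rV_box.
by have [] := lf _ (@compact_rV_box _ _ _ _) (cD k D0).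
Qed.

Lemma ae_eq_Rintegral D f g : measurable D -> measurable_fun D f ->
  measurable_fun D g -> ae_eq mu D f g ->
  \int[mu]_(x in D) f x = \int[mu]_(x in D) g x.
Proof.
move=> mD mf mg fg; rewrite /Rintegral; congr fine.
apply: ae_eq_integral => //; [exact/measurable_EFinP|exact/measurable_EFinP|].
by apply: filterS fg => x h Dx; rewrite h.
Qed.

Lemma measurable_mul_test D f phi : measurable_fun D f -> smooth phi ->
  measurable_fun D (fun x => f x * phi x).
Proof.
move=> mf sp; apply: measurable_funM => //.
apply: measurable_funTS; apply: measurable_continuous; exact: smooth_continuous.
Qed.

Lemma weak_partial_ae D s f g f' g' : open D -> ae_eq mu D f f' ->
  ae_eq mu D g g' -> Lp_loc 1%E D f' -> Lp_loc 1%E D g' ->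
  weak_partial D s f g -> weak_partial D s f' g'.
Proof.
move=> oD ff' gg' lf' lg' [lf lg h]; have mD := measurable_openV oD.
split => // phi tphi.
have E u u' psi : Lp_loc 1%E D u -> Lp_loc 1%E D u' -> ae_eq mu D u u' ->
    smooth psi -> \int[mu]_(x in D) (u x * psi x) = \int[mu]_(x in D) (u' x * psi x).
  move=> lu lu' uu' sp; apply: ae_eq_Rintegral => //.
  - by apply: measurable_mul_test => //; exact: Lp_loc1_measurable.
  - by apply: measurable_mul_test => //; exact: Lp_loc1_measurable.
  - by apply: filterS uu' => x hx Dx; rewrite hx.
have [sp _ _] := tphi.
rewrite -(E f f')// -1?(E g g')//; first exact: h.
exact: smooth_partial.
Qed.

(** Integration by parts: the product of [phi] with a test function has compact support, so its
    partial derivative has integral 0 over the whole space. *)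
Lemma weak_partial_smooth D i phi : open D -> smooth phi ->
  weak_partial D [:: i] phi ('D_(evec i) phi).
Proof.
move=> oD sp; have mD := measurable_openV oD.
have cphi := smooth_continuous sp; have [cdphi _] := sp [:: i].
have [_ dphi] := sp [::].
split; [exact: Lp_loc1_continuous|exact: Lp_loc1_continuous|] => psi tpsi.
have [spsi cK KD] := tpsi; have cpsi := smooth_continuous spsi.
have [cdpsi _] := spsi [:: i]; have [_ dpsi] := spsi [::].
have [M hM] := compact_in_box cK.
pose F x := phi x * psi x.
have dF x : is_derive x (evec i) F (phi x * 'D_(evec i) psi x + psi x * 'D_(evec i) phi x).
  apply: is_deriveM; apply: DeriveDef => //; [exact: dphi|exact: dpsi].
have DF : 'D_(evec i) F = (fun x => phi x * 'D_(evec i) psi x + psi x * 'D_(evec i) phi x).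
  by apply/funext => x; have [_ ->] := dF x.
have I0 : (\int[mu]_x ('D_(evec i) F x)%:E = 0)%E.
  apply: (@integral_partial0 _ _ _ _ M).
  - by move=> x; have [] := dF x.
  - have c1 : continuous (phi \* 'D_(evec i) psi).
      by move=> x; exact: continuousM (cphi x) (cdpsi x).
    have c2 : continuous (psi \* 'D_(evec i) phi).
      by move=> x; exact: continuousM (cpsi x) (cdphi x).
    by rewrite DF => x; exact: continuousD (c1 x) (c2 x).
  - by move=> x /hM nK; rewrite /F (closed_support_out nK) mulr0.
have tp := test_function_partial [:: i] tpsi.
have i1 := test_integrable oD (Lp_loc1_continuous cphi) tp.
have i2 := test_integrable oD (Lp_loc1_continuous cdphi) tpsi.
rewrite expr1 mulN1r; apply/eqP; rewrite -subr_eq0 opprK; apply/eqP.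
rewrite -RintegralD//.
transitivity (fine (\int[mu]_x ('D_(evec i) F x)%:E)%E); last by rewrite I0.
rewrite /Rintegral; congr fine; rewrite integral_mkcond; apply: eq_integral => x _.
rewrite patchE; have [_ ->] := dF x; case: ifPn => [_|/negP xD].
  by congr EFin; rewrite /= [in RHS](mulrC (psi x)).
have nD : ~ D x by move/mem_set.
rewrite (test_function_out tpsi nD) mul0r addr0.
by have /= -> := test_function_out tp nD; rewrite mulr0.
Qed.

(** Test the derivative [g] with [partial [:: j] phi] instead of [phi]: one of the two signs of the
    second order formula is absorbed. This makes second derivatives of [f] into first derivatives of
    its gradient. *)
Lemma weak_partial_split D i j f g h : weak_partial D [:: i] f g ->
  weak_partial D [:: i; j] f h -> weak_partial D [:: j] g h.
Proof.
move=> [_ lg hg] [lf lh hh]; split => // phi tphi.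
have /= := hg _ (test_function_partial [:: j] tphi); have /= := hh _ tphi.
by rewrite expr1 expr2 mulrNN mulr1 !mulN1r mul1r => <- ->; rewrite opprK.
Qed.

End weak_derivatives.

(** * Morrey estimates *)

Section mean_value.
Context {R : realType}.

Lemma mean_value (f f' : R -> R) (u v : R) :
  (forall x : R, is_derive x 1 f (f' x)) ->
  exists2 c, `|c - v| <= `|u - v| & f u - f v = f' c * (u - v).
Proof.
move=> df; have cf : continuous f.
  by move=> x; apply/differentiable_continuous/derivable1_diffP; have [] := df x.
have [uv|uv|->] := ltgtP u v; last by exists v; rewrite // !subrr mulr0.
  have [|c] := @MVT _ f f' u v uv (fun x _ => df x); first exact: continuous_subspaceT.
  rewrite in_itv/= => /andP[c1 c2] E; exists c.
    by rewrite !ltr0_norm ?subr_lt0// lerN2 lerD2r ltW.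
  by rewrite -opprB E -mulrN opprB.
have [|c] := @MVT _ f f' v u uv (fun x _ => df x); first exact: continuous_subspaceT.
rewrite in_itv/= => /andP[c1 c2] E; exists c => //.
by rewrite !gtr0_norm ?subr_gt0// lerD2r ltW.
Qed.

Lemma taylor1_bound (f f' f'' : R -> R) (B : R) :
  (forall x : R, is_derive x 1 f (f' x)) ->
  (forall x : R, is_derive x 1 f' (f'' x)) -> (forall x, `|f'' x| <= B) ->
  forall u v, `|f u - f v - f' v * (u - v)| <= B * (u - v) ^+ 2.
Proof.
move=> df df' fB u v; have [c hc ->] := mean_value u v df.
have [e _ E] := mean_value c v df'.
rewrite -mulrBl E !normrM -[(u - v) ^+ 2]real_normK ?num_real// expr2 mulrA.
by rewrite ler_wpM2r// ler_pM.
Qed.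

(** Cut [0, 1] into N+1 equal steps: the linear terms add up to [A], the quadratic ones to C /
    (N+1). A second order error thus disappears, however large its constant. *)
Lemma refine_bound (psi : R -> R) (A C : R) : 0 <= C ->
  (forall u v, 0 <= u <= 1 -> 0 <= v <= 1 ->
    `|psi u - psi v| <= A * `|u - v| + C * (u - v) ^+ 2) ->
  `|psi 1 - psi 0| <= A.
Proof.
move=> C0 h; apply/ler_addgt0Pl => e e0.
have [N hN] : exists N : nat, C < N.+1%:R * e.
  exists (Num.truncn (C / e)); rewrite -ltr_pdivrMr//.
  by rewrite truncnS_gt.
have N0 : 0 < N.+1%:R :> R by [].
have -> : psi 1 - psi 0 = \sum_(j < N.+1) (psi (j.+1%:R / N.+1%:R) - psi (j%:R / N.+1%:R)).
  rewrite -(big_mkord xpredT (fun j => psi (j.+1%:R / N.+1%:R) - psi (j%:R / N.+1%:R))).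
  by rewrite telescope_sumr// divff ?gt_eqF// mul0r.
apply: (le_trans (ler_norm_sum _ _ _)).
apply: (@le_trans _ _ (\sum_(j < N.+1) (A / N.+1%:R + C / N.+1%:R ^+ 2))).
  apply: ler_sum => j _; apply: (le_trans (h _ _ _ _)).
  - by rewrite divr_ge0//= ler_pdivrMr// mul1r ler_nat.
  - by rewrite divr_ge0//= ler_pdivrMr// mul1r ler_nat ltnW.
  - rewrite -mulrBl -natrB// subSnn mul1r gtr0_norm ?invr_gt0//.
    by rewrite exprVn.
rewrite sumr_const card_ord -[X in X <= _]mulr_natr mulrDl mulrVK ?unitfE ?gt_eqF// addrC lerD2r.
rewrite expr2 invfM mulrA mulrVK ?unitfE ?gt_eqF//.
by rewrite ler_pdivrMr// mulrC ltW.
Qed.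

End mean_value.

(** * One-dimensional mollifiers and their primitives *)

Section kernels.
Context {R : realType}.

(** [kern z t] is a bump of mass 1 on [z, z + t] and [cdf z t] its primitive, which climbs from 0 to
    1. A difference of two bumps is then the derivative of a function with compact support. *)
Definition cdf (z t x : R) : R := sstep (t^-1 * x + - (t^-1 * z)).
Definition kern (z t x : R) : R :=
  t^-1 * derive1 (@sstep R) (t^-1 * x + - (t^-1 * z)).
Lemma smooth1_cdf z t : smooth1 (cdf z t).
Proof. exact/smooth1_affine/smooth1_sstep. Qed.

Lemma smooth1_kern z t : smooth1 (kern z t).
Proof.
apply: smooth1M; first exact: smooth1_cst.
exact/smooth1_affine/smooth1_derive/smooth1_sstep.
Qed.

Lemma is_derive_affine (f f' : R -> R) a b (x : R) :
  (forall x : R, is_derive x 1 f (f' x)) ->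
  is_derive x 1 (fun y => f (a * y + b)) (a * f' (a * x + b)).
Proof.
move=> df; have h : is_derive x 1 (fun y : R => a * y) a.
  have h := is_deriveZ a (is_derive_id x 1).
  by rewrite -[X in is_derive _ _ _ X]mulr1.
have h2 := is_deriveD h (is_derive_cst b x 1); rewrite addr0 in h2.
rewrite mulrC.
exact: (@is_derive1_comp _ f (fun y => a * y + b) x _ _ (df _) h2).
Qed.

Lemma is_derive_cdf z t (x : R) : is_derive x 1 (cdf z t) (kern z t x).
Proof.
apply: is_derive_affine => y; apply: smooth1_is_derive; exact: smooth1_sstep.
Qed.

Lemma cdf_left z t x : 0 < t -> x <= z -> cdf z t x = 0.
Proof. by move=> t0 xz; rewrite /cdf sstep0// subr_le0 ler_pM2l ?invr_gt0. Qed.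

Lemma cdf_right z t x : 0 < t -> z + t <= x -> cdf z t x = 1.
Proof.
move=> t0 xz; rewrite /cdf sstep1// -mulrBr -ler_pdivrMl ?invr_gt0// invrK mulr1.
by rewrite lerBrDl.
Qed.

Lemma kern_out z t x : 0 < t -> ~~ (z <= x <= z + t) -> kern z t x = 0.
Proof.
move=> t0 h; rewrite /kern dsstep_out ?mulr0//; apply: contra h.
rewrite subr_ge0 ler_pM2l ?invr_gt0// -mulrBr ler_pdivrMl// mulr1 lerBlDl.
by [].
Qed.

Lemma cdf_diff_le1 z t z' t' x : `|cdf z t x - cdf z' t' x| <= 1.
Proof.
have := sstep_ge0 (t^-1 * x + - (t^-1 * z)); have := sstep_le1 (t^-1 * x + - (t^-1 * z)).
have := sstep_ge0 (t'^-1 * x + - (t'^-1 * z')); have := sstep_le1 (t'^-1 * x + - (t'^-1 * z')).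
by rewrite /cdf => *; rewrite ler_norml; apply/andP; split; lra.
Qed.

Lemma integral_kern z t : 0 < t ->
  (\int[lebesgue_measure]_x (kern z t x)%:E = 1%:E)%E.
Proof.
move=> t0; rewrite -[1 in RHS]subr0.
apply: (@integral_derive1 _ (cdf z t) (kern z t) z (z + t)).
- by rewrite ltrDl.
- exact: is_derive_cdf.
- exact/smooth1_continuous/smooth1_kern.
- by move=> x; exact: cdf_left.
- by move=> x; exact: cdf_right.
Qed.

Lemma cdf_translate (B z t eta x : R) : 0 < t ->
  (forall x, `|derive1 (derive1 (@sstep R)) x| <= B) ->
  `|cdf (z + eta) t x - cdf z t x + eta * kern z t x| <= B / t ^+ 2 * eta ^+ 2.
Proof.
move=> t0 hB.
have d1 (y : R) : is_derive y 1 (@sstep R) (derive1 sstep y).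
  by apply: smooth1_is_derive; exact: smooth1_sstep.
have d2 (y : R) : is_derive y 1 (derive1 (@sstep R)) (derive1 (derive1 sstep) y).
  by apply: smooth1_is_derive; apply: smooth1_derive; exact: smooth1_sstep.
have := taylor1_bound d1 d2 hB (t^-1 * x + - (t^-1 * (z + eta))) (t^-1 * x + - (t^-1 * z)).
have -> : t^-1 * x + - (t^-1 * (z + eta)) - (t^-1 * x + - (t^-1 * z)) = - (t^-1 * eta) by ring.
rewrite -/(cdf (z + eta) t x) -/(cdf z t x).
have -> : derive1 (@sstep R) (t^-1 * x + - (t^-1 * z)) * - (t^-1 * eta) = - (eta * kern z t x).
  by rewrite /kern; ring.
rewrite opprK => /le_trans; apply.
by rewrite sqrrN exprMn mulrA exprVn.
Qed.

End kernels.

(** * Averages against product kernels *)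

Section averages.
Context {R : realType} {n : nat}.
Local Notation V := 'rV[R]_n.
Local Notation mu := (lebesgue_rV R n).
Implicit Types (D Q : set V) (f g phi : V -> R) (z a x : V) (t l : R).

Definition kernel z t : V -> R := tensor (fun i => kern (z 0 i) t).

(** A weighted mean over [ccube z t]. Unlike the indicator of the cube, the weight is a test
    function, so weak derivatives can be tested against it and its variants. *)
Definition average D f z t : R := \int[mu]_(x in D) (f x * kernel z t x).

Lemma kern_supported z t : 0 < t ->
  supported (fun i => kern (z 0 i) t) (fun i => z 0 i) (fun i => z 0 i + t).
Proof. by move=> t0 i x; exact: kern_out. Qed.

Lemma test_kernel D z t : 0 < t -> ccube z t `<=` D -> test_function D (kernel z t).
Proof.
move=> t0; apply: test_function_tensor; last exact: kern_supported.
by move=> i; exact: smooth1_kern.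
Qed.

Lemma tensor_le (beta : 'I_n -> R -> R) (C : 'I_n -> R) (y : V) :
  (forall i (x : R), `|beta i x| <= C i) -> `|tensor beta y| <= \prod_i C i.
Proof.
move=> h; rewrite /tensor normr_prod; apply: ler_prod => i _.
by rewrite normr_ge0 h.
Qed.

Lemma test_bound D Q g phi C : open D -> compact Q -> Q `<=` D ->
  Lp_loc 1%E D g -> test_function D phi -> (forall x, `|phi x| <= C) ->
  (forall x, ~ Q x -> phi x = 0) ->
  `|\int[mu]_(x in D) (g x * phi x)| <= C * \int[mu]_(x in Q) `|g x|.
Proof.
move=> oD cQ QD lg tphi phiC phi0.
have mD := measurable_openV oD; have mQ := measurable_compactV cQ.
have ig : mu.-integrable Q (EFin \o g) by apply/Lp1P => //; exact: lg.
have igQ := integrable_norm ig.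
have igD := test_integrable oD lg tphi.
apply: (le_trans (le_normr_Rintegral mD igD)).
rewrite -RintegralZl//.
have -> : \int[mu]_(x in D) `|g x * phi x| = \int[mu]_(x in Q) `|g x * phi x|.
  rewrite /Rintegral; congr fine; rewrite integral_mkcond [RHS]integral_mkcond.
  apply: eq_integral => x _; rewrite !patchE.
  case: ifPn => [xD|/negP xD]; case: ifPn => [xQ|/negP xQ] //.
    by rewrite phi0 ?mulr0 ?normr0// => /mem_set.
  by exfalso; apply: xD; apply: mem_set; apply: QD; exact: set_mem.
apply: le_Rintegral => //.
- have := integrableS mD mQ QD igD; exact: integrable_norm.
- exact: (integrableZl mQ C igQ).
- by move=> x _; rewrite normrM mulrC ler_wpM2r.
Qed.

Lemma sub_box (a b a' b' : 'I_n -> R) : (forall i, a' i <= a i) ->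
  (forall i, b i <= b' i) -> rV_box a b `<=` rV_box a' b'.
Proof.
move=> h1 h2 y h i; have := h i; rewrite /= !in_itv/= => /andP[h3 h4].
by rewrite (le_trans (h1 i))// (le_trans h4).
Qed.

(* The coordinates of the kernel are changed one at a time; changing one
   coordinate perturbs the kernel by a partial derivative of a test function,
   since kern is the derivative of cdf. *)
Lemma kernel_diff D f (g : 'I_n -> V -> R) z t z' t' (a b : 'I_n -> R) (m B : R) :
  open D -> (forall i, weak_partial D [:: i] f (g i)) ->
  0 < m -> m <= t -> m <= t' ->
  (forall i, a i <= z 0 i) -> (forall i, z 0 i + t <= b i) ->
  (forall i, a i <= z' 0 i) -> (forall i, z' 0 i + t' <= b i) ->
  rV_box a b `<=` D ->
  0 < B -> (forall u : R, `|derive1 (@sstep R) u| <= B) ->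
  `|average D f z t - average D f z' t'| <=
    (B / m) ^+ n.-1 * \sum_i \int[mu]_(x in rV_box a b) `|g i x|.
Proof.
move=> oD wf m0 mt mt' az zb az' zb' QD B0 hB.
have t0 : 0 < t by exact: lt_le_trans mt.
have t'0 : 0 < t' by exact: lt_le_trans mt'.
have mD := measurable_openV oD.
(* Hybrid kernels: the first [k] factors come from [z, t], the others from [z', t']. *)
pose bk (k : nat) : 'I_n -> R -> R :=
  fun i => if (i < k)%N then kern (z 0 i) t else kern (z' 0 i) t'.
have sm k : smooths (bk k).
  by move=> i; rewrite /bk; case: ifP => _; exact: smooth1_kern.
have sup k : supported (bk k) a b.
  move=> i x h; rewrite /bk; case: ifP => _; apply: kern_out => //;
    apply: contra h => /andP[h1 h2].
    by rewrite (le_trans (az i) h1) (le_trans h2 (zb i)).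
  by rewrite (le_trans (az' i) h1) (le_trans h2 (zb' i)).
have test k : test_function D (tensor (bk k)) by exact: test_function_tensor QD.
pose A k := \int[mu]_(x in D) (f x * tensor (bk k) x).
have A0 : average D f z' t' = A 0%N.
  by rewrite /A /average; congr (Rintegral _ _ _); apply/funext => x; congr (_ * _).
have An : average D f z t = A n.
  rewrite /A /average; congr (Rintegral _ _ _); apply/funext => x; congr (_ * _).
  by rewrite /kernel /tensor; apply: eq_bigr => i _; rewrite /bk ltn_ord.
rewrite A0 An.
have -> : A n - A 0%N = \sum_(k < n) (A k.+1 - A k).
  by rewrite -(big_mkord xpredT (fun k => A k.+1 - A k)) telescope_sumr.
rewrite mulr_sumr; apply: (le_trans (ler_norm_sum _ _ _)).
apply: ler_sum => k _.
(* Primitive of the difference of the two factors in direction [k]. It has compact support because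
   both cumulative functions are 0 to the left of [a k] and 1 to the right of [b k]. *)
pose w (x : R) := cdf (z 0 k) t x + -1 * cdf (z' 0 k) t' x.
have sw : smooth1 w.
  apply: smooth1D; first exact: smooth1_cdf.
  by apply: smooth1M; [exact: smooth1_cst|exact: smooth1_cdf].
have dw : derive1 w = fun x : R => kern (z 0 k) t x - kern (z' 0 k) t' x.
  have [-> //] : derive1 w = (fun x : R => kern (z 0 k) t x - kern (z' 0 k) t' x) /\
    forall x : R, derivable w x 1.
  apply: derive1_is_derive => x; rewrite /w -[- kern _ _ _]mulN1r.
  apply: is_deriveD; first exact: is_derive_cdf.
  exact: (is_deriveZ (-1) (is_derive_cdf (z' 0 k) t' x)).
have w0 (x : R) : ~~ (a k <= x <= b k) -> w x = 0.
  rewrite negb_and -!ltNge => /orP[h|h].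
    rewrite /w !cdf_left// ?mulr0 ?addr0// ltW//.
      exact: lt_le_trans (az' k).
    exact: lt_le_trans (az k).
  rewrite /w !cdf_right// ?mulr1 ?subrr//.
    exact: le_trans (zb' k) (ltW h).
  exact: le_trans (zb k) (ltW h).
pose psi := tensor (upd (bk k) k w).
have tpsi : test_function D psi.
  apply: test_function_tensor QD; first exact: smooths_upd.
  exact: supported_upd.
have Dpsi x : partial [:: k] psi x = tensor (bk k.+1) x - tensor (bk k) x.
  transitivity ('D_(evec k) psi x) => //.
  have -> : 'D_(evec k) psi x = tensor (upd (upd (bk k) k w) k
      (derive1 (upd (bk k) k w k))) x.
    by rewrite -derive_tensor//; exact: smooths_upd.
  rewrite updE dw tensor_upd (tensor_split (bk k.+1) k) (tensor_split (bk k) k).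
  have b1 : bk k.+1 k = kern (z 0 k) t by rewrite /bk ltnS leqnn.
  have b0 : bk k k = kern (z' 0 k) t' by rewrite /bk ltnn.
  rewrite b1 b0 mulrBl.
  have E : \prod_(j < n | j != k) upd (bk k) k w j (x 0 j) =
      \prod_(j < n | j != k) bk k j (x 0 j).
    by apply: eq_bigr => j /negbTE jk; rewrite /upd jk.
  have E' : \prod_(j < n | j != k) bk k.+1 j (x 0 j) =
      \prod_(j < n | j != k) bk k j (x 0 j).
    apply: eq_bigr => j jk; rewrite /bk ltnS leq_eqVlt.
    by rewrite (inj_eq val_inj) (negbTE jk).
  by rewrite E E'.
have [lf lg hk] := wf k.
have i1 := test_integrable oD lf (test k.+1).
have i2 := test_integrable oD lf (test k).
have -> : A k.+1 - A k = - \int[mu]_(x in D) (g k x * psi x).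
  rewrite /A -RintegralB//; have := hk _ tpsi; rewrite expr1 mulN1r => <-.
  by congr (Rintegral _ _ _); apply/funext => x; rewrite Dpsi mulrBr.
rewrite normrN; apply: test_bound => //.
- exact: compact_rV_box.
- move=> x; have Bm0 : 0 <= B / m by rewrite divr_ge0 ?ltW.
  (* The factor in direction [k] is at most 1 and each other one at most B / m, whence the exponent
     [n.-1]. *)
  apply: (le_trans (@tensor_le _ (fun i => if i == k then 1 else B / m) _ _)).
    move=> i y; rewrite /upd; case: ifP => [_|_].
      by rewrite /w mulN1r; exact: cdf_diff_le1.
    have aux (u v : R) : m <= u -> `|kern v u y| <= B / m.
      move=> mu'; have u0 : 0 < u by exact: lt_le_trans mu'.
      rewrite /kern normrM gtr0_norm ?invr_gt0// mulrC ler_pM ?invr_ge0 ?(ltW u0)//.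
      by rewrite lef_pV2.
    by rewrite /bk; case: ifP => _; exact: aux.
  rewrite (bigD1 k)//= eqxx mul1r.
  rewrite (eq_bigr (fun=> B / m)); last by move=> j /negbTE ->.
  rewrite prodr_const; suff -> : #|[pred j | j != k]| = n.-1 by [].
  by rewrite -[in RHS](card_ord n) -(cardC1 k).
- move=> x xQ; apply: (tensor_out (a := a) (b := b)) => //.
  exact: supported_upd.
Qed.

Lemma integral_kernel D z t : 0 < t -> ccube z t `<=` D ->
  \int[mu]_(x in D) kernel z t x = 1.
Proof.
move=> t0 QD; rewrite /Rintegral.
have -> : (\int[mu]_(x in D) (kernel z t x)%:E = \int[mu]_x (kernel z t x)%:E)%E.
  rewrite integral_mkcond; apply: eq_integral => x _; rewrite patchE.
  case: ifPn => // /negP xD; rewrite /kernel (tensor_out (kern_supported t0))// => /QD.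
  by move/mem_set.
rewrite (integral_tensor (a := fun i => z 0 i) (b := fun i => z 0 i + t))//.
- by move=> i; exact/smooth1_continuous/smooth1_kern.
- exact: kern_supported.
- by move=> i; exact: integral_kern.
Qed.

Lemma lebesgue_ccube z t : 0 <= t -> mu (ccube z t) = (t ^+ n)%:E.
Proof.
move=> t0; rewrite lebesgue_rV_box; last by move=> i; rewrite lerDl.
by rewrite (eq_bigr (fun=> t)) ?prodr_const ?card_ord// => i _; rewrite addrC addKr.
Qed.

Lemma compact_ccube z t : compact (ccube z t).
Proof. exact: compact_rV_box. Qed.

(* Replaces Hoelder's inequality by t <= c + c (t / c) ^ r, c > 0. *)
Lemma cube_L1_le Q g (v r I : R) : compact Q -> mu Q = v%:E -> 0 < v -> 1 < r ->
  0 < I -> mu.-integrable Q (EFin \o g) ->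
  (\int[mu]_(x in Q) (`|g x| `^ r)%:E <= I%:E)%E ->
  \int[mu]_(x in Q) `|g x| <= 2 * (I / v) `^ r^-1 * v.
Proof.
move=> cQ Qv v0 r1 I0 ig hI.
have r0 : 0 < r by rewrite (lt_trans _ r1).
have mQ := measurable_compactV cQ.
have mg : measurable_fun Q g by apply/measurable_EFinP; exact: measurable_int ig.
(* With this [c] the two terms [c * v] and [c * I / c ^ r] coincide, hence the factor 2 in the
   bound. *)
set c := (I / v) `^ r^-1.
have c0 : 0 < c by rewrite powR_gt0// divr_gt0.
have cr : c `^ r = I / v.
  by rewrite /c -powRrM mulVf ?gt_eqF// powRr1// divr_ge0// ltW.
clearbody c.
have mgr : measurable_fun Q (fun x => (`|g x| `^ r)).
  by apply: (measurableT_comp (measurable_powR r)); exact: measurableT_comp.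
have young s : 0 <= s -> s <= c + (c / c `^ r) * s `^ r.
  move=> s0; have [sc|cs] := leP s c; first by rewrite ler_wpDr// mulr_ge0 ?divr_ge0 ?powR_ge0// ltW.
  rewrite ler_wpDl ?(ltW c0)//.
  rewrite mulrAC ler_pdivlMr ?powR_gt0//.
  have E (u : R) : 0 < u -> u `^ r = u * u `^ (r - 1).
    move=> u0; rewrite -[X in _ = X * _](powRr1 (ltW u0)) -powRD; last by rewrite (gt_eqF u0) implybT.
    by rewrite subrKC.
  rewrite !E ?(lt_trans c0 cs)// !mulrA (mulrC c) ler_wpM2l ?mulr_ge0 ?(ltW c0)//.
  apply: ge0_ler_powR; rewrite ?nnegrE ?(ltW c0) ?subr_ge0 ?(ltW r1)//.
  exact: ltW.
have fin1 : (\int[mu]_(x in Q) `|(g x)%:E| < +oo)%E by have /integrableP[] := ig.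
suff h : (\int[mu]_(x in Q) `|g x|%:E <= (2 * c * v)%:E)%E.
  have fin2 : (\int[mu]_(x in Q) `|g x|%:E)%E \is a fin_num.
    by rewrite ge0_fin_numE//; exact: integral_ge0.
  have fin3 : (2 * c * v)%:E \is a fin_num by [].
  exact: (fine_le fin2 fin3 h).
apply: (@le_trans _ _ (\int[mu]_(x in Q) (c%:E + (c / c `^ r)%:E * (`|g x| `^ r)%:E))%E).
  apply: ge0_le_integral => //.
  - by apply/measurable_EFinP; exact: measurableT_comp.
  - by apply/measurable_EFinP; apply: measurable_funD => //; apply: measurable_funM.
  - by move=> x _; rewrite -EFinM -EFinD lee_fin young.
have k0 : 0 <= c / c `^ r by rewrite divr_ge0 ?powR_ge0 ?ltW.
rewrite ge0_integralD//; first last.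
  by apply/measurable_EFinP; apply: measurable_funM.
  by move=> x _; rewrite -EFinM lee_fin mulr_ge0 ?powR_ge0.
  by move=> x _; rewrite lee_fin ltW.
have Ec : (\int[mu]_(x in Q) c%:E = c%:E * v%:E)%E.
  by rewrite -Qv; exact: (integral_cst mu mQ c%:E).
rewrite [X in (X + _ <= _)%E](_ : _ = (c%:E * v%:E)%E); last exact: Ec.
rewrite ge0_integralZl//; first last.
  exact/measurable_EFinP.
apply: (@le_trans _ _ (c%:E * v%:E + (c / c `^ r)%:E * I%:E)%E).
  by apply: leeD => //; apply: lee_wpmul2l.
rewrite -!EFinM -EFinD lee_fin cr.
have -> : c / (I / v) * I = c * v by field; rewrite !gt_eqF.
by lra.
Qed.

End averages.

(** * Morrey's inequality through averages at decreasing scales *)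

Section morrey.
Context {R : realType} {n : nat}.
Local Notation V := 'rV[R]_n.
Local Notation mu := (lebesgue_rV R n).
Implicit Types (D Q : set V) (f g phi : V -> R) (z a x : V) (t l : R).

(** Image of the corner [a] under the homothety of centre [x] and ratio 2^-k: the cube at this
    corner, of side 2^-k l, shrinks to [x] inside the original cube. *)
Definition shrink x a (k : nat) : V := x + 2 ^- k *: (a - x).

Lemma shrinkE x a k i : shrink x a k 0 i = x 0 i + 2 ^- k * (a 0 i - x 0 i).
Proof. by rewrite !mxE. Qed.

Lemma shrink0 x a : shrink x a 0 = a.
Proof. by apply/rowP => i; rewrite shrinkE expr0 invr1 mul1r subrKC. Qed.

Lemma pow2N k : 0 < 2 ^- k :> R /\ 2 ^- k <= 1 :> R.
Proof.
split; first by rewrite invr_gt0 exprn_gt0.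
by rewrite invf_le1 ?exprn_gt0// exprn_ege1// ler1n.
Qed.

Lemma shrink_sub x a l k : ccube a l x ->
  ccube (shrink x a k) (2 ^- k * l) `<=` ccube a l.
Proof.
move=> xQ; apply: sub_box => i; have := xQ i; rewrite /= in_itv/= shrinkE;
  have [h1 h2] := pow2N k; move=> /andP[h3 h4]; nra.
Qed.

Lemma shrink_subS x a l k : ccube a l x ->
  ccube (shrink x a k.+1) (2 ^- k.+1 * l) `<=` ccube (shrink x a k) (2 ^- k * l).
Proof.
move=> xQ; apply: sub_box => i; have := xQ i; rewrite /= in_itv/= !shrinkE.
  rewrite exprS invfM; have [h1 h2] := pow2N k; move=> /andP[h3 h4]; nra.
rewrite exprS invfM; have [h1 h2] := pow2N k; move=> /andP[h3 h4]; nra.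
Qed.

Lemma shrink_mem x a l k : 0 <= l -> ccube a l x ->
  ccube (shrink x a k) (2 ^- k * l) x.
Proof.
move=> l0 xQ i; have := xQ i; rewrite /= !in_itv/= shrinkE.
have [h1 h2] := pow2N k; move=> /andP[h3 h4]; apply/andP; split; nra.
Qed.

Lemma powR_scale (I t r : R) : 0 < I -> 0 < t -> 0 < r ->
  (I / t ^+ n) `^ r^-1 * t = I `^ r^-1 * t `^ (1 - n%:R / r).
Proof.
move=> I0 t0 r0; rewrite powRM ?(ltW I0)//; last by rewrite invr_ge0 exprn_ge0 ?ltW.
rewrite -powR_mulrn ?(ltW t0)// -powRN -powRrM -mulrA; congr (_ * _).
rewrite -[X in _ * X](powRr1 (ltW t0)) -powRD; last by rewrite (gt_eqF t0) implybT.
by congr (_ `^ _); rewrite addrC mulNr.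
Qed.

(** Telescope over the scales t = 2^-j l. By [kernel_diff] and [cube_L1_le] each step costs at most
    C1 I^(1/r) t^(1 - n/r); since n < r these terms form a geometric series of ratio [rho < 1]. *)
Lemma morrey_averages (r : R) : (0 < n)%N -> n%:R < r ->
  exists2 C : R, 0 < C & forall D f (g : 'I_n -> V -> R) a l I x k,
    open D -> (forall i, weak_partial D [:: i] f (g i)) ->
    0 < l -> ccube a l `<=` D -> 0 < I ->
    (forall i, \int[mu]_(y in ccube a l) (`|g i y| `^ r)%:E <= I%:E)%E ->
    ccube a l x ->
    `|average D f a l - average D f (shrink x a k) (2 ^- k * l)| <=
      C * I `^ r^-1 * l `^ (1 - n%:R / r).
Proof.
move=> n0 nr; have [B B0 hB] := @dsstep_bounded R.
have r1 : 1 < r by rewrite (le_lt_trans _ nr)// ler1n.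
have r0 : 0 < r by rewrite (lt_trans _ r1).
set kap := 1 - n%:R / r.
have kap0 : 0 < kap by rewrite subr_gt0 ltr_pdivrMr// mul1r.
pose rho : R := 2^-1 `^ kap.
have rho0 : 0 < rho by rewrite powR_gt0.
have rho1 : rho < 1.
  by rewrite -[ltRHS](congr1 (@^~ kap) (@powR1 R)); apply: gt0_ltr_powR; rewrite // ?nnegrE// invf_lt1// ltr1n.
pose C1 := (2 * B) ^+ n.-1 * (n%:R * 2).
have C10 : 0 < C1 by rewrite !mulr_gt0 ?exprn_gt0 ?mulr_gt0// ltr0n.
have s1 : 0 < 1 - rho by rewrite subr_gt0.
exists (C1 / (1 - rho)); first by rewrite divr_gt0.
move=> D f g a l I x k oD wf l0 QD I0 hI xQ.
pose A k := average D f (shrink x a k) (2 ^- k * l).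
have step j : `|A j - A j.+1| <= C1 * I `^ r^-1 * l `^ kap * rho ^+ j.
  set t := 2 ^- j * l; have t0 : 0 < t by rewrite mulr_gt0// (pow2N j).1.
  have tS : 2 ^- j.+1 * l = t / 2 by rewrite /t exprS invfM; ring.
  have m0 : 0 < t / 2 by rewrite divr_gt0.
  have sub := @shrink_subS x a l j xQ.
  have subQ := @shrink_sub x a l j xQ.
  have hz i : shrink x a j 0 i <= shrink x a j.+1 0 i /\
      shrink x a j.+1 0 i + t / 2 <= shrink x a j 0 i + t.
    have := xQ i; rewrite /= in_itv/= !shrinkE /t exprS invfM.
    have [h1 h2] := pow2N j; move=> /andP[h3 h4]; split; nra.
  rewrite /A tS -/t.
  apply: (le_trans (kernel_diff (a := fun i => shrink x a j 0 i)
    (b := fun i => shrink x a j 0 i + t) oD wf m0 _ _ _ _ _ _ _ B0 hB)) => //.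
  - by rewrite ler_pdivrMr// ler_peMr ?(ltW t0)// ler1n.
  - by move=> i; have [] := hz i.
  - by move=> i; have [] := hz i.
  - exact: subset_trans subQ QD.
  rewrite -/(ccube _ _).
  have L1 i : \int[mu]_(y in ccube (shrink x a j) t) `|g i y| <=
      2 * (I / t ^+ n) `^ r^-1 * t ^+ n.
    have sD : ccube (shrink x a j) t `<=` D by exact: subset_trans subQ QD.
    apply: cube_L1_le => //.
    - exact: compact_ccube.
    - by rewrite lebesgue_ccube// ltW.
    - by rewrite exprn_gt0.
    - have [_ lg _] := wf i; apply/Lp1P; first exact: measurable_rV_box.
      by apply: lg => //; exact: compact_ccube.
    - apply: le_trans (hI i); apply: ge0_subset_integral => //.
      + exact: measurable_rV_box.
      + exact: measurable_rV_box.
      + have [_ lg _] := wf i; have [mg _] := lg _ (@compact_ccube _ _ a l) QD.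
        apply/measurable_EFinP; apply: (measurableT_comp (measurable_powR r)).
        exact: measurableT_comp.
  apply: (@le_trans _ _ ((B / (t / 2)) ^+ n.-1 *
      (n%:R * (2 * (I / t ^+ n) `^ r^-1 * t ^+ n)))).
    rewrite ler_wpM2l ?exprn_ge0 ?divr_ge0 ?(ltW B0) ?(ltW t0)//.
    apply: (@le_trans _ _ (\sum_(i < n) (2 * (I / t ^+ n) `^ r^-1 * t ^+ n))).
      by apply: ler_sum => i _; exact: L1.
    by rewrite sumr_const card_ord [leRHS]mulr_natl.
  have -> : B / (t / 2) = 2 * B / t by field; rewrite gt_eqF.
  rewrite expr_div_n.
  have -> : t ^+ n = t ^+ n.-1 * t by rewrite -exprSr prednK.
  have tn0 : t ^+ n.-1 != 0 by rewrite expf_neq0// gt_eqF.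
  rewrite -{1}[t ^+ n.-1 * t]exprSr prednK//.
  have -> : (2 * B) ^+ n.-1 / t ^+ n.-1 * (n%:R * (2 * (I / t ^+ n) `^ r^-1 *
      (t ^+ n.-1 * t))) = C1 * ((I / t ^+ n) `^ r^-1 * t).
    by rewrite /C1; field.
  rewrite powR_scale// -/kap /t powRM ?(ltW l0)//.
  have -> : (2 ^- j) `^ kap = rho ^+ j :> R.
    rewrite /rho -exprVn -powR_mulrn// -powRrM mulrC powRrM powR_mulrn ?powR_ge0//.
  by rewrite le_eqVlt; apply/orP; left; apply/eqP; ring.
have -> : average D f a l = A 0%N by rewrite /A shrink0 expr0 invr1 mul1r.
rewrite -/(A k); clearbody A; set X := C1 * I `^ r^-1 * l `^ kap in step *.
have X0 : 0 <= X.
  apply: mulr_ge0; last exact: powR_ge0.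
  by apply: mulr_ge0; [exact: ltW|exact: powR_ge0].
have -> : A 0%N - A k = \sum_(0 <= j < k) (A j - A j.+1).
  elim: (k) => [|m ih]; first by rewrite big_geq// subrr.
  by rewrite big_nat_recr//= -ih addrA subrK.
apply: (le_trans (ler_norm_sum _ _ _)).
apply: (@le_trans _ _ (\sum_(0 <= j < k) X * rho ^+ j)); first exact: ler_sum.
rewrite -mulr_sumr.
have -> : C1 / (1 - rho) * I `^ r^-1 * l `^ kap = X / (1 - rho) by rewrite /X; ring.
rewrite ler_wpM2l// big_mkord.
have E : (1 - rho) * (\sum_(i < k) rho ^+ i) = 1 - rho ^+ k.
  by rewrite -[RHS]opprB subrX1 -mulNr opprB.
have rk : 0 <= rho ^+ k by rewrite exprn_ge0// ltW.
by rewrite -[leRHS]mul1r ler_pdivlMr// mulrC E lerBlDr lerDl.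
Qed.

Lemma average_cvg D f a l x : open D -> continuous f -> 0 < l ->
  ccube a l `<=` D -> ccube a l x -> forall e : R, 0 < e ->
  \forall k \near \oo, `|average D f (shrink x a k) (2 ^- k * l) - f x| <= e.
Proof.
move=> oD cf l0 QD xQ e e0; have [B B0 hB] := @dsstep_bounded R.
have mD := measurable_openV oD.
(* The kernel is at most (B / t)^n on a cube of volume t^n, so its L^1 norm is at most B^n; the
   tolerance is divided accordingly. *)
have e'0 : 0 < e / B ^+ n by rewrite divr_gt0// exprn_gt0.
have /nbhs_ballP[d /= d0 hd] : nbhs x [set y | `|f x - f y| < e / B ^+ n].
  by have /cvgrPdist_lt := cf x; apply.
have : \forall k \near \oo, (2 ^- k * l : R) < d.
  have [k0 _ hk0] : \forall k \near \oo, (k.+1%:R^-1 : R) < d / l.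
    by apply: near_infty_natSinv_lt (PosNum _) => //; rewrite divr_gt0.
  exists k0 => //= k kk; rewrite -ltr_pdivlMr//; apply: le_lt_trans (hk0 k kk).
  rewrite lef_pV2 ?posrE ?exprn_gt0// -natrX ler_nat.
  exact: ltn_expl.
apply: filterS => k kd; set t := 2 ^- k * l; set z := shrink x a k.
have t0 : 0 < t by rewrite mulr_gt0// (pow2N k).1.
have zD : ccube z t `<=` D by apply: subset_trans QD; exact: shrink_sub.
have xz : ccube z t x by apply: shrink_mem => //; exact: ltW.
have lf := @Lp_loc1_continuous _ _ D _ cf.
have lfx : Lp_loc 1%E D (fun y => -1 * cst (f x) y + f y).
  by apply: Lp_loc1D => //; apply: Lp_loc1_continuous; exact: cst_continuous.
have tk := test_kernel t0 zD.
have -> : average D f z t - f x = \int[mu]_(y in D) ((-1 * cst (f x) y + f y) * kernel z t y).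
  have i1 := test_integrable oD lf tk.
  have i2 := test_integrable oD (@Lp_loc1_continuous _ _ D (cst 1) (@cst_continuous _ _ _)) tk.
  have E1 : \int[mu]_(y in D) (cst 1 y * kernel z t y) = 1.
    by under eq_Rintegral do rewrite mul1r; exact: integral_kernel.
  have -> : (fun y => (-1 * f x + f y) * kernel z t y) =
      (fun y => (- f x) * (cst 1 y * kernel z t y) + f y * kernel z t y).
    by apply/funext => y /=; ring.
  rewrite RintegralD//; last exact: (integrableZl mD (- f x) i2).
  by rewrite RintegralZl// E1 mulr1 addrC.
have kB y : `|kernel z t y| <= (B / t) ^+ n.
  apply: (le_trans (@tensor_le _ _ _ (fun=> B / t) _ _)); last first.
    by rewrite prodr_const card_ord.
  move=> i u; rewrite /kern normrM gtr0_norm ?invr_gt0// mulrC.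
  by rewrite ler_wpM2r ?invr_ge0 ?(ltW t0).
apply: (le_trans (@test_bound _ _ D (ccube z t) _ _ _ oD (@compact_ccube _ _ z t) zD lfx tk kB _)).
  by move=> y; apply: tensor_out; exact: kern_supported.
have mQ : measurable (ccube z t) by exact: measurable_rV_box.
apply: (@le_trans _ _ ((B / t) ^+ n * (e / B ^+ n * t ^+ n))).
  rewrite ler_wpM2l ?exprn_ge0 ?divr_ge0 ?(ltW B0) ?(ltW t0)//.
  have -> : e / B ^+ n * t ^+ n = \int[mu]_(y in ccube z t) cst (e / B ^+ n) y.
    by rewrite Rintegral_cst//= lebesgue_ccube ?ltW.
  apply: le_Rintegral => //.
  - apply: integrable_norm; apply/Lp1P => //; apply: lfx => //; exact: compact_ccube.
  - apply: continuous_integrable_compact; [exact: compact_ccube|exact: cst_continuous].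
  - move=> y yz; rewrite mulN1r addrC distrC ltW//; apply: hd; apply/ball_rV => // i.
    have := xz i; have := yz i; rewrite /= !in_itv/= => h1 h2.
    apply: le_lt_trans kd; rewrite -/t.
    by rewrite ler_norml; move: h1 h2 => /andP[? ?] /andP[? ?]; apply/andP; split; lra.
rewrite expr_div_n.
have b0 : B ^+ n != 0 by rewrite expf_neq0// gt_eqF.
have tn0 : t ^+ n != 0 by rewrite expf_neq0// gt_eqF.
by rewrite le_eqVlt; apply/orP; left; apply/eqP; field; rewrite tn0 b0.
Qed.

(** Limit of [morrey_averages] as the small cube shrinks to [x], by continuity of [f]. *)
Lemma morrey_osc (r : R) : (0 < n)%N -> n%:R < r ->
  exists2 C : R, 0 < C & forall D f (g : 'I_n -> V -> R) a l I x,
    open D -> continuous f -> (forall i, weak_partial D [:: i] f (g i)) ->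
    0 < l -> ccube a l `<=` D -> 0 < I ->
    (forall i, \int[mu]_(y in ccube a l) (`|g i y| `^ r)%:E <= I%:E)%E ->
    ccube a l x ->
    `|f x - average D f a l| <= C * I `^ r^-1 * l `^ (1 - n%:R / r).
Proof.
move=> n0 nr; have [C C0 hC] := morrey_averages n0 nr.
exists C => // D f g a l I x oD cf wf l0 QD I0 hI xQ.
apply/ler_addgt0Pl => e e0.
have [k _ /(_ k (leqnn k)) hk] := average_cvg oD cf l0 QD xQ e0.
have := hC D f g a l I x k oD wf l0 QD I0 hI xQ; move: hk => /=.
set X := average D f a l; set Y := average _ _ _ _; set W := _ * _ * _.
move=> h1 h2; rewrite (le_trans (ler_distD Y _ _))//.
by apply: lerD; rewrite distrC.
Qed.

(** When the cube moves along axis [i], the average of [f] varies at the rate of the average of its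
    weak derivative. The constant of the second order error may depend on [t], but neither on [z]
    nor on [eta]. *)
Lemma average_translate D f (g : 'I_n -> V -> R) (a b : 'I_n -> R) t i :
  open D -> (forall i, weak_partial D [:: i] f (g i)) -> rV_box a b `<=` D ->
  0 < t -> exists2 C : R, 0 <= C & forall z (eta : R),
    ccube z t `<=` rV_box a b -> ccube (z + eta *: evec i) t `<=` rV_box a b ->
    `|average D f (z + eta *: evec i) t - average D f z t -
      eta * average D (g i) z t| <= C * eta ^+ 2.
Proof.
move=> oD wf QD t0; have [B B0 hB] := @dsstep_bounded R.
have [B' B'0 hB'] := @ddsstep_bounded R.
have mD := measurable_openV oD.
exists (B' / t ^+ 2 * (B / t) ^+ n.-1 * \int[mu]_(y in rV_box a b) `|g i y|).
  apply: mulr_ge0; last by apply: Rintegral_ge0.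
  by rewrite mulr_ge0 ?exprn_ge0 ?divr_ge0 ?exprn_ge0 ?(ltW t0) ?(ltW B0) ?(ltW B'0).
move=> z eta zQ z'Q; set z' := z + _.
have z'E j : z' 0 j = z 0 j + eta * (j == i)%:R.
  by rewrite /z' !mxE eqxx.
pose be (j : 'I_n) := kern (z 0 j) t.
pose w (x : R) := cdf (z' 0 i) t x + -1 * cdf (z 0 i) t x.
(* [w] is a primitive of the difference of the two kernels; [w2] measures its distance to the first
   order term and is of order eta^2 by [cdf_translate]. *)
pose w2 (x : R) := w x + eta * kern (z 0 i) t x.
have sbe : smooths be by move=> j; exact: smooth1_kern.
have sw : smooth1 w.
  apply: smooth1D; first exact: smooth1_cdf.
  by apply: smooth1M; [exact: smooth1_cst|exact: smooth1_cdf].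
have sw2 : smooth1 w2.
  apply: smooth1D => //.
  by apply: smooth1M; [exact: smooth1_cst|exact: smooth1_kern].
have dw : derive1 w = fun x : R => kern (z' 0 i) t x - kern (z 0 i) t x.
  have [-> //] : derive1 w = (fun x : R => kern (z' 0 i) t x - kern (z 0 i) t x) /\
    forall x : R, derivable w x 1.
  apply: derive1_is_derive => x; rewrite /w -[- kern _ _ _]mulN1r.
  apply: is_deriveD; first exact: is_derive_cdf.
  exact: (is_deriveZ (-1) (is_derive_cdf (z 0 i) t x)).
have corner_in y : ccube y t `<=` rV_box a b -> forall j, a j <= y 0 j /\ y 0 j + t <= b j.
  move=> h j.
  have h1 : ccube y t y by move=> k; rewrite /= in_itv/= lexx lerDl ltW.
  have h2 : ccube y t (y + const_mx t).
    by move=> k; rewrite /= in_itv/= !mxE lexx lerDl ltW.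
  have := h _ h1 j; have := h _ h2 j; rewrite /= !in_itv/= !mxE.
  by move=> /andP[_ ->] /andP[-> _].
have cz := corner_in _ zQ; have cz' := corner_in _ z'Q.
have supk (y : V) j (x : R) : (forall j, a j <= y 0 j /\ y 0 j + t <= b j) ->
    ~~ (a j <= x <= b j) -> kern (y 0 j) t x = 0.
  move=> h; have [h1 h2] := h j => nx; apply: kern_out => //; apply: contra nx.
  by move=> /andP[h3 h4]; rewrite (le_trans h1 h3) (le_trans h4 h2).
have w0 (x : R) : ~~ (a i <= x <= b i) -> w x = 0.
  have [h1 h2] := cz i; have [h3 h4] := cz' i.
  rewrite negb_and -!ltNge => /orP[h|h].
    rewrite /w !cdf_left// ?mulr0 ?addr0// ltW//; exact: lt_le_trans h _.
  rewrite /w !cdf_right// ?mulr1 ?subrr//; exact: le_trans (ltW h).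
have w20 (x : R) : ~~ (a i <= x <= b i) -> w2 x = 0.
  by move=> h; rewrite /w2 w0// (supk z)// mulr0 addr0.
have sup : supported be a b by move=> j x; exact: supk.
pose psi := tensor (upd be i w); pose psi2 := tensor (upd be i w2).
have tpsi : test_function D psi.
  by apply: test_function_tensor QD; [exact: smooths_upd|exact: supported_upd].
have tpsi2 : test_function D psi2.
  by apply: test_function_tensor QD; [exact: smooths_upd|exact: supported_upd].
have kz : kernel z t = tensor be by [].
have kz' x : kernel z' t x = tensor (upd be i (kern (z' 0 i) t)) x.
  rewrite tensor_upd /kernel (tensor_split _ i); congr (_ * _).
  by apply: eq_bigr => j /negbTE ji; rewrite z'E ji mulr0 addr0.
have Dpsi x : partial [:: i] psi x = kernel z' t x - kernel z t x.
  transitivity ('D_(evec i) psi x) => //.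
  have -> : 'D_(evec i) psi x = tensor (upd (upd be i w) i (derive1 (upd be i w i))) x.
    by rewrite -derive_tensor//; exact: smooths_upd.
  rewrite updE dw kz' kz !tensor_upd (tensor_split be i) mulrBl.
  have E : \prod_(j < n | j != i) upd be i w j (x 0 j) =
      \prod_(j < n | j != i) be j (x 0 j).
    by apply: eq_bigr => j /negbTE jk; rewrite /upd jk.
  by rewrite E.
have psi2E x : psi2 x = psi x + eta * kernel z t x.
  rewrite /psi2 /psi kz !tensor_upd (tensor_split be i) /w2 mulrDl; congr (_ + _).
  by rewrite mulrA.
have [lf lg hi] := wf i.
have tk : test_function D (kernel z t) by apply: test_kernel => //; exact: subset_trans QD.
have tk' : test_function D (kernel z' t) by apply: test_kernel => //; exact: subset_trans QD.
have i1 := test_integrable oD lf tk; have i2 := test_integrable oD lf tk'.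
have i3 := test_integrable oD lg tpsi; have i4 := test_integrable oD lg tk.
have E1 : average D f z' t - average D f z t = - \int[mu]_(x in D) (g i x * psi x).
  rewrite [LHS](esym (RintegralB mD i2 i1)).
  have H := hi _ tpsi; rewrite expr1 mulN1r in H; rewrite -H.
  by congr (Rintegral _ _ _); apply/funext => x; rewrite Dpsi mulrBr.
have E2 : \int[mu]_(x in D) (g i x * psi2 x) =
    \int[mu]_(x in D) (g i x * psi x) + eta * average D (g i) z t.
  rewrite /average -RintegralZl// -RintegralD//; last exact: (integrableZl mD eta i4).
  congr (Rintegral _ _ _); apply/funext => x; rewrite psi2E; ring.
have -> : average D f z' t - average D f z t - eta * average D (g i) z t =
    - \int[mu]_(x in D) (g i x * psi2 x) by rewrite E1 E2 opprD.
rewrite normrN.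
have Bt : 0 <= B / t by rewrite divr_ge0 ?ltW.
have psi2B x : `|psi2 x| <= B' / t ^+ 2 * (B / t) ^+ n.-1 * eta ^+ 2.
  apply: (le_trans (@tensor_le _ _ _ (fun j => if j == i then B' / t ^+ 2 * eta ^+ 2 else B / t) _ _)).
    move=> j y; rewrite /upd; case: ifP => _; last first.
      rewrite /be /kern normrM gtr0_norm ?invr_gt0// mulrC.
      by rewrite ler_wpM2r ?invr_ge0 ?(ltW t0).
    rewrite /w2 /w z'E eqxx mulr1 mulN1r; exact: cdf_translate.
  rewrite (bigD1 i)//= eqxx.
  rewrite (eq_bigr (fun=> B / t)); last by move=> j /negbTE ->.
  rewrite prodr_const (_ : #|[pred j | j != i]| = n.-1).
    by rewrite le_eqVlt; apply/orP; left; apply/eqP; ring.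
  by rewrite -[in RHS](card_ord n) -(cardC1 i).
apply: (le_trans (test_bound oD (@compact_rV_box _ _ a b) QD lg tpsi2 psi2B _)).
  by move=> x; apply: tensor_out; exact: supported_upd.
by rewrite le_eqVlt; apply/orP; left; apply/eqP; ring.
Qed.

(** The slope is the average of [g i] over the big cube. Small averages of [f] move at the rate of
    small averages of [g i], each within [om] of the slope by [morrey_averages]; shrinking the small
    cubes recovers the values of [f]. *)
Lemma morrey_affine (r : R) : (0 < n)%N -> n%:R < r ->
  exists2 C : R, 0 < C & forall D f (g : 'I_n -> V -> R) (h : 'I_n -> 'I_n -> V -> R) a l I,
    open D -> continuous f -> (forall i, weak_partial D [:: i] f (g i)) ->
    (forall i j, weak_partial D [:: j] (g i) (h i j)) ->
    0 < l -> ccube a l `<=` D -> 0 < I ->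
    (forall i j, \int[mu]_(y in ccube a l) (`|h i j y| `^ r)%:E <= I%:E)%E ->
    forall i, exists gam : R, forall x s, ccube a l x -> ccube a l (x + s *: evec i) ->
      `|f (x + s *: evec i) - f x - s * gam| <=
        `|s| * (C * I `^ r^-1 * l `^ (1 - n%:R / r)).
Proof.
move=> n0 nr; have [C C0 hC] := morrey_averages n0 nr.
exists C => // D f g h a l I oD cf wf wg l0 QD I0 hI i.
exists (average D (g i) a l) => x s xQ xsQ.
set gam := average _ _ _ _; set om := C * _ * _.
(* When [x] moves by [s], the corner of its shrunk cube moves only by (1 - 2^-k) s. *)
have main k : `|average D f (shrink (x + s *: evec i) a k) (2 ^- k * l) -
    average D f (shrink x a k) (2 ^- k * l) - (1 - 2 ^- k) * s * gam| <= `|s| * om.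
  have [th0 th1] := pow2N k; set th := 2 ^- k in th0 th1 *; set t := th * l.
  have t0 : 0 < t by rewrite mulr_gt0.
  have [C' C'0 hC'] := @average_translate D f g (fun j => a 0 j) (fun j => a 0 j + l) t i oD wf QD t0.
  pose y (u : R) : V := x + (u * s) *: evec i.
  pose z (u : R) : V := shrink (y u) a k.
  have yE u j : y u 0 j = x 0 j + u * s * (j == i)%:R by rewrite /y !mxE eqxx.
  have yQ u : 0 <= u <= 1 -> ccube a l (y u).
    move=> /andP[u0 u1] j; have := xQ j; have := xsQ j; rewrite /= !in_itv/= yE !mxE eqxx.
    by case: (j == i); move=> /andP[? ?] /andP[? ?]; apply/andP; split; nra.
  have zz u v : z u = z v + ((u - v) * s * (1 - th)) *: evec i.
    apply/rowP => j; rewrite [RHS]mxE [X in _ = _ + X]mxE evecE /z !shrinkE !yE -/th; ring.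
  pose psi u := average D f (z u) t - u * (1 - th) * s * gam.
  have -> : average D f (shrink (x + s *: evec i) a k) t -
    average D f (shrink x a k) t - (1 - th) * s * gam = psi 1 - psi 0.
    have y1 : y 1 = x + s *: evec i by rewrite /y mul1r.
    have y0 : y 0 = x by rewrite /y mul0r scale0r addr0.
    rewrite /psi /z y1 y0.
    move: (average D f _ _) (average D f _ _) => X Y; ring.
  (* The translation constant [C'] depends on the scale; [refine_bound] removes it before [k] tends
     to infinity. *)
  apply: (@refine_bound _ psi _ (C' * s ^+ 2)); first by rewrite mulr_ge0 ?sqr_ge0.
  move=> u v u01 v01; set eta := (u - v) * s * (1 - th).
  have zQ w : 0 <= w <= 1 -> ccube (z w) t `<=` ccube a l.
    by move=> w01; apply: shrink_sub; exact: yQ.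
  have h1 := hC' (z v) eta (zQ v v01); rewrite -zz in h1.
  have {}h1 := h1 (zQ u u01).
  have h2 := hC D (g i) (h i) a l I (y v) k oD (wg i) l0 QD I0 (hI i) (yQ v v01).
  rewrite -/om -/gam -/(z v) -/th -/t in h2.
  have -> : psi u - psi v = (average D f (z u) t - average D f (z v) t -
      eta * average D (g i) (z v) t) + eta * (average D (g i) (z v) t - gam).
    have alg (X Y G g' : R) : (X - u * (1 - th) * s * g') -
        (Y - v * (1 - th) * s * g') = (X - Y - (u - v) * s * (1 - th) * G) +
        (u - v) * s * (1 - th) * (G - g') by ring.
    exact: alg.
  rewrite (le_trans (ler_normD _ _))// addrC lerD//.
    rewrite normrM -(distrC gam) /eta !normrM (ger0_norm (_ : 0 <= 1 - th)); last by rewrite subr_ge0.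
    have om0 : 0 <= om by exact: le_trans (normr_ge0 _) h2.
    apply: (@le_trans _ _ (`|u - v| * `|s| * (1 - th) * om)).
      by rewrite ler_wpM2l// !mulr_ge0// subr_ge0.
    rewrite -mulrA [leRHS](_ : _ = `|u - v| * `|s| * om); last by ring.
    by rewrite ler_wpM2l ?mulr_ge0// ler_piMl// lerBlDr lerDl ltW.
  apply: (le_trans h1); rewrite -mulrA ler_wpM2l// /eta.
  have -> : ((u - v) * s * (1 - th)) ^+ 2 = (s ^+ 2 * (u - v) ^+ 2) * (1 - th) ^+ 2 by ring.
  apply: ler_piMr; first by rewrite mulr_ge0 ?sqr_ge0.
  by rewrite exprn_ile1 ?subr_ge0// lerBlDr lerDl ltW.
apply/ler_addgt0Pl => e e0.
have e30 : 0 < e / 3 by rewrite divr_gt0.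
have a1 := average_cvg oD cf l0 QD xQ e30.
have a2 := average_cvg oD cf l0 QD xsQ e30.
have a3 : \forall k \near \oo, `|(2 ^- k : R) * s * gam| <= e / 3.
  have X0 : 0 < `|s * gam| + 1 by rewrite ltr_pwDr.
  have [k0 _ hk0] : \forall k \near \oo, (k.+1%:R^-1 : R) < e / 3 / (`|s * gam| + 1).
    by apply: near_infty_natSinv_lt (PosNum _) => //; rewrite divr_gt0.
  exists k0 => //= k kk; rewrite -mulrA normrM gtr0_norm ?(pow2N k).1//.
  apply: (@le_trans _ _ (2 ^- k * (`|s * gam| + 1))).
    by rewrite ler_wpM2l ?(ltW (pow2N k).1)// lerDl.
  rewrite -ler_pdivlMr//; apply: le_trans (ltW (hk0 k kk)).
  rewrite lef_pV2 ?posrE ?exprn_gt0// -natrX ler_nat.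
  exact: ltn_expl.
have [k _ hk] := filterI (filterI a1 a2) a3.
have [[h1 h2] h3] := hk k (leqnn k); have := main k.
move: h1 h2 h3; rewrite /=.
set A1 := average _ _ _ _; set A2 := average _ _ _ _; set fx := f x; set fxs := f _.
set T := 2 ^- k * s * gam.
rewrite (_ : (1 - 2 ^- k) * s * gam = s * gam - T); last by rewrite /T; ring.
move: (s * gam) (`|s| * om) => P Q.
rewrite !ler_norml => /andP[? ?] /andP[? ?] /andP[? ?] /andP[? ?].
apply/andP; split; lra.
Qed.

End morrey.

(** * Sobolev spaces *)

Section Lp_norm.
Context {R : realType} {n : nat}.
Local Notation V := 'rV[R]_n.
Local Notation mu := (lebesgue_rV R n).
Implicit Types (D K : set V) (f g phi : V -> R) (r a : R).

Definition Nrm r D f : \bar R := Lnorm mu r%:E (EFin \o (f \_ D)).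

Lemma NrmE r D f : 0 < r ->
  Nrm r D f = ((\int[mu]_(x in D) (`|f x| `^ r)%:E) `^ r^-1)%E.
Proof.
by move=> r0; rewrite -Lnorm_restrictE// /Nrm; rewrite unlock; congr (_ `^ _)%E.
Qed.

Lemma Nrm_ge0 r D f : (0 <= Nrm r D f)%E.
Proof. exact: Lnorm_ge0. Qed.

Lemma measurable_powR_norm r D f : measurable_fun D f ->
  measurable_fun D (fun x => (`|f x| `^ r)%:E).
Proof.
move=> mf; apply/measurable_EFinP; apply: (measurableT_comp (measurable_powR r)).
exact: measurableT_comp.
Qed.

Lemma Nrm_triangle r D f g : 1 <= r -> measurable D ->
  measurable_fun D f -> measurable_fun D g ->
  (Nrm r D (fun x => (f x + g x)%R) <= Nrm r D f + Nrm r D g)%E.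
Proof.
move=> r1 mD mf mg; rewrite /Nrm.
have -> : (fun x => f x + g x) \_ D = (f \_ D \+ g \_ D).
  by apply/funext => x /=; rewrite !restrictE; case: ifP => // _; rewrite addr0.
apply: eminkowski => //.
  exact/(measurable_restrictT f mD).
exact/(measurable_restrictT g mD).
Qed.

Lemma Nrm_scale r D a f : 0 < r -> measurable D -> measurable_fun D f ->
  Nrm r D (fun x => a * f x) = (`|a|%:E * Nrm r D f)%E.
Proof.
move=> r0 mD mf; rewrite (NrmE D _ r0) (NrmE D f r0).
have -> : (\int[mu]_(x in D) (`|a * f x| `^ r)%:E =
    (`|a| `^ r)%:E * \int[mu]_(x in D) (`|f x| `^ r)%:E)%E.
  rewrite -ge0_integralZl//; last exact: measurable_powR_norm.
  by apply: eq_integral => x _; rewrite normrM powRM// EFinM.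
rewrite poweRM//; last by apply: integral_ge0 => x _; rewrite lee_fin powR_ge0.
by rewrite poweR_EFin -powRrM divff ?gt_eqF// powRr1.
Qed.

Lemma Nrm_ae r D f g : 0 < r -> measurable D -> measurable_fun D f ->
  measurable_fun D g -> ae_eq mu D f g -> Nrm r D f = Nrm r D g.
Proof.
move=> r0 mD mf mg fg; rewrite (NrmE D f r0) (NrmE D g r0).
suff -> : (\int[mu]_(x in D) (`|f x| `^ r)%:E =
  \int[mu]_(x in D) (`|g x| `^ r)%:E)%E by [].
apply: ae_eq_integral => //; [exact: measurable_powR_norm|exact: measurable_powR_norm|].
by apply: filterS fg => x h Dx; rewrite h.
Qed.

Lemma Nrm_le r D f g : 0 < r -> measurable D -> measurable_fun D f ->
  measurable_fun D g -> (forall x, D x -> `|f x| <= `|g x|) ->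
  (Nrm r D f <= Nrm r D g)%E.
Proof.
move=> r0 mD mf mg fg; rewrite (NrmE D f r0) (NrmE D g r0).
apply: gt0_ler_poweR; first by rewrite invr_ge0 ltW.
- by rewrite in_itv/= leey andbT; apply: integral_ge0 => x _; rewrite lee_fin powR_ge0.
- by rewrite in_itv/= leey andbT; apply: integral_ge0 => x _; rewrite lee_fin powR_ge0.
apply: ge0_le_integral => //; [exact: measurable_powR_norm|exact: measurable_powR_norm|].
move=> x Dx; rewrite lee_fin.
by apply: ge0_ler_powR; [exact: ltW|rewrite nnegrE|rewrite nnegrE|exact: fg].
Qed.

Lemma Nrm_eq0 r D f : 0 < r -> measurable D -> measurable_fun D f ->
  Nrm r D f = 0%E -> ae_eq mu D f (cst 0).
Proof.
move=> r0 mD mf N0; have mr : measurable_fun setT (f \_ D) by exact/(measurable_restrictT f mD).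
have := Lnorm_eq0_eq0 (mu := mu) (f := EFin \o (f \_ D)) (p := r%:E) _ _ N0.
move=> h; have {h} : ae_eq mu setT (EFin \o (f \_ D)) (cst 0%E).
  by apply: h => //; exact/measurable_EFinP.
apply: filterS => x h Dx; have := h I; rewrite /= restrictE mem_set//.
by case.
Qed.

Lemma Nrm_int r D f (I : R) : 0 < r -> (Nrm r D f <= I%:E)%E -> 0 <= I ->
  (\int[mu]_(x in D) (`|f x| `^ r)%:E <= (I `^ r)%:E)%E.
Proof.
move=> r0 + I0; rewrite NrmE// => h.
have i0 : (0 <= \int[mu]_(x in D) (`|f x| `^ r)%:E)%E.
  by apply: integral_ge0 => x _; rewrite lee_fin powR_ge0.
have : (((\int[mu]_(x in D) (`|f x| `^ r)%:E) `^ r^-1) `^ r <= I%:E `^ r)%E.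
  apply: gt0_ler_poweR => //; first exact: ltW.
  - by rewrite in_itv/= leey andbT poweR_ge0.
  - by rewrite in_itv/= leey andbT lee_fin.
by rewrite -poweRrM mulVf ?gt_eqF// poweRe1// poweR_EFin.
Qed.

Lemma Lp_lin r D a f g : 1 <= r -> measurable D -> Lp r%:E D f -> Lp r%:E D g ->
  Lp r%:E D (fun x => a * f x + g x).
Proof.
move=> r1 mD [mf Nf] [mg Ng]; have r0 : 0 < r by rewrite (lt_le_trans _ r1).
have maf : measurable_fun D (fun x => a * f x) by apply: measurable_funM.
split; first exact: measurable_funD.
apply: (le_lt_trans (Nrm_triangle r1 mD maf mg)); rewrite Nrm_scale//.
by rewrite lte_add_pinfty// lte_mul_pinfty// ?Nrm_ge0.
Qed.

Lemma Lp_test r D phi : 0 < r -> open D -> test_function D phi -> Lp r%:E D phi.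
Proof.
move=> r0 oD tphi; have [sp cK KD] := tphi; have mD := measurable_openV oD.
have cp := smooth_continuous sp; have mK := measurable_compactV cK.
have mphi : measurable_fun setT phi by exact: measurable_continuous.
apply/LpP => //; split; first exact: measurable_funTS.
have [C C0 hC] := continuous_bounded_compact cK cp.
have -> : (\int[mu]_(x in D) (`|phi x| `^ r)%:E =
    \int[mu]_(x in closed_support phi) (`|phi x| `^ r)%:E)%E.
  rewrite integral_mkcond [RHS]integral_mkcond; apply: eq_integral => x _.
  rewrite !patchE; case: ifPn => [xD|/negP xD]; case: ifPn => [xK|/negP xK] //.
    rewrite (@closed_support_out _ _ phi) ?normr0 ?powR0 ?gt_eqF//.
    by move/mem_set.
  by exfalso; apply: xD; apply: mem_set; apply: KD; exact: set_mem.
have : mu.-integrable (closed_support phi) (EFin \o (fun x => `|phi x| `^ r)).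
  have i1 := continuous_integrable_compact cK (@cst_continuous _ _ (C `^ r)).
  apply: (le_integrable mK _ _ i1).
    by apply: measurable_powR_norm; exact: measurable_funTS.
  move=> x Kx; rewrite /= lee_fin !(ger0_norm (powR_ge0 _ _)).
  have h := hC x Kx; have r0' := ltW r0. exact: ge0_ler_powR.
move=> /integrableP[_]; apply: le_lt_trans.
by apply: ge0_le_integral => //; [exact: measurable_powR_norm (measurable_funTS mphi)
  |apply: measurableT_comp => //; exact: measurable_powR_norm (measurable_funTS mphi)
  |move=> x _; rewrite /= lee_fin ler_norm].
Qed.

End Lp_norm.

(** * First order Sobolev spaces and density of test functions *)

Section W1_space.
Context {R : realType} {n : nat}.
Local Notation V := 'rV[R]_n.
Local Notation mu := (lebesgue_rV R n).
Implicit Types (D K : set V) (f g phi : V -> R) (r a : R).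

Lemma wgradP D f i g : weak_partial D [:: i] f g ->
  weak_partial D [:: i] f (wgrad D f i).
Proof. by move=> h; rewrite /wgrad; case: xgetP => [y _ //|/(_ g)]. Qed.

Lemma wgrad_ae D f i g : open D -> weak_partial D [:: i] f g ->
  ae_eq mu D (wgrad D f i) g.
Proof. by move=> oD h; apply: (weak_partial_unique oD _ h); exact: wgradP h. Qed.

(** A working form of [sobolev 1] in which the chosen representatives [wgrad] are themselves the
    derivatives in L^r. *)
Definition W1 r D f := [/\ Lp r%:E D f, Lp_loc 1%E D f &
  forall i, Lp r%:E D (wgrad D f i) /\ weak_partial D [:: i] f (wgrad D f i)].

Lemma W1_intro r D f (g : 'I_n -> V -> R) : 0 < r -> open D -> Lp r%:E D f ->
  Lp_loc 1%E D f -> (forall i, Lp r%:E D (g i)) ->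
  (forall i, weak_partial D [:: i] f (g i)) -> W1 r D f.
Proof.
move=> r0 oD lf lf1 lg wg; split => // i; have w := wgradP (wg i); split => //.
have [_ l1 _] := w; have m1 := Lp_loc1_measurable oD l1; split => //.
have [mg Ng] := lg i; apply: le_lt_trans Ng.
rewrite -/(Nrm _ _ _) -/(Nrm _ _ _) (Nrm_ae r0 _ m1 mg)//; first exact: measurable_openV.
exact: wgrad_ae.
Qed.

Lemma sobolev1P r D f : (0 < n)%N -> 0 < r -> open D ->
  sobolev 1 r%:E D f <-> W1 r D f.
Proof.
move=> n0 r0 oD; have mD := measurable_openV oD; split => [sf|[lf lf1 lg] s].
  have [g0 lg0 [lf1 lg01 h0]] := sf [::] isT.
  have mf := Lp_loc1_measurable oD lf1; have mg0 := Lp_loc1_measurable oD lg01.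
  (* The empty multi-index provides a function of L^r equal to [f] only against test functions;
     uniqueness of weak derivatives identifies the two. *)
  have fg : ae_eq mu D f g0.
    have wf : weak_partial D [::] f g0 by split.
    have wff : weak_partial D [::] f f.
      by split => // phi _; rewrite expr0 mul1r.
    exact: weak_partial_unique wff wf.
  have lf : Lp r%:E D f.
    split => //; have [_] := lg0; rewrite -!/(Nrm _ _ _).
    by rewrite (Nrm_ae r0 mD mf mg0 fg).
  have /choice[g hg] : forall i, exists g, Lp r%:E D g /\ weak_partial D [:: i] f g.
    by move=> i; have [g h1 h2] := sf [:: i] isT; exists g.
  by apply: (W1_intro (g := g)) => // i; have [] := hg i.
case: s => [|i [|//]] _; last by exists (wgrad D f i); have [] := lg i.
by exists f => //; split => // phi _; rewrite expr0 mul1r.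
Qed.

Lemma W1_lin r D a f g : 1 <= r -> open D -> W1 r D f -> W1 r D g ->
  W1 r D (fun x => a * f x + g x) /\
  forall i, ae_eq mu D (wgrad D (fun x => a * f x + g x) i)
    (fun x => a * wgrad D f i x + wgrad D g i x).
Proof.
move=> r1 oD [lf lf1 hf] [lg lg1 hg]; have mD := measurable_openV oD.
have r0 : 0 < r by rewrite (lt_le_trans _ r1).
have w i : weak_partial D [:: i] (fun x => a * f x + g x)
    (fun x => a * wgrad D f i x + wgrad D g i x).
  by apply: weak_partialD => //; [have [] := hf i|have [] := hg i].
split; last by move=> i; exact: wgrad_ae.
apply: W1_intro w => //; [exact: Lp_lin|exact: Lp_loc1D|].
by move=> i; apply: Lp_lin => //; [have [] := hf i|have [] := hg i].
Qed.

Lemma W1norm_fin r D f : W1 r D f -> (W1norm r%:E D f < +oo)%E.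
Proof.
move=> [[_ lf] _ hf]; rewrite /W1norm lte_add_pinfty//.
by apply: lte_sum_pinfty => i _; have [[_]] := hf i.
Qed.

Lemma W1norm_ge0 r D f : (0 <= W1norm r%:E D f)%E.
Proof.
by apply: adde_ge0; [exact: Lnorm_ge0|apply: sume_ge0 => i _; exact: Lnorm_ge0].
Qed.

Lemma W1norm_lin r D a f g : 1 <= r -> open D -> W1 r D f -> W1 r D g ->
  (W1norm r%:E D (fun x => (a * f x + g x)%R) <=
   `|a|%:E * W1norm r%:E D f + W1norm r%:E D g)%E.
Proof.
move=> r1 oD wf wg; have mD := measurable_openV oD.
have r0 : 0 < r by rewrite (lt_le_trans _ r1).
have [[lf lf1 hf] [lg lg1 hg]] := (wf, wg).
have [[_ lfg1 hfg] ae] := W1_lin a r1 oD wf wg.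
have N u v : Lp r%:E D u -> Lp r%:E D v ->
    (Nrm r D (fun x => (a * u x + v x)%R) <= `|a|%:E * Nrm r D u + Nrm r D v)%E.
  move=> [mu' _] [mv _]; have mau : measurable_fun D (fun x => a * u x) by apply: measurable_funM.
  by apply: (le_trans (Nrm_triangle r1 mD mau mv)); rewrite Nrm_scale.
rewrite /W1norm -!/(Nrm _ _ _).
rewrite ge0_muleDr ?Nrm_ge0 ?sume_ge0//.
rewrite addeACA leeD//; first exact: N.
rewrite ge0_sume_distrr//.
rewrite -big_split/=; apply: lee_sum => i _; rewrite -!/(Nrm _ _ _).
have [[m1 _] _] := hfg i; have [L1 _] := hf i; have [L2 _] := hg i.
rewrite (Nrm_ae r0 mD m1 _ (ae i)); first exact: N L1 L2.
  by have [] := Lp_lin a r1 mD L1 L2.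
all: by move=> i _; exact: Lnorm_ge0.
Qed.

Lemma partial_lin s a phi psi : smooth phi -> smooth psi ->
  partial s (fun x => a * phi x + psi x) =
  (fun x => a * partial s phi x + partial s psi x).
Proof.
move=> sp sq; elim: s => [//|i s ih]; rewrite [LHS]/= ih; apply/funext => x.
have [_ d1] := sp s; have [_ d2] := sq s.
have h1 : is_derive x (evec i) (partial s phi) (partial (i :: s) phi x).
  by apply: DeriveDef => //; exact: d1.
have h2 : is_derive x (evec i) (partial s psi) (partial (i :: s) psi x).
  by apply: DeriveDef => //; exact: d2.
by have [_] := is_deriveD (is_deriveZ a h1) h2.
Qed.

Lemma smooth_lin a phi psi : smooth phi -> smooth psi ->
  smooth (fun x => a * phi x + psi x).
Proof.
move=> sp sq s; rewrite partial_lin//; have [c1 d1] := sp s; have [c2 d2] := sq s.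
split => [x|i x].
  have h : continuous (fun y => a * partial s phi y).
    by move=> y; exact: continuousM (@cst_continuous _ _ a y) (c1 y).
  exact: continuousD (h x) (c2 x).
have h1 : is_derive x (evec i) (partial s phi) (partial (i :: s) phi x).
  by apply: DeriveDef => //; exact: d1.
have h2 : is_derive x (evec i) (partial s psi) (partial (i :: s) psi x).
  by apply: DeriveDef => //; exact: d2.
by have [] := is_deriveD (is_deriveZ a h1) h2.
Qed.

Lemma test_function_lin D a phi psi : test_function D phi -> test_function D psi ->
  test_function D (fun x => a * phi x + psi x).
Proof.
move=> [s1 c1 d1] [s2 c2 d2].
have sub : closed_support (fun x => a * phi x + psi x) `<=`
    closed_support phi `|` closed_support psi.
  rewrite {1}/closed_support closureE => x; apply; split.
    by apply: closedU; exact: closed_closure.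
  move=> y /= /eqP h; apply: contrapT => /not_orP[n1 n2]; apply: h.
  by rewrite (closed_support_out n1) (closed_support_out n2) mulr0 addr0.
split; first exact: smooth_lin.
  apply: subclosed_compact sub; first exact: closed_closure.
  exact: compactU.
by apply: subset_trans sub _ => x [/d1|/d2].
Qed.

Lemma W1_test r D phi : 0 < r -> open D -> test_function D phi ->
  W1 r D phi /\ forall i, ae_eq mu D (wgrad D phi i) ('D_(evec i) phi).
Proof.
move=> r0 oD tp; have [sp _ _] := tp; have w i := weak_partial_smooth i oD sp.
split; last by move=> i; exact: wgrad_ae.
apply: W1_intro w => //; first exact: Lp_test.
  by apply: Lp_loc1_continuous; exact: smooth_continuous.
by move=> i; apply: Lp_test => //; exact: (test_function_partial [:: i] tp).
Qed.

Lemma W10_W1 r D f : (0 < n)%N -> 0 < r -> open D -> W10 r%:E D f -> W1 r D f.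
Proof. by move=> n0 r0 oD [sf _]; exact/sobolev1P. Qed.

Lemma W10_lin r D a f g : (0 < n)%N -> 1 <= r -> open D -> W10 r%:E D f ->
  W10 r%:E D g -> W10 r%:E D (fun x => a * f x + g x).
Proof.
move=> n0 r1 oD wf wg; have r0 : 0 < r by rewrite (lt_le_trans _ r1).
have Wf := W10_W1 n0 r0 oD wf; have Wg := W10_W1 n0 r0 oD wg.
have [wl _] := W1_lin a r1 oD Wf Wg.
split; first exact: (sobolev1P _ n0 r0 oD).2 wl.
move=> e e0.
have A0 : 0 < `|a| + 1 by rewrite ltr_pwDr.
have e1 : 0 < e / 2 / (`|a| + 1) by rewrite !divr_gt0.
have e2 : 0 < e / 2 by rewrite divr_gt0.
have [phi tphi hphi] := wf.2 _ e1; have [psi tpsi hpsi] := wg.2 _ e2.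
exists (fun x => a * phi x + psi x); first exact: test_function_lin.
have W1p u chi : W1 r D u -> test_function D chi -> W1 r D (fun x => u x - chi x).
  move=> Wu tc; have [Wc _] := W1_test r0 oD tc.
  have [] := W1_lin (-1) r1 oD Wc Wu; rewrite [X in W1 r D X -> _](_ : _ = (fun x => u x - chi x))//.
  by apply/funext => x; rewrite mulN1r addrC.
have -> : (fun x => a * f x + g x) \- (fun x => a * phi x + psi x) =
    (fun x => a * (f x - phi x) + (g x - psi x)).
  by apply/funext => x /=; ring.
apply: (le_lt_trans (W1norm_lin a r1 oD (W1p _ _ Wf tphi) (W1p _ _ Wg tpsi))).
have -> : e%:E = ((e / 2)%:E + (e / 2)%:E)%E by rewrite -EFinD -splitr.
apply: lee_ltD => //.
  by rewrite ge0_fin_numE ?mule_ge0 ?W1norm_ge0// lte_mul_pinfty ?W1norm_ge0// (lt_trans hphi) ?ltry.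
apply: (@le_trans _ _ ((`|a| + 1)%:E * (e / 2 / (`|a| + 1))%:E)%E).
  by apply: lee_pmul; rewrite ?W1norm_ge0 ?lee_fin ?lerDl ?(ltW hphi).
by rewrite -EFinM lee_fin mulrC divfK ?gt_eqF.
Qed.

Lemma W1_opp_sub r D f g : 1 <= r -> open D -> W1 r D f -> W1 r D g ->
  W1 r D (fun x => f x - g x).
Proof.
move=> r1 oD wf wg; have [] := W1_lin (-1) r1 oD wg wf.
rewrite [X in W1 r D X -> _](_ : _ = (fun x => f x - g x))//.
by apply/funext => x; rewrite mulN1r addrC.
Qed.

End W1_space.

(** * The embedding of W^{1,r}_0 into C_0 for r > n *)

Section sobolev_embedding.
Context {R : realType} {n : nat}.
Local Notation V := 'rV[R]_n.
Local Notation mu := (lebesgue_rV R n).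
Variables (D : set V) (r : R).
Hypotheses (n0 : (0 < n)%N) (nr : n%:R < r) (oD : open D) (bD : bounded_set D).

Let r1 : 1 < r. Proof. by rewrite (le_lt_trans _ nr)// ler1n. Qed.
Let r0 : 0 < r. Proof. by rewrite (lt_trans _ r1). Qed.
Let mD : measurable D. Proof. exact: measurable_openV. Qed.

Lemma bounded_in_cube : exists (a : V) (l : R),
  [/\ 0 < l, D `<=` ccube a l, ccube a l a & ~ D a].
Proof.
have [M [_ hM]] := bD.
have {}hM x : D x -> `|x| <= `|M| + 1.
  by apply: hM; rewrite (le_lt_trans (ler_norm _))// ltrDl.
(* The points of [D] have norm at most |M| + 1, so the corner of this cube lies outside [D], where
   test functions vanish. *)
pose N := `|M| + 2.
have N0 : 0 < N by rewrite ltr_wpDl.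
exists (const_mx (- N)), (2 * N); split.
- by rewrite mulr_gt0.
- move=> x Dx i; rewrite /= in_itv/= mxE.
  have := le_trans (le_coord_norm x i) (hM x Dx).
  by rewrite ler_norml /N => /andP[h1 h2]; apply/andP; split; lra.
- move=> i; rewrite /= in_itv/= !mxE lexx lerDl mulr_ge0// ltW//.
- move=> /hM h; have := le_trans (le_coord_norm _ (Ordinal n0)) h.
  by rewrite mxE normrN gtr0_norm// /N; lra.
Qed.

Lemma bounded_measure_fin : (mu D < +oo)%E.
Proof.
have [a [l [l0 Dal _ _]]] := bounded_in_cube.
apply: (@le_lt_trans _ _ (mu (ccube a l))).
  by apply: le_measure; rewrite ?inE//; exact: measurable_rV_box.
by rewrite lebesgue_ccube ?ltry// ltW.
Qed.

(** A test function is extended by 0 to a cube with a corner outside [D]. Its values at [x] and at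
    the corner are both close to the same average, whence the factor 2. *)
Lemma test_sup_bound : exists2 C : R, 0 < C & forall phi, test_function D phi ->
  forall x, `|phi x| <= C * fine (W1norm r%:E D phi).
Proof.
have [C C0 hC] := @morrey_osc R n r n0 nr.
have [a [l [l0 Dal aa na]]] := bounded_in_cube.
have lk : 0 < l `^ (1 - n%:R / r) by rewrite powR_gt0.
exists (2 * C * l `^ (1 - n%:R / r)); first by rewrite !mulr_gt0.
move=> phi tphi x; have [W wae] := W1_test r0 oD tphi.
have Wfin := W1norm_fin W; set A := fine _.
have A0 : 0 <= A by apply: fine_ge0; exact: W1norm_ge0.
have EA : W1norm r%:E D phi = A%:E by rewrite /A fineK// ge0_fin_numE// W1norm_ge0.
have [sp cK KD] := tphi.
have [Dx|Dx] := pselect (D x); last first.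
  by rewrite (test_function_out tphi Dx) normr0 !mulr_ge0// ?(ltW C0) ?(ltW lk).
(* The Morrey estimate requires a positive bound on the integrals, while the norm [A] may be 0; [A']
   decreases to [A] at the end. *)
have osc (A' : R) : A < A' -> `|phi x| <= 2 * C * l `^ (1 - n%:R / r) * A'.
  move=> AA'; have A'0 : 0 < A' by exact: le_lt_trans AA'.
  have hI i : (\int[mu]_(y in ccube a l) (`|'D_(evec i) phi y| `^ r)%:E <= (A' `^ r)%:E)%E.
    have dt := test_function_partial [:: i] tphi.
    have mdphi : measurable_fun setT ('D_(evec i) phi).
      by apply: measurable_continuous; have [] := sp [:: i].
    apply: (@le_trans _ _ (\int[mu]_(y in D) (`|'D_(evec i) phi y| `^ r)%:E)%E).
      rewrite le_eqVlt; apply/orP; left; apply/eqP.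
      rewrite integral_mkcond [RHS]integral_mkcond; apply: eq_integral => y _.
      rewrite !patchE; case: ifPn => [yQ|/negP yQ]; case: ifPn => [yD|/negP yD] //.
        have /= -> := test_function_out dt (fun h => yD (mem_set h)).
        by rewrite normr0 powR0// gt_eqF.
      by exfalso; apply: yQ; apply: mem_set; apply: Dal; exact: set_mem.
    apply: Nrm_int => //; last exact: ltW.
    have [_ _ /(_ i)[[mw _] _]] := W.
    rewrite -(Nrm_ae r0 mD mw (measurable_funTS mdphi) (wae i)).
    apply: (@le_trans _ _ A%:E); last by rewrite lee_fin ltW.
    rewrite -EA /W1norm -!/(Nrm _ _ _).
    apply: (@le_trans _ _ (\sum_(j < n) Nrm r D (wgrad D phi j))%E).
      by rewrite (bigD1 i)//=; apply: leeDl; apply: sume_ge0 => j _; exact: Nrm_ge0.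
    by apply: leeDr; exact: Nrm_ge0.
  have Ipos : 0 < A' `^ r by rewrite powR_gt0.
  have osc y : ccube a l y -> `|phi y - average setT phi a l| <= C * A' * l `^ (1 - n%:R / r).
    move=> yQ.
    have := hC setT phi (fun i => 'D_(evec i) phi) a l (A' `^ r) y openT
      (smooth_continuous sp) (fun i => weak_partial_smooth i openT sp) l0 (@subsetT _ _) Ipos hI yQ.
    by rewrite -powRrM divff ?gt_eqF// powRr1// ltW.
  have h1 := osc x (Dal x Dx); have h2 := osc a aa.
  rewrite (test_function_out tphi na) sub0r normrN in h2.
  have -> : 2 * C * l `^ (1 - n%:R / r) * A' =
    C * A' * l `^ (1 - n%:R / r) + C * A' * l `^ (1 - n%:R / r) by ring.
  rewrite -[phi x](subrK (average setT phi a l)).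
  by apply: (le_trans (ler_normD _ _)); exact: lerD.
apply/ler_addgt0Pl => e e0.
have K0 : 0 < 2 * C * l `^ (1 - n%:R / r) by rewrite !mulr_gt0.
apply: (le_trans (osc (A + e / (2 * C * l `^ (1 - n%:R / r))) _)).
  by rewrite ltrDl divr_gt0.
by rewrite mulrDr (mulrC _ (e / _)) divfK ?gt_eqF// addrC.
Qed.

(** Test functions that converge to [v] in norm converge uniformly by [test_sup_bound]. The limit is
    continuous on the whole space and 0 off [D], so it can be integrated against measures that
    charge the boundary. *)
Lemma W10_continuous_representative : exists2 C : R, 0 < C &
  forall v, W10 r%:E D v -> exists w : V -> R,
    [/\ continuous w, forall x, ~ D x -> w x = 0, ae_eq mu D v w &
        forall x, `|w x| <= C * fine (W1norm r%:E D v)].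
Proof.
have [C C0 hC] := test_sup_bound; exists C => // v Wv.
have Wv1 := W10_W1 n0 r0 oD Wv.
have r1' : 1 <= r by exact: ltW.
have [mv _] : Lp r%:E D v by have [] := Wv1.
have ek k : 0 < k.+1%:R^-1 :> R by [].
have /choice[phi hphi] : forall k : nat, exists phi, test_function D phi /\
    (W1norm r%:E D (v \- phi)%R < (k.+1%:R^-1)%:E)%E.
  by move=> k; have [phi h1 h2] := Wv.2 _ (ek k); exists phi.
have tphi k : test_function D (phi k) by have [] := hphi k.
have W1phi k : W1 r D (phi k) by have [] := W1_test r0 oD (tphi k).
have W1d k : W1 r D (fun x => v x - phi k x) by exact: (W1_opp_sub r1' oD Wv1 (W1phi k)).
have dif k m x : `|phi k x - phi m x| <= C * (k.+1%:R^-1 + m.+1%:R^-1).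
  have tt := test_function_lin (-1) (tphi m) (tphi k).
  have -> : phi k x - phi m x = -1 * phi m x + phi k x by rewrite mulN1r addrC.
  apply: (le_trans (hC _ tt x)); rewrite ler_pM2l//.
  have -> : (fun x => -1 * phi m x + phi k x) =
      (fun x => -1 * (v x - phi k x) + (v x - phi m x)).
    by apply/funext => y; ring.
  have h := W1norm_lin (-1) r1' oD (W1d k) (W1d m).
  rewrite normrN1 mul1e in h.
  have fin k' := W1norm_fin (W1d k').
  have fin' k' : W1norm r%:E D (fun x => v x - phi k' x) \is a fin_num.
    by rewrite ge0_fin_numE ?W1norm_ge0.
  apply: (@le_trans _ _ (fine (W1norm r%:E D (fun x => (v x - phi k x)%R) +
      W1norm r%:E D (fun x => (v x - phi m x)%R))%E)).
    apply: fine_le => //; last by rewrite fin_numD !fin'.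
    rewrite ge0_fin_numE ?W1norm_ge0//; apply: (le_lt_trans h).
    by rewrite lte_add_pinfty.
  have [_ h1] := hphi k; have [_ h2] := hphi m.
  rewrite fineD//; apply: lerD; rewrite -lee_fin fineK//; exact: ltW.
have cau x : cvg (phi k x @[k --> \oo]).
  apply/cauchy_cvgP/cauchy_ballP => e e0.
  have e2 : 0 < e / (2 * C) by rewrite divr_gt0// mulr_gt0.
  have [N _ hN] : \forall k \near \oo, (k.+1%:R^-1 : R) < e / (2 * C).
    exact: near_infty_natSinv_lt (PosNum e2).
  exists (phi ^~ x @` [set k | (N <= k)%N], phi ^~ x @` [set k | (N <= k)%N]).
    by split; exists N => // k Nk; exists k.
  move=> [_ _] [[k Nk <-] [m Nm <-]]; rewrite /ball/=.
  apply: (le_lt_trans (dif k m x)).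
  have h1 := hN k Nk; have h2 := hN m Nm.
  have -> : e = C * (e / (2 * C) + e / (2 * C)) by field; rewrite gt_eqF.
  by rewrite ltr_pM2l// ltrD.
pose w x := lim (phi k x @[k --> \oo]).
have wphi k x : `|w x - phi k x| <= C * k.+1%:R^-1.
  apply/ler_addgt0Pl => e e0.
  have e2 : 0 < e / 2 by rewrite divr_gt0.
  have e3 : 0 < e / 2 / C by rewrite divr_gt0.
  have h1 : \forall m \near \oo, `|w x - phi m x| < e / 2.
    by have /cvgrPdist_lt := cau x; apply.
  have h2 : \forall m \near \oo, (m.+1%:R^-1 : R) < e / 2 / C.
    exact: near_infty_natSinv_lt (PosNum e3).
  have [m _ /(_ m (leqnn m))[hm1 hm2]] := filterI h1 h2.
  rewrite (le_trans (ler_distD (phi m x) _ _))//.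
  have := dif m k x; rewrite mulrDr => h3.
  have : C * m.+1%:R^-1 <= e / 2 by rewrite mulrC -ler_pdivlMr// ltW.
  move: hm1 h3; move: (`|w x - _|) (`|phi m x - _|) (C * m.+1%:R^-1) (C * k.+1%:R^-1).
  by move=> X Y Z T *; lra.
have cw : continuous w.
  move=> x; apply/(@cvgrPdist_lt _ _ _ (nbhs x)) => e e0.
  have e3 : 0 < e / 3 / C by rewrite !divr_gt0.
  have [k _ /(_ k (leqnn k)) hk] : \forall m \near \oo, (m.+1%:R^-1 : R) < e / 3 / C.
    exact: near_infty_natSinv_lt (PosNum e3).
  have Ck : C * k.+1%:R^-1 < e / 3 by rewrite mulrC -ltr_pdivlMr.
  have [sp _ _] := tphi k.
  have /cvgrPdist_lt/(_ (e / 3)) := smooth_continuous sp (x := x).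
  rewrite divr_gt0// => /(_ isT); apply: filterS => y hy.
  have h1 := wphi k x; have h2 := wphi k y.
  rewrite (le_lt_trans (ler_distD (phi k x) _ _))//.
  rewrite (@le_lt_trans _ _ (`|w x - phi k x| + (`|phi k x - phi k y| + `|phi k y - w y|)))//.
    by rewrite lerD2l ler_distD.
  rewrite (distrC (phi k y)); move: h1 h2 hy Ck.
  by move: (`|w x - _|) (`|w y - _|) (`|phi k x - _|) (C * _) => X Y Z T *; lra.
have w0 x : ~ D x -> w x = 0.
  move=> nD; rewrite /w; under eq_fun do rewrite (test_function_out (tphi _) nD).
  exact: lim_cst.
have mw : measurable_fun D w by apply: measurable_funTS; exact: measurable_continuous.
exists w; split => //.
(* [D] has finite measure, so uniform convergence implies convergence in L^r and the limit is a
   representative of [v]. *)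
- have lD := bounded_measure_fin.
  have N1 : (Nrm r D (cst 1%R) < +oo)%E.
    rewrite NrmE//; apply: poweR_lty.
    under eq_integral do rewrite normr1 powR1.
    by rewrite integral_cst// mul1e.
  have N0 : Nrm r D (fun x => v x - w x) = 0%E.
    apply/eqP; rewrite eq_le Nrm_ge0 andbT; apply/lee_addgt0Pr => e e0.
    rewrite add0e.
    set Z := fine (Nrm r D (cst 1)).
    have EZ : Nrm r D (cst 1) = Z%:E by rewrite fineK// ge0_fin_numE// Nrm_ge0.
    have Z0 : 0 <= Z by apply: fine_ge0; exact: Nrm_ge0.
    have K0 : 0 < 1 + C * Z by rewrite ltr_pwDl// mulr_ge0// ltW.
    have eK : 0 < e / (1 + C * Z) by rewrite divr_gt0.
    have [k _ /(_ k (leqnn k)) hk] : \forall m \near \oo, (m.+1%:R^-1 : R) < e / (1 + C * Z).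
      exact: near_infty_natSinv_lt (PosNum eK).
    have mphi : measurable_fun D (phi k).
      apply: measurable_funTS; apply: measurable_continuous.
      by have [sp _ _] := tphi k; exact: smooth_continuous.
    have m1 : measurable_fun D (fun x => v x - phi k x) by exact: measurable_funB.
    have m2 : measurable_fun D (fun x => phi k x - w x) by exact: measurable_funB.
    have -> : (fun x => v x - w x) = (fun x => (v x - phi k x) + (phi k x - w x)).
      by apply/funext => x; rewrite addrA subrK.
    apply: (le_trans (Nrm_triangle r1' mD m1 m2)).
    apply: (@le_trans _ _ ((k.+1%:R^-1)%:E + (C * k.+1%:R^-1)%:E * Z%:E)%E).
      apply: leeD.
        have [_ h] := hphi k; apply: (le_trans _ (ltW h)).
        by rewrite /W1norm leeDl// sume_ge0// => i _; exact: Lnorm_ge0.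
      have Ck0 : 0 <= C * k.+1%:R^-1 by rewrite mulr_ge0 ?(ltW C0).
      rewrite -EZ -[X in (X%:E * _)%E](ger0_norm Ck0) -Nrm_scale//.
      apply: (Nrm_le r0 mD m2); first exact: measurable_funM.
      move=> x _; rewrite /= mulr1 (ger0_norm Ck0) distrC; exact: wphi.
    rewrite -EFinM -EFinD lee_fin.
    have -> : k.+1%:R^-1 + C * k.+1%:R^-1 * Z = k.+1%:R^-1 * (1 + C * Z) by ring.
    by rewrite -ler_pdivlMr// ltW.
  have := Nrm_eq0 r0 mD (measurable_funB mv mw) N0.
  by apply: filterS => x h Dx; have /eqP := h Dx; rewrite subr_eq0 => /eqP.
- move=> x; apply/ler_addgt0Pl => e e0.
  have e3 : 0 < e / (2 * C) by rewrite !divr_gt0// mulr_gt0.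
  have [k _ /(_ k (leqnn k)) hk] : \forall m \near \oo, (m.+1%:R^-1 : R) < e / (2 * C).
    exact: near_infty_natSinv_lt (PosNum e3).
  have h1 := wphi k x; have h2 := hC _ (tphi k) x.
  set A := fine (W1norm r%:E D v).
  have EA : W1norm r%:E D v = A%:E.
    by rewrite fineK// ge0_fin_numE ?W1norm_ge0// W1norm_fin.
  have : fine (W1norm r%:E D (phi k)) <= k.+1%:R^-1 + A.
    have ph : W1norm r%:E D (phi k) \is a fin_num.
      by rewrite ge0_fin_numE; [exact: W1norm_fin (W1phi k)|exact: W1norm_ge0].
    rewrite -lee_fin (fineK ph).
    have -> : phi k = (fun x => -1 * (v x - phi k x) + v x).
      by apply/funext => y; ring.
    apply: (le_trans (W1norm_lin (-1) r1' oD (W1d k) Wv1)).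
    rewrite normrN1 mul1e EFinD EA leeD2r// ltW//.
    by have [] := hphi k.
  rewrite -(ler_pM2l C0) mulrDr => h3.
  have Ck : C * k.+1%:R^-1 < e / 2.
    by rewrite mulrC -ltr_pdivlMr// (lt_le_trans hk)// invfM mulrA.
  have : `|w x| <= `|w x - phi k x| + `|phi k x|.
    by rewrite -{1}[w x](subrK (phi k x)) ler_normD.
  move: h1 h2 h3 Ck; move: (`|w x|) (`|w x - _|) (`|phi k x|) (C * _) (C * A) (C * _) => *; lra.
Qed.

(** The points of [D] where [f] and [g] differ form an open set; if nonempty it contains a cube, of
    positive measure. *)
Lemma continuous_ae_eq (f g : V -> R) : {in D, continuous f} -> {in D, continuous g} ->
  ae_eq mu D f g -> forall x, D x -> f x = g x.
Proof.
move=> cf cg fg x Dx; apply: contrapT => /eqP fgx.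
have d0 : 0 < `|f x - g x| / 2 by rewrite divr_gt0// normr_gt0 subr_eq0.
have Dx' : x \in D by exact: mem_set.
have h1 : \forall y \near x, `|f x - f y| < `|f x - g x| / 2.
  by have /cvgrPdist_lt := cf x Dx'; apply.
have h2 : \forall y \near x, `|g x - g y| < `|f x - g x| / 2.
  by have /cvgrPdist_lt := cg x Dx'; apply.
have h3 : \forall y \near x, D y by exact: open_nbhs_nbhs.
have : nbhs x [set y | D y /\ f y <> g y].
  apply: filterS (filterI h1 (filterI h2 h3)) => y [a1 [a2 Dy]]; split => // E.
  have : `|f x - g x| < `|f x - g x| / 2 + `|f x - g x| / 2.
    rewrite (le_lt_trans (ler_distD (f y) _ _))// ltrD//.
    by rewrite E distrC.
  by rewrite -splitr ltxx.
move=> /nbhs_ballP[e /= e0 he].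
have [N [mN N0 sN]] := fg.
have e2 : 0 < e / 2 by rewrite divr_gt0.
pose a := x - const_mx (e / 2 / 2).
have QN : ccube a (e / 2) `<=` N.
  move=> y yQ; apply: sN => /= h.
  have [Dy nfg] : [set y | D y /\ f y <> g y] y.
    apply: he; apply/ball_rV => // i; have := yQ i; rewrite /= in_itv/= !mxE => /andP[b1 b2].
    by rewrite ltr_norml; apply/andP; split; lra.
  by apply: nfg; exact: h.
have : (mu (ccube a (e / 2)) <= mu N)%E.
  by apply: le_measure; rewrite ?inE//; exact: measurable_rV_box.
by rewrite N0 lebesgue_ccube ?(ltW e2)// lee_fin leNgt exprn_gt0.
Qed.

(** Makes the value of [embed_C0] on the closure of [D] independent of the representative chosen by
    [xget]. *)
Lemma C0_representative_unique v w1 w2 : C0_representative D v w1 ->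
  C0_representative D v w2 -> forall x, closure D x -> w1 x = w2 x.
Proof.
move=> [c1 z1 e1] [c2 z2 e2] x cx.
have [Dx|nD] := pselect (D x); last by rewrite z1 ?z2.
have cD (w : V -> R) : {within closure D, continuous w} -> {in D, continuous w}.
  move=> cw y /set_mem Dy; have cDy : closure D y by exact: subset_closure.
  have := continuous_subspaceW (@subset_closure _ D) cw.
  by rewrite continuous_open_subspace//; apply; exact: mem_set.
apply: (continuous_ae_eq (cD _ c1) (cD _ c2)) => //.
by apply: filterS2 e1 e2 => y h1 h2 Dy; rewrite -h1// h2.
Qed.

End sobolev_embedding.

(** * Finite measures and the state equation *)

Section finite_measures.
Context {d : measure_display} {T : measurableType d} {R : realType}.
Implicit Types (m : {measure set T -> \bar R}) (D : set T).

(** The proof of finiteness is an argument of the copy, so that the structure of finite measure can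
    be attached to it. *)
Definition finite_copy m of (m setT < +oo)%E : set T -> \bar R := m.

Section finite_copy_instance.
Variables (m : {measure set T -> \bar R}) (fm : (m setT < +oo)%E).

Let copy0 : finite_copy fm set0 = 0%E. Proof. exact: measure0. Qed.
Let copy_ge0 A : (0 <= finite_copy fm A)%E. Proof. exact: measure_ge0. Qed.
Let copy_sigma : semi_sigma_additive (finite_copy fm).
Proof. exact: measure_semi_sigma_additive. Qed.
HB.instance Definition _ := isMeasure.Build _ _ _ (finite_copy fm)
  copy0 copy_ge0 copy_sigma.
Let copy_fin : fin_num_fun (finite_copy fm). Proof. exact: lty_fin_num_fun. Qed.
HB.instance Definition _ := Measure_isFinite.Build _ _ _ (finite_copy fm) copy_fin.

End finite_copy_instance.

Lemma finite_measureP m : (m setT < +oo)%E ->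
  exists m' : {finite_measure set T -> \bar R}, forall A, m' A = m A.
Proof. by move=> fm; exists (finite_copy fm : {finite_measure set T -> \bar R}). Qed.

Lemma finite_measure_fin (m : {finite_measure set T -> \bar R}) : (m setT < +oo)%E.
Proof. exact: fin_num_fun_lty (@fin_num_measure _ _ _ m). Qed.

Lemma bounded_finite_integrable m D (f : T -> R) (C : R) : (m D < +oo)%E ->
  measurable D -> measurable_fun D f -> (forall x, D x -> `|f x| <= C) ->
  m.-integrable D (EFin \o f).
Proof.
move=> mDfin mD mf hf; apply: measurable_bounded_integrable => //.
exists C; split; first exact: num_real.
by move=> M CM x Dx; apply: (le_trans (hf x Dx)); exact: ltW.
Qed.

(** Two integration rules are given: the one for nonnegative functions serves the transport cost,
    the one for integrable functions the state equation. *)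
Lemma convex_measureP (m0 m1 : {finite_measure set T -> \bar R}) (t : R) :
  0 <= t <= 1 -> exists mt : {finite_measure set T -> \bar R},
  [/\ forall A, mt A = ((1 - t)%:E * m0 A + t%:E * m1 A)%E,
      forall D (f : T -> \bar R), measurable D -> measurable_fun D f ->
        (forall x, D x -> (0 <= f x)%E) ->
        (\int[mt]_(x in D) f x =
         (1 - t)%:E * \int[m0]_(x in D) f x + t%:E * \int[m1]_(x in D) f x)%E &
      forall D (f : T -> R), measurable D -> m0.-integrable D (EFin \o f) ->
        m1.-integrable D (EFin \o f) ->
        \int[mt]_(x in D) f x =
        (1 - t) * \int[m0]_(x in D) f x + t * \int[m1]_(x in D) f x].
Proof.
move=> /andP[t0 t1]; have t1' : 0 <= 1 - t by rewrite subr_ge0.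
pose m := measure_add (mscale (NngNum t1') m0) (mscale (NngNum t0) m1).
have mE A : m A = ((1 - t)%:E * m0 A + t%:E * m1 A)%E by rewrite /m measure_addE.
have fm : (m setT < +oo)%E.
  have f0 := finite_measure_fin m0; have f1 := finite_measure_fin m1.
  by rewrite mE lte_add_pinfty// lte_mul_pinfty// lee_fin.
have [mt mtE] := finite_measureP fm; exists mt.
have I D (f : T -> \bar R) : measurable D -> measurable_fun D f ->
    (forall x, D x -> (0 <= f x)%E) ->
    (\int[mt]_(x in D) f x =
     (1 - t)%:E * \int[m0]_(x in D) f x + t%:E * \int[m1]_(x in D) f x)%E.
  move=> mD mf f0; rewrite (eq_measure_integral m); last by move=> A _ _; exact: mtE.
  by rewrite /m ge0_integral_measure_add// !ge0_integral_mscale.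
split => //; first by move=> A; rewrite mtE; exact: mE.
move=> D f mD i0 i1; have mf := measurable_int _ i0.
have fin (m' : {measure set T -> \bar R}) : m'.-integrable D (EFin \o f) ->
    (\int[m']_(x in D) (EFin \o f)^\+%E x \is a fin_num)%E /\
    (\int[m']_(x in D) (EFin \o f)^\-%E x \is a fin_num)%E.
  by move=> i; split; [exact: integrable_pos_fin_num|exact: integrable_neg_fin_num].
have [p0 n0] := fin _ i0; have [p1 n1] := fin _ i1.
rewrite /Rintegral !(integralE _ _ (fun x => (f x)%:E)).
rewrite I//; last exact: measurable_funepos.
rewrite I//; last exact: measurable_funeneg.
move: p0 n0 p1 n1; rewrite -!/(EFin \o f).
move: (integral m0 D (EFin \o f)^\+%E) (integral m0 D (EFin \o f)^\-%E)
 (integral m1 D (EFin \o f)^\+%E) (integral m1 D (EFin \o f)^\-%E).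
by move=> [a| |] [b| |] [c| |] [e| |]// _ _ _ _ /=; ring.
Qed.

(** On the negative set of a Hahn decomposition the charge is both nonpositive and equal to a
    measure, so its Jordan negative part vanishes. *)
Lemma charge_integral_measure (u : {charge set T -> \bar R}) m D (f : T -> R) :
  measurable D -> (forall A, measurable A -> u A = m A) ->
  charge_integral u D f = \int[m]_(x in D) f x.
Proof.
move=> mD um; rewrite /charge_integral.
have [posP negN PN PN0] := hahn_posneg u.
have mN := (@negative_set_charge_le0 _ _ _ u _).
have neg0 A : measurable A -> jordan_neg (hahn_posneg u) A = 0%E.
  move=> mA; rewrite jordan_negE cjordan_negE /crestr0 mem_set// /crestr.
  have mAN : measurable (A `&` hahn_neg u) by apply: measurableI => //; case: negN.
  have h1 : (u (A `&` hahn_neg u) <= 0)%E by case: negN => _; apply => //; exact: subIsetr.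
  have h2 : (0 <= u (A `&` hahn_neg u))%E by rewrite um.
  have -> : u (A `&` hahn_neg u) = 0%E by apply/eqP; rewrite eq_le h1 h2.
  by rewrite oppe0.
have posE A : measurable A -> jordan_pos (hahn_posneg u) A = m A.
  move=> mA; rewrite -um// (jordan_decomp (hahn_posneg u) mA) /cadd/= /cscale/= neg0//.
  by rewrite mule0 adde0.
rewrite /Rintegral (eq_measure_integral m); last by move=> A mA _; exact: posE.
rewrite (eq_measure_integral mzero (m1 := jordan_neg _)); last by move=> A mA _; exact: neg0.
by rewrite integral_measure_zero subr0.
Qed.

End finite_measures.

(** * The bilinear form of the weak Laplacian *)

Section pairing.
Context {R : realType} {n : nat}.
Local Notation V := 'rV[R]_n.
Local Notation mu := (lebesgue_rV R n).
Implicit Types (D : set V) (y v z : V -> R) (q r a : R).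

Definition pairing D y v : R :=
  \int[mu]_(x in D) (\sum_(i < n) wgrad D y i x * wgrad D v i x).

Lemma hoelder_conjugate_fin q r : 1 < q -> q^-1 + r^-1 = 1 -> 0 < r ->
  hoelder_conjugate q%:E = r%:E.
Proof.
move=> q1 qr r0; have q0 : 0 < q by rewrite (lt_trans _ q1).
have h0 : q%:E != 0%E by rewrite eqe gt_eqF.
apply/esym/(hoelder_conjugateP r%:E (ltNyr q) h0).
by rewrite !inver !gt_eqF// -EFinD qr.
Qed.

Lemma pairingC D y v : pairing D y v = pairing D v y.
Proof.
by apply: eq_Rintegral => x _; apply: eq_bigr => i _; rewrite mulrC.
Qed.

Lemma pairing_integrable D q r y v : 0 < q -> 0 < r -> q^-1 + r^-1 = 1 -> open D ->
  W1 q D y -> W1 r D v ->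
  mu.-integrable D (EFin \o fun x => \sum_(i < n) wgrad D y i x * wgrad D v i x).
Proof.
move=> q0 r0 qr oD [_ _ hy] [_ _ hv]; have mD := measurable_openV oD.
have -> : (EFin \o fun x => \sum_(i < n) wgrad D y i x * wgrad D v i x) =
    (fun x => \sum_(i < n) (wgrad D y i x * wgrad D v i x)%:E)%E.
  by apply/funext => x; rewrite /= sumEFin.
apply: integrable_sum => // i _.
have [[my Ny] _] := hy i; have [[mv Nv] _] := hv i.
have my' : measurable_fun setT (wgrad D y i \_ D) by exact/(measurable_restrictT _ mD).
have mv' : measurable_fun setT (wgrad D v i \_ D) by exact/(measurable_restrictT _ mD).
apply/integrableP; split; first by apply/measurable_EFinP; exact: measurable_funM.
have := hoelder mu my' mv' q0 r0 qr; rewrite Lnorm1 => h.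
apply: (le_lt_trans (le_trans _ h)).
  rewrite le_eqVlt; apply/orP; left; apply/eqP; rewrite integral_mkcond.
  apply: eq_integral => x _; rewrite /= patchE !restrictE; case: ifP => //= _.
  by rewrite mul0r normr0.
by rewrite lte_mul_pinfty ?Lnorm_ge0// ge0_fin_numE// Lnorm_ge0.
Qed.

Lemma pairing_linl D q r a y z v : 1 <= q -> 0 < r -> q^-1 + r^-1 = 1 -> open D ->
  W1 q D y -> W1 q D z -> W1 r D v ->
  pairing D (fun x => a * y x + z x) v = a * pairing D y v + pairing D z v.
Proof.
move=> q1 r0 qr oD Wy Wz Wv; have q0 : 0 < q by rewrite (lt_le_trans _ q1).
have mD := measurable_openV oD.
have [Wl ae] := W1_lin a q1 oD Wy Wz.
have iy := pairing_integrable q0 r0 qr oD Wy Wv.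
have iz := pairing_integrable q0 r0 qr oD Wz Wv.
have il := pairing_integrable q0 r0 qr oD Wl Wv.
have iay : mu.-integrable D
    (EFin \o (fun x => a * \sum_(i < n) wgrad D y i x * wgrad D v i x)).
  by have := integrableZl mD a iy; apply: eq_integrable => // x _ /=; rewrite EFinM.
rewrite /pairing -RintegralZl// -RintegralD//.
apply: ae_eq_Rintegral => //.
- by apply/measurable_EFinP; exact: measurable_int il.
- apply: measurable_funD; apply/measurable_EFinP.
    exact: measurable_int iay.
  exact: measurable_int iz.
- have := @filter_forall _ _ _ _ (ae_filter_ringOfSetsType mu) ae.
  apply: filterS => x h Dx; rewrite mulr_sumr -big_split/=.
  by apply: eq_bigr => i _; rewrite (h i Dx); ring.
Qed.

(** [wgrad] is a chosen representative, so its vanishing has to be proved: it is a weak derivative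
    of a function that is 0 almost everywhere, and weak derivatives are unique. *)
Lemma W1norm_ae0 D q y z : 1 <= q -> open D -> W1 q D y -> W1 q D z ->
  ae_eq mu D z y -> W1norm q%:E D (fun x => z x - y x) = 0%E.
Proof.
move=> q1 oD Wy Wz zy; have q0 : 0 < q by rewrite (lt_le_trans _ q1).
have mD := measurable_openV oD.
have [[mw _] _ hw] := W1_opp_sub q1 oD Wz Wy.
have w0 : ae_eq mu D (fun x => z x - y x) (cst 0).
  by apply: filterS zy => x h Dx; rewrite h// subrr.
have l0 : Lp_loc 1%E D (cst 0) by apply: Lp_loc1_continuous; exact: cst_continuous.
have N0 : Nrm q D (cst 0) = 0%E.
  rewrite NrmE//; under eq_integral do rewrite normr0 powR0 ?gt_eqF//.
  by rewrite integral0 poweR0r// invr_neq0// gt_eqF.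
rewrite /W1norm -!/(Nrm _ _ _) (Nrm_ae q0 mD mw _ w0)// N0 add0e big1// => i _.
rewrite -/(Nrm _ _ _); have [[mi _] wi] := hw i; have [_ li _] := wi.
have w00 : weak_partial D [:: i] (cst 0) (wgrad D (fun x => z x - y x) i).
  apply: (weak_partial_ae oD w0 _ l0 li wi); exact: ae_eq_refl.
have c0 : weak_partial D [:: i] (cst 0 : V -> R) (cst 0).
  split => // phi tphi.
  rewrite (eq_Rintegral _ (g := cst 0)); last by move=> x _; rewrite mul0r.
  rewrite [X in _ = _ * X](eq_Rintegral _ (g := cst 0)); last by move=> x _; rewrite mul0r.
  by rewrite Rintegral_cst// mul0r mulr0.
by rewrite (Nrm_ae q0 mD mi _ (weak_partial_unique oD w00 c0)).
Qed.

(** [J] acts on representatives; continuity for the seminorm [W1norm] makes it a function of the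
    class. *)
Lemma W10_continuous_ae D q J y z : (0 < n)%N -> 1 <= q -> open D ->
  W10_continuous q%:E D J -> W10 q%:E D y -> W10 q%:E D z -> ae_eq mu D z y ->
  J z = J y.
Proof.
move=> n0 q1 oD Jc Wy Wz zy; have q0 : 0 < q by rewrite (lt_le_trans _ q1).
apply/eqP; rewrite -subr_eq0 -normr_le0; apply/ler_addgt0Pl => e e0; rewrite addr0.
have [dl dl0 h] := Jc y Wy e e0; apply/ltW/h => //.
have := W1norm_ae0 q1 oD (W10_W1 n0 q0 oD Wy) (W10_W1 n0 q0 oD Wz) zy.
by move=> ->; rewrite lte_fin.
Qed.

End pairing.

(** * State equation, adjoint state and first order condition *)

Section adjoint.
Context {R : realType} {n : nat}.
Local Notation V := 'rV[R]_n.
Local Notation mu := (lebesgue_rV R n).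
Variables (D w1 : set V) (q r : R).
Hypotheses (n0 : (0 < n)%N) (nr : n%:R < r) (q1 : 1 < q) (qr : q^-1 + r^-1 = 1).
Hypotheses (oD : open D) (bD : bounded_set D).
Hypotheses (cw1 : compact w1) (w1D : w1 `<=` closure D).
Hypothesis solvable : poisson_uniquely_solvable q%:E D.
Implicit Types (u : {charge set V -> \bar R}) (m : {finite_measure set V -> \bar R}).
Implicit Types (v w y p : V -> R) (J : (V -> R) -> R).

Let r1 : 1 < r. Proof. by rewrite (le_lt_trans _ nr)// ler1n. Qed.
Let r0 : 0 < r. Proof. by rewrite (lt_trans _ r1). Qed.
Let q0 : 0 < q. Proof. by rewrite (lt_trans _ q1). Qed.
Let rq : r^-1 + q^-1 = 1. Proof. by rewrite addrC. Qed.
Let cjq : hoelder_conjugate q%:E = r%:E. Proof. exact: hoelder_conjugate_fin. Qed.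
Let cjr : hoelder_conjugate r%:E = q%:E. Proof. exact: hoelder_conjugate_fin. Qed.
Let mw1 : measurable w1. Proof. exact: measurable_compactV. Qed.
Let mD : measurable D. Proof. exact: measurable_openV. Qed.

Lemma finite_continuous_integrable m w : continuous w -> m.-integrable w1 (EFin \o w).
Proof.
move=> cw; have [C _ hC] := continuous_bounded_compact cw1 cw.
apply: bounded_finite_integrable hC => //.
  by rewrite -ge0_fin_numE//; exact: fin_num_measure.
by apply: measurable_funTS; exact: measurable_continuous.
Qed.

Lemma C0_continuous v w : continuous w -> (forall x, ~ D x -> w x = 0) ->
  ae_eq mu D v w -> C0_representative D v w.
Proof.
by move=> cw w0 vw; split => //; [exact: continuous_subspaceT|move=> x [_ +]; exact: w0].
Qed.

Lemma Estar_measure u m v w : (forall A, measurable A -> u A = m A) ->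
  C0_representative D v w -> Estar D w1 u v = \int[m]_(x in w1) w x.
Proof.
move=> um rw; rewrite /Estar (charge_integral_measure _ mw1 um).
apply: eq_Rintegral => x /set_mem wx.
have re : C0_representative D v (embed_C0 D v).
  by rewrite /embed_C0; case: xgetP => [e _ //|/(_ w)].
exact: (C0_representative_unique oD re rw (w1D wx)).
Qed.

Lemma Estar_dual u m : (forall A, measurable A -> u A = m A) ->
  W10_dual r%:E D (Estar D w1 u).
Proof.
move=> um; have [C C0 hC] := W10_continuous_representative n0 nr oD bD.
split => [a f g Wf Wg|].
  have [wf [cf f0 ef _]] := hC _ Wf; have [wg [cg g0 eg _]] := hC _ Wg.
  have caf : continuous (fun x => a * wf x).
    by move=> x; exact: continuousM (@cst_continuous _ _ a x) (cf x).
  rewrite (Estar_measure um (C0_continuous cf f0 ef)).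
  rewrite (Estar_measure um (C0_continuous cg g0 eg)).
  rewrite (@Estar_measure _ _ _ (fun x => a * wf x + wg x) um); last first.
    apply: C0_continuous; first by move=> x; exact: continuousD (caf x) (cg x).
      by move=> x nD; rewrite f0// g0// mulr0 addr0.
    by apply: filterS2 ef eg => x h1 h2 Dx; rewrite h1// h2.
  rewrite RintegralD//; [|exact: finite_continuous_integrable|exact: finite_continuous_integrable].
  by rewrite RintegralZl//; exact: finite_continuous_integrable.
have mfin : m w1 \is a fin_num by exact: fin_num_measure.
exists (C * fine (m w1)) => f Wf.
have [w [cw w0 ew bw]] := hC _ Wf.
rewrite (Estar_measure um (C0_continuous cw w0 ew)).
have Nfin : W1norm r%:E D f \is a fin_num.
  rewrite ge0_fin_numE; first exact: W1norm_fin (W10_W1 n0 r0 oD Wf).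
  exact: W1norm_ge0.
rewrite -(fineK Nfin) -EFinM lee_fin.
have iw := finite_continuous_integrable m cw.
apply: (le_trans (le_normr_Rintegral mw1 iw)).
apply: (@le_trans _ _ (\int[m]_(x in w1) (C * fine (W1norm r%:E D f)))).
  apply: le_Rintegral => //; first exact: integrable_abse iw.
  by apply: finite_continuous_integrable; exact: cst_continuous.
by rewrite Rintegral_cst// mulrAC.
Qed.

Lemma control_to_stateP u m : (forall A, measurable A -> u A = m A) ->
  poisson_solution q%:E D (control_to_state D w1 q%:E u) (Estar D w1 u).
Proof.
move=> um; have := Estar_dual um; rewrite -{1}cjq => /solvable[[y hy] _].
by rewrite /control_to_state; case: xgetP => [z _ hz|h0]; [exact: hz|case: (h0 y)].
Qed.

(** By linearity of the pairing, the combination of the two states solves the equation for the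
    combined control; unique solvability concludes. *)
Lemma control_to_state_convex u0 u1 (ut : {charge set V -> \bar R}) m0 m1
    (mt : {finite_measure set V -> \bar R}) (t : R) :
  (forall A, measurable A -> u0 A = m0 A) -> (forall A, measurable A -> u1 A = m1 A) ->
  (forall A, measurable A -> ut A = mt A) ->
  (forall f : V -> R, m0.-integrable w1 (EFin \o f) -> m1.-integrable w1 (EFin \o f) ->
    \int[mt]_(x in w1) f x =
    (1 - t) * \int[m0]_(x in w1) f x + t * \int[m1]_(x in w1) f x) ->
  let y0 := control_to_state D w1 q%:E u0 in let y1 := control_to_state D w1 q%:E u1 in
  ae_eq mu D (control_to_state D w1 q%:E ut) (fun x => y0 x + t * (y1 x - y0 x)).
Proof.
move=> um0 um1 umt conv y0 y1.
have [W0 s0] := control_to_stateP um0; have [W1' s1] := control_to_stateP um1.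
have st := control_to_stateP umt.
have Wd : W10 q%:E D (fun x => -1 * y0 x + y1 x).
  exact: (W10_lin (-1) n0 (ltW q1) oD W0 W1').
have Wt : W10 q%:E D (fun x => t * (-1 * y0 x + y1 x) + y0 x).
  exact: (W10_lin t n0 (ltW q1) oD Wd W0).
have -> : (fun x => y0 x + t * (y1 x - y0 x)) = (fun x => t * (-1 * y0 x + y1 x) + y0 x).
  by apply/funext => x; ring.
have := Estar_dual umt; rewrite -{1}cjq => /solvable[_ un].
apply: un; [exact: st|split; first exact: Wt].
rewrite cjq => v Wv; have Wv1 := W10_W1 n0 r0 oD Wv; have W q' := @W10_W1 _ _ q D q' n0 q0 oD.
rewrite -/(pairing _ _ _).
rewrite (pairing_linl t (ltW q1) r0 qr oD (W _ Wd) (W _ W0) Wv1).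
rewrite (pairing_linl (-1) (ltW q1) r0 qr oD (W _ W0) (W _ W1') Wv1).
move: s0 s1; rewrite cjq => /(_ v Wv); rewrite -/(pairing _ _ _) => -> /(_ v Wv).
rewrite -/(pairing _ _ _) => ->.
have [C _ /(_ v Wv)[w [cw w0 ew _]]] := W10_continuous_representative n0 nr oD bD.
have rw := C0_continuous cw w0 ew.
rewrite (Estar_measure um0 rw) (Estar_measure um1 rw) (Estar_measure umt rw).
rewrite conv; [ring|exact: finite_continuous_integrable|exact: finite_continuous_integrable].
Qed.

(** Symmetry of the pairing: J'(y0)(y1 - y0) is the pairing of [p] with y1 - y0, which the two state
    equations tested with [p] turn into integrals of the representative [w]. *)
Lemma gateaux_adjoint J p w u0 u1 m0 m1 :
  (forall A, measurable A -> u0 A = m0 A) -> (forall A, measurable A -> u1 A = m1 A) ->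
  adjoint_state D w1 q%:E J u0 p -> C0_representative D p w ->
  let y0 := control_to_state D w1 q%:E u0 in let y1 := control_to_state D w1 q%:E u1 in
  gateaux J y0 (fun x => y1 x - y0 x) =
  \int[m1]_(x in w1) w x - \int[m0]_(x in w1) w x.
Proof.
move=> um0 um1 [] + + rw y0 y1; rewrite cjq => Wp; rewrite cjr => hp.
have [W0 s0] := control_to_stateP um0; have [W1' s1] := control_to_stateP um1.
have E : (fun x => y1 x - y0 x) = (fun x => -1 * y0 x + y1 x).
  by apply/funext => x; ring.
have Wd : W10 q%:E D (fun x => -1 * y0 x + y1 x).
  exact: (W10_lin (-1) n0 (ltW q1) oD W0 W1').
rewrite E -(hp _ Wd) -/(pairing _ _ _) pairingC.
have W q' := @W10_W1 _ _ q D q' n0 q0 oD; have Wp1 := W10_W1 n0 r0 oD Wp.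
rewrite (pairing_linl (-1) (ltW q1) r0 qr oD (W _ W0) (W _ W1') Wp1).
move: s0 s1; rewrite cjq => /(_ p Wp); rewrite -/(pairing _ _ _) => -> /(_ p Wp).
rewrite -/(pairing _ _ _) => ->.
by rewrite (Estar_measure um0 rw) (Estar_measure um1 rw); ring.
Qed.

(** The limit of the quotients is two-sided, but small positive [t] already give a lower bound for
    it. *)
Lemma gateaux_lower_bound J y v (K : R) : cvg (gateaux_quotient J y v @ 0^') ->
  (forall t, 0 < t <= 1 -> J y - t * K <= J (fun x => y x + t * v x)) ->
  - K <= gateaux J y v.
Proof.
move=> cv h; rewrite leNgt; apply/negP => lK.
have e0 : 0 < - K - gateaux J y v by rewrite subr_gt0.
have /cvgrPdist_lt/(_ _ e0) := cv.
rewrite near_withinE => /nbhs_ballP[d /= d0 hd].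
pose t := Num.min (d / 2) 1.
have t0 : 0 < t by rewrite lt_min divr_gt0/=.
have t1 : t <= 1 by rewrite ge_min lexx orbT.
have td : t < d by rewrite (@le_lt_trans _ _ (d / 2)) ?ge_min ?lexx//; lra.
have := hd t; rewrite /ball/= sub0r normrN gtr0_norm// => /(_ td (lt0r_neq0 t0)).
rewrite -/(gateaux J y v) ltr_norml => /andP[+ _].
have := h t; rewrite t0 t1 => /(_ isT) ht.
rewrite /gateaux_quotient.
have : - K <= t^-1 * (J (fun x => y x + t * v x) - J y).
  by rewrite mulrC ler_pdivlMr//; move: ht; rewrite (mulrC (- K)) mulrN; lra.
by move: (gateaux _ _ _) (t^-1 * _) => a b; lra.
Qed.

(** [K] stands for the increase of the transport term per unit of [t] along the segment from [u0] to
    [u1]. The hypothesis covers every charge that represents a point of the segment, so that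
    optimality can be inserted later. *)
Lemma adjoint_first_order J p w u0 u1 m0 m1 (K : R) :
  W10_continuous q%:E D J -> gateaux_differentiable q%:E D J ->
  (forall A, measurable A -> u0 A = m0 A) -> (forall A, measurable A -> u1 A = m1 A) ->
  adjoint_state D w1 q%:E J u0 p -> C0_representative D p w ->
  (forall t, 0 < t <= 1 -> forall (ut : {charge set V -> \bar R})
      (mt : {finite_measure set V -> \bar R}), (forall A, measurable A -> ut A = mt A) ->
    (forall A, measurable A -> ut A = ((1 - t)%:E * u0 A + t%:E * u1 A)%E) ->
    (forall f : V -> R, m0.-integrable w1 (EFin \o f) -> m1.-integrable w1 (EFin \o f) ->
      \int[mt]_(x in w1) f x =
      (1 - t) * \int[m0]_(x in w1) f x + t * \int[m1]_(x in w1) f x) ->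
    J (control_to_state D w1 q%:E u0) - t * K <= J (control_to_state D w1 q%:E ut)) ->
  \int[m0]_(x in w1) w x <= \int[m1]_(x in w1) w x + K.
Proof.
move=> Jc Jd um0 um1 ap rw h.
suff : - K <= \int[m1]_(x in w1) w x - \int[m0]_(x in w1) w x.
  by move: (\int[m1]_(x in w1) w x) (\int[m0]_(x in w1) w x) => a b; lra.
rewrite -(gateaux_adjoint um0 um1 ap rw).
have [W0 _] := control_to_stateP um0; have [W1' _] := control_to_stateP um1.
set y0 := control_to_state D w1 q%:E u0; set y1 := control_to_state D w1 q%:E u1.
have E : (fun x => y1 x - y0 x) = (fun x => -1 * y0 x + y1 x).
  by apply/funext => x; ring.
have Wd : W10 q%:E D (fun x => y1 x - y0 x).
  by rewrite E; exact: (W10_lin (-1) n0 (ltW q1) oD W0 W1').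
apply: gateaux_lower_bound; first by have [+ _] := Jd _ W0; apply.
move=> t /andP[t0 t1].
have t01 : 0 <= t <= 1 by rewrite ltW.
have [mt [mtE _ mtI]] := convex_measureP m0 m1 t01.
pose ut : {charge set V -> \bar R} := charge_of_finite_measure mt.
have utE A : measurable A -> ut A = mt A by [].
have ae := control_to_state_convex um0 um1 utE (fun f => @mtI w1 f mw1).
have [Wut _] := control_to_stateP utE.
have Wt : W10 q%:E D (fun x => y0 x + t * (y1 x - y0 x)).
  have -> : (fun x => y0 x + t * (y1 x - y0 x)) = (fun x => t * (y1 x - y0 x) + y0 x).
    by apply/funext => x; ring.
  exact: (W10_lin t n0 (ltW q1) oD Wd W0).
rewrite -(W10_continuous_ae n0 (ltW q1) oD Jc Wt Wut ae).
apply: (h t _ ut mt utE); first by rewrite t0.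
  by move=> A mA; rewrite /ut um0// um1//; exact: mtE.
by move=> f; exact: mtI.
Qed.

End adjoint.

(** * Almost optimal transport plans *)

(** [E] may differ from the preimage of [D] by a null set: a plan is concentrated on a product,
    which is smaller than the preimage of a factor under a projection. *)
Lemma pushforward_Rintegral {d d' : measure_display} {X : measurableType d}
    {Y : measurableType d'} {R : realType} (m : {finite_measure set X -> \bar R})
    (m' : {measure set Y -> \bar R}) (phi : X -> Y) (E : set X) (D : set Y)
    (f : Y -> R) (C : R) :
  measurable_fun setT phi -> (forall A, measurable A -> m' A = m (phi @^-1` A)) ->
  measurable E -> measurable D -> measurable_fun setT f ->
  (forall y, D y -> `|f y| <= C) -> E `<=` phi @^-1` D ->
  m (phi @^-1` D `\` E) = 0%E ->
  \int[m']_(y in D) f y = \int[m]_(x in E) f (phi x).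
Proof.
move=> mphi mE mmE mD mf hf ED m0.
have mpD : measurable (phi @^-1` D) by rewrite -[X in measurable X]setTI; exact: mphi.
have mfphi : measurable_fun setT (f \o phi) by exact: measurableT_comp.
have i : m.-integrable (phi @^-1` D) (EFin \o f \o phi).
  apply: (@bounded_finite_integrable _ _ _ m (phi @^-1` D) (f \o phi) C) => //.
  - by rewrite -ge0_fin_numE//; exact: fin_num_measure.
  - exact: measurable_funTS.
  - by move=> x; exact: hf.
rewrite /Rintegral; congr fine.
pose pm : {measure set Y -> \bar R} :=
  measure_function_pushforward__canonical__measure_function_Measure m mphi.
rewrite (eq_measure_integral pm); last by move=> A mA _; rewrite mE.
rewrite integral_pushforward//; last exact/measurable_EFinP.
have mN : measurable (phi @^-1` D `\` E) by exact: measurableD.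
rewrite (negligible_integral mN mpD i m0); congr (integral _ _ _).
by rewrite setDD setIC; apply/setIidl.
Qed.

Section transport.
Context {R : realType} {n : nat}.
Local Notation V := 'rV[R]_n.
Variables (w0 w1 : set V) (u0 : {finite_measure set V -> \bar R}).
Hypotheses (cw0 : compact w0) (cw1 : compact w1) (u0w : concentrated_on u0 w0).
Implicit Types (pi : {finite_measure set (V * V)%type -> \bar R}) (T : V -> V).
Implicit Types (Phi : V -> V -> R).

Let mw0 : measurable w0. Proof. exact: measurable_compactV. Qed.
Let mw1 : measurable w1. Proof. exact: measurable_compactV. Qed.
Let mW : measurable (w0 `*` w1). Proof. exact: measurableX. Qed.

(** A competitor: the first marginal is prescribed, the second one is free and defines the competing
    control. *)
Definition half_plan pi := concentrated_on pi (w0 `*` w1) /\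
  forall A, measurable A -> pi (fst @^-1` A) = u0 A.

Lemma half_plan_snd pi : half_plan pi ->
  exists m : {finite_measure set V -> \bar R},
    (forall A, m A = pi (snd @^-1` A)) /\ concentrated_on m w1.
Proof.
move=> [cpi _].
pose pm : {measure set V -> \bar R} :=
  measure_function_pushforward__canonical__measure_function_Measure pi
    (measurable_snd : measurable_fun setT (@snd V V)).
have [|m mE] := @finite_measureP _ _ _ pm.
  by rewrite /= /pushforward preimage_setT; exact: finite_measure_fin.
exists m; split => [A|A mA A0]; first by rewrite mE.
rewrite mE /= /pushforward cpi//.
  by rewrite -[X in measurable X]setTI; exact: measurable_snd.
apply/seteqP; split => // -[x y] [/= Ay [_ wy]].
by have : (A `&` w1) y by []; rewrite A0.
Qed.

Lemma half_plan_int_fst pi (g : V -> R) (C : R) : half_plan pi ->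
  measurable_fun setT g -> (forall x, w0 x -> `|g x| <= C) ->
  \int[pi]_(z in w0 `*` w1) g z.1 = \int[u0]_(x in w0) g x.
Proof.
move=> [cpi pi1] mg hg; apply/esym.
apply: (pushforward_Rintegral measurable_fst) => //.
- by move=> A mA; exact/esym/pi1.
- exact: hg.
- by move=> z [].
- have mf : measurable (fst @^-1` w0 : set (V * V)).
    by rewrite -[X in measurable X]setTI; exact: measurable_fst.
  by apply: cpi; [exact: measurableD|rewrite setDE -setIA setICl setI0].
Qed.

Lemma half_plan_int_snd pi (m : {finite_measure set V -> \bar R}) (g : V -> R) (C : R) :
  half_plan pi -> (forall A, measurable A -> m A = pi (snd @^-1` A)) ->
  measurable_fun setT g -> (forall x, w1 x -> `|g x| <= C) ->
  \int[pi]_(z in w0 `*` w1) g z.2 = \int[m]_(x in w1) g x.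
Proof.
move=> [cpi _] pi2 mg hg; apply/esym.
apply: (pushforward_Rintegral measurable_snd) => //.
- exact: hg.
- by move=> z [].
- have mf : measurable (snd @^-1` w1 : set (V * V)).
    by rewrite -[X in measurable X]setTI; exact: measurable_snd.
  by apply: cpi; [exact: measurableD|rewrite setDE -setIA setICl setI0].
Qed.

Lemma map_plan T : measurable_fun setT T -> (forall x, w1 (T x)) ->
  exists pi, half_plan pi /\ forall (f : V * V -> R) (C : R), measurable_fun setT f ->
    (forall z, (w0 `*` w1) z -> `|f z| <= C) ->
    \int[pi]_(z in w0 `*` w1) f z = \int[u0]_(x in w0) f (x, T x).
Proof.
move=> mT Tw.
have mg : measurable_fun setT (fun x => (x, T x)) by exact: measurable_fun_pair.
pose pm : {measure set (V * V)%type -> \bar R} :=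
  measure_function_pushforward__canonical__measure_function_Measure u0 mg.
have [|pi piE] := @finite_measureP _ _ _ pm.
  by rewrite /= /pushforward preimage_setT; exact: finite_measure_fin.
exists pi; split; first split.
- move=> A mA A0; rewrite piE /= /pushforward; apply: u0w.
    by rewrite -[X in measurable X]setTI; exact: (mg).
  apply/seteqP; split => // x [/= Ax wx].
  have : (A `&` (w0 `*` w1)) (x, T x) by split => //; split => //; exact: Tw.
  by rewrite A0.
- by move=> A mA; rewrite piE.
move=> f C mf hf; apply: (pushforward_Rintegral mg) => //; first by move=> A _; exact: piE.
- exact: hf.
- by move=> x wx; split => //; exact: Tw.
apply: u0w.
  apply: measurableD => //.
  by rewrite -[X in measurable X]setTI; apply: (mg).
by rewrite setDE -setIA setICl setI0.
Qed.

(** A measurable map without a selection theorem. By compactness of [w0], for y near y1 the point y1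
    is within [e] of being as good as y for all x at once; by compactness of [w1] finitely many y1
    suffice, and the best of a finite list is chosen by measurable case distinctions. *)
Lemma near_minimizer Phi (e : R) : 0 < e -> w1 !=set0 ->
  (continuous (fun z : V * V => Phi z.1 z.2)) ->
  measurable_fun setT (fun z : V * V => Phi z.1 z.2) ->
  exists T, [/\ measurable_fun setT T, forall x, w1 (T x) &
    forall x y, w0 x -> w1 y -> Phi x (T x) <= Phi x y + e].
Proof.
move=> e0 [y0 wy0] cPhi mPhi.
have cover1 y1 : \forall y \near y1, w0 `<=` [set x | Phi x y1 <= Phi x y + e].
  have /compact_near_coveringP/(_ V (nbhs y1) (fun y x => Phi x y1 <= Phi x y + e)) := cw0.
  apply=> x wx.
  have e2 : 0 < e / 2 by rewrite divr_gt0.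
  have h1 : \forall z \near (x, y1), `|Phi x y1 - Phi z.1 z.2| < e / 2.
    by have /cvgrPdist_lt := cPhi (x, y1); apply.
  have h2 : \forall x' \near x, `|Phi x y1 - Phi x' y1| < e / 2.
    case: h1 => -[X Y] /= [nX nY] XY; apply: filterS nX => x' Xx'.
    by apply: (XY (x', y1)); split => //=; exact: nbhs_singleton nY.
  have h3 : \forall z \near (x, y1), `|Phi x y1 - Phi z.1 y1| < e / 2.
    exists ([set x' | `|Phi x y1 - Phi x' y1| < e / 2], setT) => /=.
      by split => //; exact: filterT.
    by move=> z [].
  apply: filterS2 h1 h3 => z; rewrite !ltr_norml => /andP[a1 a2] /andP[a3 a4].
  by move: a1 a2 a3 a4; rewrite /=; move: (Phi x y1) (Phi z.1 z.2) (Phi z.1 y1) => *; lra.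
pose O y1 : set V := interior [set y | w0 `<=` [set x | Phi x y1 <= Phi x y + e]].
have := cw1; rewrite compact_cover => /(_ V w1 O) h.
have [||s sw1 hs] := h.
- by move=> y _; exact: open_interior.
- by move=> y wy; exists y => //; exact: cover1.
have key (l : seq V) : (forall y, y \in l -> w1 y) -> exists T,
    [/\ measurable_fun setT T, forall x, w1 (T x) &
      forall x y, y \in l -> Phi x (T x) <= Phi x y].
  elim: l => [|y l ih] lw; first by exists (cst y0); split.
  have [T [mT Tw Tl]] := ih (fun z zl => lw z (mem_behead (s := y :: l) zl)).
  have m1 : measurable_fun setT (fun x => Phi x (T x)).
    by apply: (measurableT_comp mPhi (g := fun x => (x, T x))); exact: measurable_fun_pair.
  have m2 : measurable_fun setT (fun x => Phi x y).
    by apply: (measurableT_comp mPhi (g := fun x => (x, y))); exact: measurable_fun_pair.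
  exists (fun x => if Phi x y < Phi x (T x) then y else T x); split.
  - by apply: measurable_fun_ifT => //; exact: measurable_fun_ltr.
  - by move=> x; case: ifP => // _; apply: lw; rewrite mem_head.
  - move=> x z; rewrite inE => /orP[/eqP ->|zl]; case: ltP => // h1; last exact: Tl.
    by apply: (le_trans (ltW h1)); exact: Tl.
have [T [mT Tw Tl]] := key (finmap.enum_fset s) (fun y ys => set_mem (sw1 y ys)).
exists T; split => // x y wx wy.
have [y1 y1s Oy] := hs y wy.
have /(_ x wx) /= := interior_subset Oy.
by apply: le_trans; exact: Tl.
Qed.

(** The points x of [w0] for which some point of [K] minimizes Phi(x, .) over [w1] up to [e]. A
    positive [e] is what Markov's inequality reaches; [e = 0] is attained in a later limit. *)
Definition contact Phi (e : R) (K : set V) : set V :=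
  fst @` ((w0 `*` K) `&` [set z | forall y, w1 y -> Phi z.1 z.2 <= Phi z.1 y + e]).

(** The continuous image of a compact set, hence compact and Borel. *)
Lemma measurable_contact Phi e K : continuous (fun z : V * V => Phi z.1 z.2) ->
  compact K -> measurable (contact Phi e K).
Proof.
move=> cPhi cK; apply: measurable_compactV; apply: continuous_compact.
  by apply: continuous_subspaceT => z; exact: cvg_fst.
apply: compact_closedI; first exact: compact_setX.
have -> : [set z | forall y, w1 y -> Phi z.1 z.2 <= Phi z.1 y + e] =
    \bigcap_(y in w1) [set z : V * V | Phi z.1 z.2 - Phi z.1 y <= e].
  by apply/seteqP; split => z h y wy; have := h y wy; rewrite /= lerBlDl.
apply: closed_bigI => y _.
have c1 : continuous (fun z : V * V => Phi z.1 y).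
  move=> z U /(cPhi (z.1, y))[[X Y] /= [nX nY] XY].
  exists (X, setT) => /=; first by split => //; exact: filterT.
  by move=> x [Xx _]; apply: (XY (x.1, y)); split => //=; exact: nbhs_singleton nY.
have c3 : continuous (fun z : V * V => Phi z.1 z.2 - Phi z.1 y).
  by move=> z; exact: continuousB (cPhi z) (c1 z).
have : closed ((fun z : V * V => Phi z.1 z.2 - Phi z.1 y) @^-1` [set x | x <= e]).
  by apply: closed_comp; [move=> z _; exact: c3|exact: closed_le].
by [].
Qed.

(* Compare an almost optimal plan with the plan carried by an almost pointwise
   minimizing map: the excess of Phi over its infimum has small integral, and
   Markov's inequality bounds the mass where it exceeds e. *)
Lemma contact_tangency Phi (w : V -> R) (c : V -> V -> R) (m : {finite_measure set V -> \bar R}) (A Tb : R)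
    (K : set V) :
  0 < A -> w1 !=set0 -> continuous w -> continuous (fun z : V * V => c z.1 z.2) ->
  measurable_fun setT (fun z : V * V => c z.1 z.2) ->
  Phi = (fun x y => w y + A * c x y) ->
  (forall pi (m1 : {finite_measure set V -> \bar R}), half_plan pi ->
    (forall B, measurable B -> m1 B = pi (snd @^-1` B)) ->
    \int[m]_(y in w1) w y + A * Tb <=
    \int[m1]_(y in w1) w y + A * \int[pi]_(z in w0 `*` w1) c z.1 z.2) ->
  (forall e : R, 0 < e -> exists pi, [/\ half_plan pi,
    (forall B, measurable B -> m B = pi (snd @^-1` B)) &
    \int[pi]_(z in w0 `*` w1) c z.1 z.2 <= Tb + e]) ->
  compact K -> K `<=` w1 -> forall e : R, 0 < e ->
  (m K <= u0 (contact Phi e K))%E.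
Proof.
move=> A0 w1n0 cw cc mc PhiE opt near cK Kw e e0.
have cw2 : continuous (fun z : V * V => w z.2).
  move=> z U /(cw z.2) nU; exists (setT, w @^-1` U) => /=.
    by split => //; exact: filterT.
  by move=> x [].
have cPhi : continuous (fun z : V * V => Phi z.1 z.2).
  rewrite PhiE => z.
  have c1 : {for z, continuous (fun z : V * V => A * c z.1 z.2)}.
    exact: continuousM (@cst_continuous _ _ A z) (cc z).
  exact: continuousD (cw2 z) c1.
have mw : measurable_fun setT w by exact: measurable_continuous.
have mw2 : measurable_fun setT (fun z : V * V => w z.2).
  by apply: (measurableT_comp mw); exact: measurable_snd.
have mAc : measurable_fun setT (fun z : V * V => A * c z.1 z.2) by exact: measurable_funM.
have mPhi : measurable_fun setT (fun z : V * V => Phi z.1 z.2).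
  by rewrite PhiE; exact: measurable_funD.
have cW : compact (w0 `*` w1) by exact: compact_setX.
have bnd (f : V * V -> R) : continuous f ->
    exists C, forall z, (w0 `*` w1) z -> `|f z| <= C.
  move=> cf; have /compact_bounded[M [_ hM]] := continuous_compact (continuous_subspaceT cf) cW.
  exists (`|M| + 1) => z Wz; apply: (hM (`|M| + 1)); last by exists z.
  by rewrite (le_lt_trans (ler_norm _))// ltrDl.
have [Cc hCc] := bnd _ cc; have [Cp hCp] := bnd _ cPhi.
have [Cw _ hCw] := continuous_bounded_compact cw1 cw.
have int pi (f : V * V -> R) C : measurable_fun setT f ->
    (forall z, (w0 `*` w1) z -> `|f z| <= C) ->
    pi.-integrable (w0 `*` w1) (EFin \o f).
  move=> mf hf; apply: bounded_finite_integrable hf => //; last exact: measurable_funTS.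
  by rewrite -ge0_fin_numE//; exact: fin_num_measure.
have split_cost pi (m1 : {finite_measure set V -> \bar R}) : half_plan pi ->
    (forall B, measurable B -> m1 B = pi (snd @^-1` B)) ->
    \int[m1]_(y in w1) w y + A * \int[pi]_(z in w0 `*` w1) c z.1 z.2 =
    \int[pi]_(z in w0 `*` w1) Phi z.1 z.2.
  move=> hp m1E; rewrite -(half_plan_int_snd hp m1E mw hCw).
  rewrite -RintegralZl//; last exact: int hCc.
  rewrite -RintegralD//; first by apply: eq_Rintegral => z _; rewrite PhiE.
    by apply: (@int _ (fun z => w z.2) Cw) => // z [_]; exact: hCw.
  apply: (@int _ (fun z => A * c z.1 z.2) (A * Cc)) => // z Wz.
  by rewrite normrM gtr0_norm// ler_pM2l// hCc.
have fu0 : u0 w0 \is a fin_num by exact: fin_num_measure.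
set U := fine (u0 w0).
have U0 : 0 <= U by exact: fine_ge0.
apply/lee_addgt0Pr => d d0.
have K0 : 0 < A + U + 1 by rewrite ltr_wpDl// addr_ge0// ltW.
(* The second term makes Markov's bound [eta * (A + U) / (e / 2)] at most [d]. *)
pose eta := Num.min (e / 2) (e * d / (A + U + 1) / 2).
have eta0 : 0 < eta by rewrite lt_min !divr_gt0//= mulr_gt0.
have eta_e : eta <= e / 2 by rewrite ge_min lexx.
have eta_d : eta * (A + U + 1) * 2 <= e * d.
  rewrite -ler_pdivlMr// -ler_pdivlMr//.
  by rewrite mulrAC ge_min lexx orbT.
have [T [mT Tw hT]] := near_minimizer eta0 w1n0 cPhi mPhi.
have [piT [hpT intT]] := map_plan mT Tw.
have [mT1 [mT1E _]] := half_plan_snd hpT.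
have [pi [hp piE pic]] := near _ eta0.
have := opt piT mT1 hpT (fun B _ => mT1E B).
rewrite (split_cost _ _ hpT (fun B _ => mT1E B)) (intT _ Cp)// => opt1.
have mPhiT : measurable_fun setT (fun x => Phi x (T x)).
  by apply: (measurableT_comp mPhi (g := fun x => (x, T x))); exact: measurable_fun_pair.
have bPhiT x : w0 x -> `|Phi x (T x)| <= Cp by move=> wx; apply: (hCp (x, T x)); split => //; exact: Tw.
rewrite -(half_plan_int_fst hp mPhiT bPhiT) in opt1.
have := split_cost _ _ hp piE => opt2.
(* Excess over the almost minimizing map, shifted by [eta] to be nonnegative on the product. *)
pose F (z : V * V) := Phi z.1 z.2 - Phi z.1 (T z.1) + eta.
have mPhiT1 : measurable_fun setT (fun z : V * V => Phi z.1 (T z.1)).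
  by apply: (measurableT_comp mPhiT); exact: measurable_fst.
have mF : measurable_fun setT F.
  by apply: measurable_funD => //; exact: measurable_funB.
have F0 z : (w0 `*` w1) z -> 0 <= F z.
  move=> [z1 z2]; have := hT _ _ z1 z2; rewrite /F.
  by move: (Phi z.1 z.2) (Phi z.1 (T z.1)) => *; lra.
have i1 : pi.-integrable (w0 `*` w1) (EFin \o (fun z => Phi z.1 z.2)) by exact: int hCp.
have i2 : pi.-integrable (w0 `*` w1) (EFin \o (fun z => Phi z.1 (T z.1))).
  by apply: (@int _ _ Cp) => // z [z1 _]; exact: bPhiT.
have i3 : pi.-integrable (w0 `*` w1) (EFin \o cst eta).
  by apply: (@int _ _ eta) => // z _; rewrite gtr0_norm.
have i12 : pi.-integrable (w0 `*` w1) (EFin \o (fun z => Phi z.1 z.2 - Phi z.1 (T z.1))).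
  by have := integrableB mW i1 i2; apply: eq_integrable => // z _ /=; rewrite EFinB.
have fpi : pi (w0 `*` w1) \is a fin_num by exact: fin_num_measure.
have piU : fine (pi (w0 `*` w1)) <= U.
  rewrite fine_le//.
  have mf : measurable (fst @^-1` w0 : set (V * V)).
    by rewrite -[X in measurable X]setTI; exact: measurable_fst.
  by have [_ <-//] := hp; apply: le_measure; rewrite ?inE// => z [].
(* Almost optimality of the plan costs [A * eta], the shift at most [U * eta]. *)
have intF : \int[pi]_(z in w0 `*` w1) F z <= eta * (A + U).
  rewrite /F RintegralD// RintegralB// Rintegral_cst// -opt2.
  have h1 : eta * fine (pi (w0 `*` w1)) <= eta * U by rewrite ler_pM2l.
  have h2 : A * \int[pi]_(z in w0 `*` w1) c z.1 z.2 <= A * (Tb + eta) by rewrite ler_pM2l.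
  move: h1 h2 opt1; rewrite mulrDr.
  move: (\int[m]_(y in w1) w y) (\int[pi]_(z in w0 `*` w1) Phi z.1 (T z.1)).
  move: (A * \int[pi]_(z in w0 `*` w1) c z.1 z.2) (fine (pi (w0 `*` w1))).
  by move=> a b f g h1 h2 h3; lra.
have intFE : (\int[pi]_(z in w0 `*` w1) (F z)%:E <= (eta * (A + U))%:E)%E.
  rewrite -(@fineK _ (\int[pi]_(z in w0 `*` w1) (F z)%:E)%E) ?lee_fin//.
  apply: integrable_fin_num => //.
  by have := integrableD mW i12 i3; apply: eq_integrable => // z _ /=; rewrite EFinD.
have mK : measurable K by exact: measurable_compactV.
have mC := measurable_contact e cPhi cK.
(* Off [G], a pair of the product has a second component that is minimal up to [e]; [G] itself is
   bounded by Markov's inequality. *)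
pose G : set (V * V) := (w0 `*` w1) `&` [set z | e / 2 <= F z].
have mG : measurable G.
  apply: measurableI => //; rewrite -[X in measurable X]setTI.
  have := mF measurableT `[e / 2, +oo[%classic (measurable_itv _).
  by congr (measurable (_ `&` _)); apply/seteqP; split => z; rewrite /= in_itv/= andbT.
have mC1 : measurable (fst @^-1` contact Phi e K : set (V * V)).
  by rewrite -[X in measurable X]setTI; exact: measurable_fst.
have mK2 : measurable (snd @^-1` K : set (V * V)).
  by rewrite -[X in measurable X]setTI; exact: measurable_snd.
have piK : (pi (snd @^-1` K) <= pi (fst @^-1` contact Phi e K) + pi G)%E.
  have N0 : pi ((snd @^-1` K) `\` (w0 `*` w1)) = 0%E.
    have [cpi _] := hp; apply: cpi; first exact: measurableD.
    by rewrite setDE -setIA setICl setI0.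
  rewrite -[X in (_ <= X)%E]adde0 -[X in (_ <= _ + X)%E]N0.
  apply: (@le_trans _ _ (pi ((fst @^-1` contact Phi e K `|` G) `|` ((snd @^-1` K) `\` (w0 `*` w1))))).
    apply: le_measure; rewrite ?inE//.
      by apply: measurableU; [exact: measurableU|exact: measurableD].
    move=> z Kz; have [Wz|nW] := pselect ((w0 `*` w1) z); last by right.
    left; have [Gz|nG] := pselect (G z); first by right.
    left; exists z => //; split; first by have [] := Wz.
    move=> y wy; have [w0z _] := Wz; have := hT z.1 y w0z wy.
    have : F z < e / 2 by rewrite ltNge; apply/negP => h; apply: nG.
    rewrite /F; move: eta_e; move: (Phi z.1 z.2) (Phi z.1 (T z.1)) (Phi z.1 y) => *; lra.
  apply: (le_trans (measureU2 _ _ _)) => //.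
  - exact: measurableU.
  - exact: measurableD.
  by rewrite leeD2r//; exact: measureU2.
rewrite piE//; apply: (le_trans piK); have [_ ->//] := hp; rewrite leeD2l//.
have : ((e / 2)%:E * pi G <= (eta * (A + U))%:E)%E.
  apply: le_trans intFE; rewrite -integral_cst//.
  apply: (@le_trans _ _ (\int[pi]_(z in G) (F z)%:E)%E).
    apply: ge0_le_integral => //.
    - by move=> z _; rewrite lee_fin divr_ge0// ltW.
    - by apply/measurable_EFinP; exact: measurable_funTS.
    - by move=> z [_ h]; rewrite lee_fin.
  apply: ge0_subset_integral => //.
    by apply/measurable_EFinP; exact: measurable_funTS.
  by move=> z [].
have fG : pi G \is a fin_num by exact: fin_num_measure.
have aux (x : \bar R) : x \is a fin_num ->
    ((e / 2)%:E * x <= (eta * (A + U))%:E)%E -> (x <= d%:E)%E.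
  move: x => [x| |]//= _; rewrite -EFinM !lee_fin => h1.
  have e2 : 0 < e / 2 by rewrite divr_gt0.
  rewrite -(ler_pM2l e2); apply: (le_trans h1).
  have -> : e / 2 * d = e * d / 2 by rewrite mulrAC.
  rewrite ler_pdivlMr//; apply: le_trans eta_d; rewrite ler_pM2r// ler_pM2l//.
  by rewrite lerDl.
exact: aux fG.
Qed.

End transport.

(** * The optimal control as marginal of almost optimal plans *)

Section optimal_contact.
Context {R : realType} {n : nat}.
Local Notation V := 'rV[R]_n.
Local Notation mu := (lebesgue_rV R n).
Variables (D w0 w1 : set V) (q r alpha : R) (J : (V -> R) -> R).
Variables (c : V -> V -> R) (u0 : {finite_measure set V -> \bar R}).
Variables (ubar : {charge set V -> \bar R}) (p w : V -> R).
Hypotheses (n0 : (0 < n)%N) (nr : n%:R < r) (q1 : 1 < q) (qr : q^-1 + r^-1 = 1).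
Hypotheses (oD : open D) (bD : bounded_set D).
Hypotheses (cw0 : compact w0) (cw1 : compact w1) (w1D : w1 `<=` closure D).
Hypotheses (w1n0 : w1 !=set0) (u0w : concentrated_on u0 w0) (a0 : 0 < alpha).
Hypothesis solvable : poisson_uniquely_solvable q%:E D.
Hypotheses (Jc : W10_continuous q%:E D J) (Jd : gateaux_differentiable q%:E D J).
Hypotheses (cc : continuous (fun z : V * V => c z.1 z.2)).
Hypotheses (mc : measurable_fun setT (fun z : V * V => c z.1 z.2)).
Hypothesis (c0 : forall x y, 0 <= c x y).
Hypothesis opt : optimal_control D w0 w1 q%:E J alpha c u0 ubar.
Hypothesis ap : adjoint_state D w1 q%:E J ubar p.
Hypotheses (cw : continuous w) (rw : C0_representative D p w).
Implicit Types (pi : {finite_measure set (V * V)%type -> \bar R}).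
Implicit Types (u : {charge set V -> \bar R}) (m : {finite_measure set V -> \bar R}).

Let mw0 : measurable w0. Proof. exact: measurable_compactV. Qed.
Let mw1 : measurable w1. Proof. exact: measurable_compactV. Qed.
Let mW : measurable (w0 `*` w1). Proof. exact: measurableX. Qed.
Let cost pi := \int[pi]_(z in w0 `*` w1) c z.1 z.2.

Lemma cost_bounded : exists C, forall z, (w0 `*` w1) z -> `|c z.1 z.2| <= C.
Proof.
have cW : compact (w0 `*` w1) by exact: compact_setX.
have /compact_bounded[M [_ hM]] := continuous_compact (continuous_subspaceT cc) cW.
exists (`|M| + 1) => z Wz; apply: (hM (`|M| + 1)); last by exists z.
by rewrite (le_lt_trans (ler_norm _))// ltrDl.
Qed.

Lemma costE pi : (\int[pi]_(z in w0 `*` w1) (c z.1 z.2)%:E = (cost pi)%:E)%E.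
Proof.
have [C hC] := cost_bounded.
rewrite /cost /Rintegral fineK//; apply: integrable_fin_num => //.
apply: (@bounded_finite_integrable _ _ _ _ _ (fun z => c z.1 z.2) C) => //.
  by rewrite -ge0_fin_numE//; exact: fin_num_measure.
exact: measurable_funTS.
Qed.

Lemma transport_cost_le pi u : half_plan w0 w1 u0 pi ->
  (forall A, measurable A -> u A = pi (snd @^-1` A)) ->
  (transport_cost w0 w1 c u0 u <= (cost pi)%:E)%E.
Proof.
move=> [h1 h2] h3; rewrite -costE; apply: ereal_inf_lbound; exists pi => //.
by split => // A mA; rewrite /pushforward -?h3// h2.
Qed.

Lemma transport_cost_ge0 u : (0 <= transport_cost w0 w1 c u0 u)%E.
Proof.
apply: le_ereal_inf_tmp => _ [pi _ <-]; apply: integral_ge0 => z _.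
by rewrite lee_fin.
Qed.

(** The constant map onto a point of [w1] yields a control of finite cost, so an optimal control
    cannot have infinite cost; the cost is also nonnegative. *)
Lemma transport_cost_fin : exists T : R, transport_cost w0 w1 c u0 ubar = T%:E.
Proof.
have [y wy] := w1n0.
have [pi [hp _]] := map_plan cw0 cw1 u0w (@measurable_cst _ _ _ _ setT y) (fun=> wy).
have [m [mE cm]] := half_plan_snd hp.
pose u : {charge set V -> \bar R} := charge_of_finite_measure m.
have le := transport_cost_le (u := u) hp (fun B _ => mE B).
have cu : concentrated_on u w1 by exact: cm.
have [_ /(_ u cu)] := opt; rewrite /control_cost.
have := transport_cost_ge0 ubar; have := transport_cost_ge0 u; move: le.
case: (transport_cost w0 w1 c u0 u) => [T| |]//= _ _.
case: (transport_cost w0 w1 c u0 ubar) => [T'| |]//= _; first by exists T'.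
by rewrite mulry gtr0_sg// mul1e addey// -EFinM -EFinD leye_eq.
Qed.

(** A finite transport cost means that plans exist, so [ubar] is a marginal of one of them, hence a
    nonnegative measure [m]. Optimality along segments of controls then supplies the comparison
    required by [contact_tangency]. *)
Lemma optimal_contact : exists m, (forall A, measurable A -> ubar A = m A) /\
  forall (K : set V) (e : R), compact K -> K `<=` w1 -> 0 < e ->
    (m K <= u0 (contact w0 w1 (fun x y => (w y + alpha * c x y)%R) e K))%E.
Proof.
have [T TE] := transport_cost_fin.
have near e : 0 < e -> exists pi, [/\ half_plan w0 w1 u0 pi,
    forall B, measurable B -> ubar B = pi (snd @^-1` B) & cost pi <= T + e].
  move=> e0; have fT : transport_cost w0 w1 c u0 ubar \is a fin_num by rewrite TE.
  have [_ [pi [h1 h2 h3] <-]] := lb_ereal_inf_adherent e0 fT.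
  rewrite -/(transport_cost _ _ _ _ _) TE costE -EFinD lte_fin => /ltW h.
  by exists pi; split => // B mB; rewrite -h3.
have [pi1 [hp1 pi1E _]] := near 1 ltr01.
have [m [mE cm]] := half_plan_snd hp1.
have um A : measurable A -> ubar A = m A by move=> mA; rewrite pi1E// mE.
exists m; split => // K e cK Kw e0.
apply: (contact_tangency (Tb := T) (A := alpha) cw0 cw1 u0w a0 w1n0 cw cc mc) => //; last first.
  move=> d /near[pi [h1 h2 h3]]; exists pi; split => // B mB.
  by rewrite -um// h2.
move=> pi m1 hp m1E.
pose u1 : {charge set V -> \bar R} := charge_of_finite_measure m1.
(* [adjoint_first_order] is used with [K] equal to alpha times the excess of the cost of [pi] over
   the optimal value [T]. *)
suff : \int[m]_(y in w1) w y <= \int[m1]_(y in w1) w y + alpha * (cost pi - T).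
  rewrite -/(cost pi) mulrBr; move: (\int[m]_(y in w1) w y) (\int[m1]_(y in w1) w y).
  by move: (alpha * _) (alpha * _) => *; lra.
have u1m A : measurable A -> u1 A = m1 A by [].
apply: (adjoint_first_order n0 nr q1 qr oD bD cw1 w1D solvable Jc Jd um u1m ap rw).
move=> t /andP[t0 t1] ut mt utE utc _.
have t01 : 0 <= t <= 1 by rewrite ltW.
have t1' : 0 <= 1 - t by rewrite subr_ge0.
have cut : concentrated_on ut w1.
  move=> A mA A0; rewrite utc//.
  have -> : ubar A = 0%E by rewrite um//; exact: cm.
  have -> : u1 A = 0%E.
    rewrite u1m// m1E//; have [h _] := hp; apply: h.
      by rewrite -[X in measurable X]setTI; exact: measurable_snd.
    apply/seteqP; split => // -[x y] [/= Ay [_ wy]].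
    by have : (A `&` w1) y by []; rewrite A0.
  by rewrite !mule0 adde0.
(* Convexity of the transport cost: an almost optimal plan for [ubar] is combined with [pi] into a
   plan for [ut]. *)
have Tut : (transport_cost w0 w1 c u0 ut <= ((1 - t) * T + t * cost pi)%:E)%E.
  apply/lee_addgt0Pr => d d0; have [pid [hpd pidE cd]] := near d d0.
  have [pit [pitE pitI _]] := convex_measureP pid pi t01.
  have hpt : half_plan w0 w1 u0 pit.
    have [a1 a2] := hpd; have [b1 b2] := hp; split => [A mA A0|A mA].
      by rewrite pitE a1// b1// !mule0 adde0.
    rewrite pitE a2// b2// -ge0_muleDl ?lee_fin//; last exact: ltW.
    by rewrite -EFinD subrK mul1e.
  have utpi A : measurable A -> ut A = pit (snd @^-1` A).
    by move=> mA; rewrite utc// pitE pidE// u1m// m1E.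
  apply: (le_trans (transport_cost_le hpt utpi)).
  rewrite -costE pitI//; last first.
  - by move=> z _; rewrite lee_fin.
  - by apply: measurable_funTS; exact/measurable_EFinP.
  rewrite !costE -!EFinM -!EFinD lee_fin.
  have : (1 - t) * cost pid <= (1 - t) * (T + d) by exact: ler_wpM2l.
  have : (1 - t) * d <= d by rewrite ler_piMl ?(ltW d0)// lerBlDr lerDl ltW.
  by rewrite mulrDr; move: (t * cost pi) ((1 - t) * cost pid) ((1 - t) * T) => *; lra.
have a0' : (0 <= alpha%:E)%E by rewrite lee_fin ltW.
have [_ /(_ ut cut)] := opt; rewrite /control_cost TE -EFinM -EFinD.
move=> h; have {h} := le_trans h (leeD2l _ (lee_wpmul2l a0' Tut)).
rewrite -EFinM -EFinD lee_fin.
move: (J _) (J _) => j1 j2 h.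
have : alpha * ((1 - t) * T + t * cost pi) = alpha * T + t * (alpha * (cost pi - T)) by ring.
by move: h; move: (alpha * (_ + _)) (alpha * T) (t * (_ * _)) => *; lra.
Qed.

End optimal_contact.

(** * Geometry of the power cost *)

Section power_inequalities.
Context {R : realType}.
Implicit Types a b k s g : R.

(** Put A = 1 + k (s - 1) = k s + (1 - k). Since ln x <= x - 1, k ln(s/A) + (1 - k) ln(1/A) <= 0,
    that is k ln s <= ln A. *)
Lemma powR_le_tangent s k : 0 <= s -> 0 < k <= 1 -> s `^ k <= 1 + k * (s - 1).
Proof.
move=> s0 /andP[k0 k1].
have [->|sn0] := eqVneq s 0.
  by rewrite powR0 ?gt_eqF// sub0r mulrN1 subr_ge0.
have {sn0}s0 : 0 < s by rewrite lt_neqAle eq_sym sn0.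
set A := 1 + k * (s - 1).
have A0 : 0 < A.
  have : 0 < k * s by rewrite mulr_gt0.
  by rewrite /A mulrBr mulr1; lra.
have l1 : ln (s / A) <= s / A - 1.
  rewrite -{1}[s / A](subrK 1) addrC; apply: le_ln1Dx.
  by rewrite ltrBrDr addrC subrr divr_gt0.
have l2 : ln A^-1 <= A^-1 - 1.
  rewrite -{1}[A^-1](subrK 1) addrC; apply: le_ln1Dx.
  by rewrite ltrBrDr addrC subrr invr_gt0.
have A0' : A^-1 \is Num.pos by rewrite posrE invr_gt0.
have k1' : 0 <= 1 - k by rewrite subr_ge0.
rewrite lnM// in l1.
have h1 := ler_wpM2l (ltW k0) l1; have h2 := ler_wpM2l k1' l2.
have e : k * (s / A - 1) + (1 - k) * (A^-1 - 1) = 0.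
  by rewrite /A; field; rewrite -/A gt_eqF.
rewrite -(ler_ln (x := s `^ k)) ?posrE ?powR_gt0// ln_powR.
move: h1 h2 e; rewrite (lnV (x := A)) ?posrE//.
move: (ln s) (ln A) (s / A - 1) (A^-1 - 1) => ls lA x y h1 h2 e.
have : k * (ls + - lA) + (1 - k) * - lA <= 0 by rewrite -e lerD.
by lra.
Qed.

Lemma powR_concave_tangent a b k : 0 < a -> 0 <= b -> 0 < k <= 1 ->
  b `^ k <= a `^ k + k * a `^ (k - 1) * (b - a).
Proof.
move=> a0 b0 k01; have s0 : 0 <= b / a by rewrite divr_ge0// ltW.
have h := powR_le_tangent s0 k01.
have -> : b `^ k = a `^ k * (b / a) `^ k.
  by rewrite -powRM ?(ltW a0)// mulrC divfK ?gt_eqF.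
apply: (le_trans (ler_wpM2l (powR_ge0 _ _) h)).
rewrite powRB; last by rewrite (gt_eqF a0) implybT.
rewrite powRr1 ?(ltW a0)// le_eqVlt; apply/orP; left; apply/eqP.
by move: (a `^ k) => X; field; rewrite gt_eqF.
Qed.

(** The concave inequality with exponent 1/g, applied to (b/a)^g and rescaled. *)
Lemma powR_convex_tangent a b g : 0 <= a -> 0 <= b -> 1 < g ->
  a `^ g + g * a `^ (g - 1) * (b - a) <= b `^ g.
Proof.
move=> a0 b0 g1; have g0 : 0 < g by rewrite (lt_trans _ g1).
have [->|an0] := eqVneq a 0.
  by rewrite !powR0 ?gt_eqF ?subr_gt0// mulr0 mul0r addr0 powR_ge0.
have {an0}a0 : 0 < a by rewrite lt_neqAle eq_sym an0.
have s0 : 0 <= b / a by rewrite divr_ge0// ltW.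
have k01 : 0 < g^-1 <= 1 by rewrite invr_gt0 g0 invf_le1// ltW.
have := powR_le_tangent (powR_ge0 (b / a) g) k01.
rewrite -powRrM divff ?gt_eqF// powRr1// => h.
have -> : b `^ g = a `^ g * (b / a) `^ g.
  by rewrite -powRM ?(ltW a0)// mulrC divfK ?gt_eqF.
rewrite powRB; last by rewrite (gt_eqF a0) implybT.
rewrite powRr1 ?(ltW a0)//.
have -> : a `^ g + g * (a `^ g / a) * (b - a) = a `^ g * (1 + g * (b / a - 1)).
  by move: (a `^ g) => X; field; rewrite gt_eqF.
rewrite ler_pM2l ?powR_gt0//.
move: h => /(ler_wpM2l (ltW g0)).
have -> : g * (1 + g^-1 * ((b / a) `^ g - 1)) = g + (b / a) `^ g - 1.
  by move: ((b / a) `^ g) => X; field; rewrite gt_eqF.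
by move: (b / a) ((b / a) `^ g) => x y; rewrite mulrBr; lra.
Qed.

End power_inequalities.

Section euclidean_norm.
Context {R : realType} {n : nat}.
Local Notation V := 'rV[R]_n.
Implicit Types (x y z : V) (i : 'I_n).

Lemma dotp_ge0 x : 0 <= dotp x x.
Proof. by apply: sumr_ge0 => i _; rewrite -expr2 sqr_ge0. Qed.

Lemma enorm_ge0 x : 0 <= enorm x. Proof. exact: sqrtr_ge0. Qed.

Lemma enorm_sqr x : enorm x ^+ 2 = dotp x x.
Proof. by rewrite sqr_sqrtr// dotp_ge0. Qed.

Lemma dotpDl x y z : dotp (x + y) z = dotp x z + dotp y z.
Proof. by rewrite /dotp -big_split/=; apply: eq_bigr => i _; rewrite mxE mulrDl. Qed.

Lemma dotpZl (a : R) x z : dotp (a *: x) z = a * dotp x z.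
Proof. by rewrite /dotp mulr_sumr; apply: eq_bigr => i _; rewrite mxE mulrA. Qed.

Lemma dotpC x y : dotp x y = dotp y x.
Proof. by apply: eq_bigr => i _; rewrite mulrC. Qed.

Lemma dotp_evec x i : dotp x (evec i) = x 0 i.
Proof.
rewrite /dotp (bigD1 i)//= big1 ?addr0; first by rewrite evecE eqxx mulr1.
by move=> j ji; rewrite evecE (negbTE ji) mulr0.
Qed.

Lemma enorm_eq0 x : enorm x = 0 -> x = 0.
Proof.
move=> x0; apply/rowP => i; rewrite mxE; apply/eqP; rewrite -sqrf_eq0 eq_le sqr_ge0 andbT.
have : dotp x x = 0 by rewrite -enorm_sqr x0 expr0n.
by rewrite /dotp (bigD1 i)//= -expr2 => <-; rewrite lerDl sumr_ge0// => j _; rewrite -expr2 sqr_ge0.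
Qed.

Lemma coord_le_enorm x i : `|x 0 i| <= enorm x.
Proof.
rewrite -sqrtr_sqr ler_wsqrtr// /dotp (bigD1 i)//= -expr2 lerDl.
by apply: sumr_ge0 => j _; rewrite -expr2 sqr_ge0.
Qed.

Lemma cauchy_schwarz x y : dotp x y <= enorm x * enorm y.
Proof.
have [x0|xn0] := eqVneq (enorm x) 0.
  by rewrite (enorm_eq0 x0) -[X in dotp X]( scale0r (0 : V)) dotpZl mul0r mulr_ge0 ?enorm_ge0.
have [y0|yn0] := eqVneq (enorm y) 0.
  by rewrite dotpC (enorm_eq0 y0) -[X in dotp X]( scale0r (0 : V)) dotpZl mul0r mulr_ge0 ?enorm_ge0.
have X : 0 < enorm x by rewrite lt_neqAle eq_sym xn0 enorm_ge0.
have Y : 0 < enorm y by rewrite lt_neqAle eq_sym yn0 enorm_ge0.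
have := dotp_ge0 (enorm y *: x + (- enorm x) *: y).
rewrite dotpDl !dotpZl !(dotpC _ (_ + _)) !dotpDl !dotpZl (dotpC y x) -!enorm_sqr.
move: (dotp x y) (enorm x) (enorm y) X Y {xn0 yn0} => d a b a0 b0.
have -> : b * (b * a ^+ 2 + - a * d) + - a * (b * d + - a * b ^+ 2) =
  2 * (a * b) * (a * b - d) by ring.
by rewrite pmulr_rge0 ?subr_ge0// !mulr_gt0.
Qed.

Lemma enorm_triangle x y : enorm (x + y) <= enorm x + enorm y.
Proof.
rewrite -(ler_pXn2r (n := 2))// ?nnegrE ?enorm_ge0 ?addr_ge0 ?enorm_ge0//.
rewrite enorm_sqr dotpDl !(dotpC _ (_ + _)) !dotpDl (dotpC y x) -!enorm_sqr.
have := cauchy_schwarz x y; rewrite sqrrD; move: (dotp x y) => d; lra.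
Qed.

Lemma enorm_le_sum x : enorm x <= \sum_(i < n) `|x 0 i|.
Proof.
have s0 : 0 <= \sum_(i < n) `|x 0 i| by exact: sumr_ge0.
rewrite -(ler_pXn2r (n := 2))// ?nnegrE ?enorm_ge0// enorm_sqr expr2 mulr_suml.
apply: ler_sum => i _; rewrite -expr2 -real_normK ?num_real// expr2.
by apply: ler_wpM2l => //; rewrite (bigD1 i)//= lerDl sumr_ge0.
Qed.

Lemma enorm_dist x y : enorm x - enorm y <= enorm (x - y).
Proof. by rewrite lerBlDr -{1}[x](subrK y) enorm_triangle. Qed.

Lemma enormZ (a : R) x : enorm (a *: x) = `|a| * enorm x.
Proof.
rewrite /enorm dotpZl dotpC dotpZl mulrA -expr2 sqrtrM ?sqr_ge0//.
by rewrite sqrtr_sqr.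
Qed.

End euclidean_norm.

(** The tangent inequality at [u]. The factor [v] compensates the unbounded derivative of t^(a-1) at
    0 when a < 2. *)
Lemma powR_sub_mul {R : realType} (a u v : R) : 1 < a -> 0 <= v -> v <= u ->
  (u `^ (a - 1) - v `^ (a - 1)) * v <= a * u `^ (a - 1) * (u - v).
Proof.
move=> a1 v0 vu; have u0 := le_trans v0 vu; have a0 : 0 < a by rewrite (lt_trans _ a1).
have h := powR_convex_tangent u0 v0 a1.
have m1 (t : R) : 0 <= t -> t `^ (a - 1) * t = t `^ a.
  by move=> t0; rewrite mulrC mulr_powRB1.
have h1 : u `^ (a - 1) * v <= u `^ (a - 1) * u.
  by apply: ler_wpM2l; [exact: powR_ge0|exact: vu].
rewrite (m1 u u0) in h1; rewrite mulrBl (m1 v v0).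
move: h h1; rewrite -(opprB u v) mulrN.
by move: (u `^ a) (v `^ a) (_ * (u - v)) (_ * v) => *; lra.
Qed.

(** * Regularity of the power cost and inversion of its gradient *)

Section power_cost.
Context {R : realType} {n : nat}.
Local Notation V := 'rV[R]_n.
Implicit Types (x y z : V) (i : 'I_n) (g s : R).

Lemma enorm_continuous : continuous (@enorm R n).
Proof.
move=> x; apply/(@cvgrPdist_lt _ _ _ (nbhs x)) => e e0.
have e1 : 0 < e / n.+1%:R by rewrite divr_gt0.
have : \forall y \near x, `|x - y| < e / n.+1%:R.
  have /(@cvgrPdist_lt _ _ _ (nbhs x)) := @cvg_id _ (nbhs x); exact.
apply: filterS => y hy.
have h z : `|z| < e / n.+1%:R -> enorm z < e.
  move=> hz; apply: (le_lt_trans (enorm_le_sum z)).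
  apply: (@le_lt_trans _ _ (\sum_(i < n) `|z|)).
    by apply: ler_sum => i _; exact: le_coord_norm.
  rewrite sumr_const card_ord -mulr_natr.
  apply: (@le_lt_trans _ _ (`|z| * n.+1%:R)); last by rewrite -ltr_pdivlMr.
  by rewrite ler_wpM2l// ler_nat.
have h1 := le_lt_trans (enorm_dist x y) (h _ hy).
rewrite distrC in hy; have h2 := le_lt_trans (enorm_dist y x) (h _ hy).
by rewrite ltr_norml; apply/andP; split; lra.
Qed.

(** The convex tangent inequality, used in both directions, is a local Lipschitz bound for t^g that
    remains valid at t = 0. *)
Lemma powR_comp_continuous (T : topologicalType) (f : T -> R) g : 1 < g ->
  (forall t, 0 <= f t) -> continuous f -> continuous (fun t => f t `^ g).
Proof.
move=> g1 f0 cf t; have g0 : 0 < g by rewrite (lt_trans _ g1).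
apply/(@cvgrPdist_lt _ _ _ (nbhs t)) => e e0.
set C := g * (f t + 1) `^ (g - 1).
have C0 : 0 < C by rewrite mulr_gt0 ?powR_gt0// ltr_wpDl.
have m0 : 0 < Num.min 1 (e / C) by rewrite lt_min ltr01 divr_gt0.
have : \forall t' \near t, `|f t - f t'| < Num.min 1 (e / C).
  by have /(@cvgrPdist_lt _ _ _ (nbhs t))/(_ _ m0) := cf t.
apply: filterS => t'; rewrite lt_min => /andP[h1 h2].
have key a b : 0 <= a -> 0 <= b -> a <= f t + 1 -> a `^ g - b `^ g <= C * `|a - b|.
  move=> a0 b0 ha; have h := powR_convex_tangent a0 b0 g1.
  have hg : a `^ (g - 1) <= (f t + 1) `^ (g - 1).
    by apply: ge0_ler_powR => //; rewrite ?nnegrE ?subr_ge0 ?(ltW g1)// addr_ge0.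
  have : g * a `^ (g - 1) * (a - b) <= C * `|a - b|.
    apply: (@le_trans _ _ (g * a `^ (g - 1) * `|a - b|)).
      by rewrite ler_wpM2l ?ler_norm// mulr_ge0 ?powR_ge0 ?(ltW g0).
    by rewrite ler_wpM2r// /C ler_pM2l.
  move: h; rewrite -(opprB a b) mulrN.
  by move: (g * _ * (a - b)) (C * _) (a `^ g) (b `^ g) => *; lra.
have ft' : f t' <= f t + 1 by move: h1; rewrite ltr_norml => /andP[]; lra.
have k1 := key _ _ (f0 t) (f0 t') (ler_wpDr ler01 (lexx _)).
have k2 := key _ _ (f0 t') (f0 t) ft'; rewrite distrC in k2.
have hC : C * `|f t - f t'| < e by rewrite mulrC -ltr_pdivlMr.
rewrite ltr_norml; move: k1 k2 hC; move: (f t `^ g) (f t' `^ g) (C * _) => *.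
by apply/andP; split; lra.
Qed.

Lemma sub_continuous : continuous (fun z : V * V => z.2 - z.1).
Proof.
by move=> z; apply: cvgB; [exact: cvg_snd|exact: cvg_fst].
Qed.

Lemma enorm_sub_continuous : continuous (fun z : V * V => enorm (z.2 - z.1)).
Proof.
by move=> z; exact: (continuous_comp (@sub_continuous z) (@enorm_continuous (z.2 - z.1))).
Qed.

Lemma power_cost_continuous g : 1 < g ->
  continuous (fun z : V * V => power_cost g z.1 z.2).
Proof.
move=> g1 z; have e0 (t : V * V) : 0 <= enorm (t.2 - t.1) by exact: enorm_ge0.
have h := powR_comp_continuous g1 e0 enorm_sub_continuous.
exact: continuousM (@cst_continuous _ _ _ z) (h z).
Qed.

Lemma measurable_power_cost g :
  measurable_fun setT (fun z : V * V => power_cost g z.1 z.2).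
Proof.
apply: measurable_funM => //.
apply: (measurableT_comp (measurable_powR g) (g := fun z : V * V => enorm (z.2 - z.1))).
apply: (measurableT_comp (measurable_continuous enorm_continuous)).
apply: measurable_fun_rV => i; under eq_fun do rewrite !mxE.
apply: measurable_funB.
  exact: measurableT_comp (measurable_coord i) measurable_snd.
exact: measurableT_comp (measurable_coord i) measurable_fst.
Qed.

Lemma power_cost_ge0 g x y : 0 < g -> 0 <= power_cost g x y.
Proof. by move=> g0; rewrite mulr_ge0 ?powR_ge0// invr_ge0 ltW. Qed.

(* The i-th component of the gradient of [|z| ^ g / g]. *)
Definition power_grad g z i : R := enorm z `^ (g - 2) * z 0 i.

Lemma enorm_powR g z : enorm z `^ g = dotp z z `^ (g / 2).
Proof.
rewrite -enorm_sqr -powR_mulrn ?enorm_ge0// -powRrM; congr (_ `^ _).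
by field.
Qed.

(** |z|^g is the power g/2 <= 1 of |z|^2: concavity in |z|^2 gives an upper tangent, and the
    increment of |z|^2 along an axis is exactly 2 s z_i + s^2. *)
Lemma power_semiconcave g z i s : 0 < g <= 2 -> enorm z != 0 ->
  g^-1 * enorm (z + s *: evec i) `^ g - g^-1 * enorm z `^ g <=
  s * power_grad g z i + s ^+ 2 / 2 * enorm z `^ (g - 2).
Proof.
move=> /andP[g0 g2] z0; rewrite -mulrBr.
have zp : 0 < dotp z z by rewrite -enorm_sqr exprn_gt0// lt_neqAle eq_sym z0 enorm_ge0.
have k01 : 0 < g / 2 <= 1 by rewrite divr_gt0//= ler_pdivrMr// mul1r.
have := powR_concave_tangent zp (dotp_ge0 (z + s *: evec i)) k01.
rewrite -!enorm_powR.
have -> : dotp z z `^ (g / 2 - 1) = enorm z `^ (g - 2).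
  by rewrite enorm_powR; congr (_ `^ _); field.
have -> : dotp (z + s *: evec i) (z + s *: evec i) - dotp z z = 2 * s * z 0 i + s ^+ 2.
  rewrite dotpDl dotpZl (dotpC z (_ + _)) (dotpC (evec i) (_ + _)) !dotpDl !dotpZl.
  by rewrite (dotpC (evec i) z) !dotp_evec evecE eqxx mulr1; ring.
rewrite /power_grad -lerBlDl.
move: (enorm (z + _) `^ g) (enorm z `^ g) (enorm z `^ (g - 2)) (z 0 i) => A B C t h.
rewrite ler_pdivrMl//; apply: (le_trans h).
by rewrite le_eqVlt; apply/orP; left; apply/eqP; field.
Qed.

(** Divide the inequality by |s| for small s of either sign: the cost is bounded above by its first
    order expansion, and the affine part is known up to [om]. *)
Lemma power_first_order g z i (A gam om s0 : R) : 1 < g <= 2 -> 0 < A -> 0 < s0 ->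
  (forall s, `|s| <= s0 -> 0 <= s * gam + `|s| * om +
    A * (g^-1 * enorm (z + s *: evec i) `^ g - g^-1 * enorm z `^ g)) ->
  `|gam + A * power_grad g z i| <= om.
Proof.
move=> /andP[g1 g2] A0 s00 h; have g0 : 0 < g by rewrite (lt_trans _ g1).
have key (sg : R) : `|sg| = 1 -> - om <= sg * (gam + A * power_grad g z i).
  move=> sg1; apply/ler_addgt0Pl => e e0.
  have sg2 : sg ^+ 2 = 1 by rewrite -real_normK ?num_real// sg1 expr1n.
  (* At z = 0 the quadratic upper bound does not apply; there the increment of the cost is |s|^g /
     g, which is o(s) since g > 1. *)
  have [z0|z0] := eqVneq (enorm z) 0.
    have -> : power_grad g z i = 0 by rewrite /power_grad (enorm_eq0 z0) mxE mulr0.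
    have e1 : 0 < e * g / A by rewrite !divr_gt0// mulr_gt0.
    (* This choice gives A s^(g-1) / g <= e, so the cost term is at most [e * s]. *)
    pose s := Num.min s0 ((e * g / A) `^ (g - 1)^-1).
    have s0' : 0 < s by rewrite lt_min s00 powR_gt0.
    have hs : s `^ (g - 1) <= e * g / A.
      apply: (@le_trans _ _ (((e * g / A) `^ (g - 1)^-1) `^ (g - 1))).
        apply: ge0_ler_powR; rewrite ?nnegrE ?powR_ge0 ?(ltW s0') ?subr_ge0 ?(ltW g1)//.
        by rewrite ge_min lexx orbT.
      by rewrite -powRrM mulVf ?powRr1 ?(ltW e1)// subr_eq0 gt_eqF.
    have := h (sg * s); rewrite normrM sg1 mul1r gtr0_norm// ge_min lexx => /(_ isT).
    rewrite z0 powR0 ?gt_eqF// mulr0 subr0 (enorm_eq0 z0) add0r enormZ normrM sg1 mul1r.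
    have -> : enorm (evec i : V) = 1 by rewrite /enorm dotp_evec evecE eqxx sqrtr1.
    rewrite gtr0_norm// mulr1 mulr0 addr0 => hh.
    have : A * (g^-1 * s `^ g) <= e * s.
      rewrite -(mulr_powRB1 (ltW s0') g0).
      have -> : A * (g^-1 * (s * s `^ (g - 1))) = s * (s `^ (g - 1) * (A / g)).
        by move: (s `^ (g - 1)) => X; ring.
      rewrite (mulrC e) ler_pM2l// -ler_pdivlMr ?divr_gt0//.
      by apply: (le_trans hs); rewrite invf_div mulrA.
    move: hh; move: (A * _) => Y hh hY.
    have : 0 <= s * (sg * gam + om + e).
      by move: hh hY; rewrite !mulrDr mulrA (mulrC s sg) (mulrC s e) => *; lra.
    by rewrite pmulr_rge0//; lra.
  have e1 : 0 < A * enorm z `^ (g - 2) / 2 + 1 by rewrite ltr_pwDr// divr_ge0 ?mulr_ge0 ?powR_ge0 ?(ltW A0).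
  (* Small enough for the quadratic remainder, divided by [s], to be at most [e]. *)
  pose s := Num.min s0 (e / (A * enorm z `^ (g - 2) / 2 + 1)).
  have s0' : 0 < s by rewrite lt_min s00 divr_gt0.
  have hs : s * (A * enorm z `^ (g - 2) / 2) <= e.
    apply: (@le_trans _ _ (s * (A * enorm z `^ (g - 2) / 2 + 1))).
      by rewrite ler_pM2l// lerDl.
    by rewrite -ler_pdivlMr// ge_min lexx orbT.
  have := h (sg * s); rewrite normrM sg1 mul1r gtr0_norm// ge_min lexx => /(_ isT).
  have g02 : 0 < g <= 2 by rewrite g0.
  have := power_semiconcave i (sg * s) g02 z0; rewrite exprMn sg2 mul1r.
  move=> /(ler_wpM2l (ltW A0)) h1 h2; have {h1 h2} := le_trans h2 (lerD (lexx _) h1).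
  move: (power_grad g z i) hs; move: (enorm z `^ (g - 2)) => N G hs.
  have -> : sg * s * gam + s * om + A * (sg * s * G + s ^+ 2 / 2 * N) =
    s * (sg * gam + om + A * (sg * G) + s * (A * N / 2)) by field.
  rewrite pmulr_rge0// => hh.
  by move: hh hs; move: (s * (A * N / 2)) => u; rewrite mulrDr (mulrCA sg A); lra.
have k1 := key 1 (normr1 _); have k2 := key (-1) (normrN1 _).
by rewrite ler_norml; apply/andP; split; lra.
Qed.

Lemma enorm_power_grad g z : 1 < g ->
  enorm (\row_i power_grad g z i) = enorm z `^ (g - 1).
Proof.
move=> g1; have -> : \row_i power_grad g z i = enorm z `^ (g - 2) *: z.
  by apply/rowP => i; rewrite !mxE.
rewrite enormZ ger0_norm ?powR_ge0// mulrC.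
have [z0|z0] := eqVneq (enorm z) 0.
  by rewrite z0 mul0r powR0// subr_eq0 gt_eqF.
rewrite -{1}[enorm z]powRr1 ?enorm_ge0// -powRD; last by rewrite z0 implybT.
by congr (_ `^ _); ring.
Qed.

(** If G is the gradient at z, then z = |z|^(2-g) G and |G| = |z|^(g-1). Hence z - z' = |z|^(2-g) (G
    - G') + (|z|^(2-g) - |z'|^(2-g)) G'; the last term is a difference of powers of |G| and |G'|
    times G', treated by [powR_sub_mul] with a = 1/(g-1). *)
Lemma power_grad_inj g z z' i (M : R) : 1 < g <= 2 -> enorm z <= M -> enorm z' <= M ->
  `|z 0 i - z' 0 i| <=
  M `^ (2 - g) * (1 + (g - 1)^-1) * \sum_(j < n) `|power_grad g z j - power_grad g z' j|.
Proof.
move=> g12; have /andP[g1 g2] := g12.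
wlog le : z z' / enorm z' <= enorm z => [wl|] zM zM'.
  have [h|/ltW h] := leP (enorm z') (enorm z); first exact: wl.
  rewrite distrC; apply: (le_trans (wl z' z h zM' zM)).
  by under eq_bigr do rewrite distrC.
set S := \sum_(j < n) _.
have M0 : 0 <= M by apply: le_trans zM; exact: enorm_ge0.
have zG (y : V) j : y 0 j = enorm y `^ (2 - g) * power_grad g y j.
  rewrite /power_grad mulrA.
  have [y0|y0] := eqVneq (enorm y) 0; first by rewrite (enorm_eq0 y0) mxE mulr0.
  by rewrite -powRD ?y0 ?implybT// addrA subrK subrr powRr0 mul1r.
have Si : `|power_grad g z i - power_grad g z' i| <= S.
  by rewrite /S (bigD1 i)//= lerDl sumr_ge0.
have pM : enorm z `^ (2 - g) <= M `^ (2 - g).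
  by apply: ge0_ler_powR; rewrite ?nnegrE ?enorm_ge0// subr_ge0.
set u := enorm z `^ (g - 1); set u' := enorm z' `^ (g - 1).
have uS : u - u' <= S.
  rewrite /u /u' -!enorm_power_grad//; apply: (le_trans (enorm_dist _ _)).
  apply: (le_trans (enorm_le_sum _)); rewrite le_eqVlt; apply/orP; left; apply/eqP.
  by apply: eq_bigr => j _; rewrite !mxE.
have u0 : 0 <= u by exact: powR_ge0.
have u0' : 0 <= u' by exact: powR_ge0.
have uu : u' <= u.
  by apply: ge0_ler_powR; rewrite ?nnegrE ?enorm_ge0 ?subr_ge0 ?(ltW g1).
have G' : `|power_grad g z' i| <= u'.
  rewrite /u' -enorm_power_grad//; apply: le_trans (coord_le_enorm _ i).
  by rewrite mxE.
have S0 : 0 <= S by exact: sumr_ge0.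
have ig : 0 < (g - 1)^-1 by rewrite invr_gt0 subr_gt0.
have key : (enorm z `^ (2 - g) - enorm z' `^ (2 - g)) * u' <=
    M `^ (2 - g) * (g - 1)^-1 * S.
  (* For g = 2 both weights are 1 and their difference vanishes, while [powR_sub_mul] requires a >
     1. *)
  have [->|gn2] := eqVneq g 2.
    rewrite subrr !powRr0 subrr mul0r mul1r mulr_ge0// invr_ge0; lra.
  have a1 : 1 < (g - 1)^-1 by rewrite invf_gt1 ?subr_gt0//; move: gn2 g2; rewrite lt_neqAle; lra.
  have e1 (y : V) : enorm y `^ (2 - g) = (enorm y `^ (g - 1)) `^ ((g - 1)^-1 - 1).
    rewrite -powRrM; congr (_ `^ _); field; rewrite subr_eq0 gt_eqF//.
  rewrite !e1; apply: (le_trans (powR_sub_mul a1 u0' uu)).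
  rewrite (mulrC (g - 1)^-1); apply: ler_pM => //.
  - by apply: mulr_ge0; [exact: powR_ge0|exact: ltW].
  - by rewrite subr_ge0.
  - by apply: ler_wpM2r; [exact: ltW|rewrite -e1].
rewrite (zG z i) (zG z' i).
have -> : enorm z `^ (2 - g) * power_grad g z i - enorm z' `^ (2 - g) * power_grad g z' i =
  enorm z `^ (2 - g) * (power_grad g z i - power_grad g z' i) +
  (enorm z `^ (2 - g) - enorm z' `^ (2 - g)) * power_grad g z' i by ring.
apply: (le_trans (ler_normD _ _)); rewrite [X in X + _]normrM [X in _ + X]normrM.
rewrite (ger0_norm (powR_ge0 (enorm z) _)).
have pos : 0 <= enorm z `^ (2 - g) - enorm z' `^ (2 - g).
  by rewrite subr_ge0; apply: ge0_ler_powR; rewrite ?nnegrE ?enorm_ge0// subr_ge0.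
rewrite (ger0_norm pos) (mulrDr (M `^ _)) mulr1 mulrDl; apply: lerD.
  by apply: ler_pM => //; exact: powR_ge0.
exact: (le_trans (ler_wpM2l pos G') key).
Qed.

End power_cost.

(** * Mass of the optimal control on small cubes *)

Section contact_cubes.
Context {R : realType} {n : nat}.
Local Notation V := 'rV[R]_n.
Local Notation mu := (lebesgue_rV R n).
Variables (w0 w1 : set V) (u0 m : {finite_measure set V -> \bar R}) (w : V -> R).
Variables (alpha g M : R).
Hypotheses (n0 : (0 < n)%N) (cw0 : compact w0) (cw1 : compact w1) (cw : continuous w).
Hypotheses (a0 : 0 < alpha) (g12 : 1 < g <= 2) (M0 : 0 <= M).
Hypothesis u0M : forall A, measurable A -> (u0 A <= M%:E * mu A)%E.
Let Phi (x y : V) : R := w y + alpha * power_cost g x y.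
Hypothesis mK : forall (K : set V) (e : R), compact K -> K `<=` w1 -> 0 < e ->
  (m K <= u0 (contact w0 w1 Phi e K))%E.

Let g1 : 1 < g. Proof. by case/andP: g12. Qed.

Let cPhi : continuous (fun z : V * V => Phi z.1 z.2).
Proof.
have cw2 : continuous (fun z : V * V => w z.2).
  move=> z U /(@cw z.2) nU; exists (setT, w @^-1` U) => /=.
    by split => //; exact: filterT.
  by move=> x [].
move=> z; have c1 : {for z, continuous (fun z : V * V => alpha * power_cost g z.1 z.2)}.
  exact: continuousM (@cst_continuous _ _ alpha z) (power_cost_continuous g1 (x := z)).
exact: continuousD (cw2 z) c1.
Qed.

(** The sets for e = 1/(k+1) decrease to the set for e = 0: for fixed x, Phi(x, .) attains its
    minimum on the compact set [K]. The finite measure [u0] is continuous along this sequence. *)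
Lemma contact0_le (K : set V) : compact K -> K `<=` w1 ->
  (m K <= u0 (contact w0 w1 Phi 0 K))%E.
Proof.
move=> cK Kw; pose F (k : nat) := contact w0 w1 Phi (k.+1%:R^-1) K.
have mF k : measurable (F k) by exact: (measurable_contact _ cw0 _ cPhi cK).
have capF : \bigcap_k F k = contact w0 w1 Phi 0 K.
  apply/seteqP; split => [x Fx|x [z [Wz h] zx] k _]; last first.
    by exists z => //; split => // y wy; rewrite (le_trans (h y wy))// lerD2l.
  have [[x' y0] [[/= wx Ky0] _] /= ex] := Fx 0%N I; rewrite ex {x' ex} in wx.
  have cx : continuous (fun y => Phi x y).
    move=> y U /(cPhi (x := (x, y)))[[X Y] /= [nX nY] XY]; apply: filterS nY => y' Yy'.
    by apply: (XY (x, y')); split => //=; exact: nbhs_singleton nX.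
  have Kn0 : K !=set0 by exists y0.
  have [y yK hy] := compact_EVT_min Kn0 cK (continuous_subspaceT cx).
  exists (x, y) => //; split; first by split => //=; exact: set_mem.
  move=> y' wy' /=; rewrite addr0; apply/ler_addgt0Pl => e e0.
  have [k _ /(_ k (leqnn k)) hk] : \forall j \near \oo, (j.+1%:R^-1 : R) < e.
    exact: near_infty_natSinv_lt (PosNum e0).
  have [[x'' y''] [[/= _ Ky''] h] /= ex] := Fx k I; rewrite ex in h.
  have := h y' wy'; have := hy y'' (mem_set Ky''); rewrite /= ?ex.
  move=> b1 b2; apply: (le_trans b1); apply: (le_trans b2).
  by rewrite (addrC e) lerD2l ltW.
have nF : {homo F : i j / (i <= j)%N >-> (j <= i)%O}.
  move=> i j ij; apply/subsetPset => x [z [Wz h] zx]; exists z => //; split => // y wy.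
  by rewrite (le_trans (h y wy))// lerD2l lef_pV2 ?posrE// ler_nat.
have lim : (u0 \o F) x @[x --> \oo] --> u0 (contact w0 w1 Phi 0 K).
  rewrite -capF; apply: nonincreasing_cvg_mu => //.
    by rewrite -ge0_fin_numE//; exact: fin_num_measure.
  by rewrite capF; exact: (measurable_contact _ cw0 _ cPhi cK).
rewrite -(cvg_lim _ lim)//; apply: lime_ge; first by apply/cvg_ex; eexists; exact: lim.
by near=> k; exact: mK.
Unshelve. all: by end_near.
Qed.

(** All minimizers in [K] satisfy the first order condition with the same slopes [gam], so two
    gradients of the cost differ by at most 2 om / alpha per coordinate. Inverting the gradient
    bounds the difference of the vectors xi - x, and the xi differ by at most [l]. The final [+ 1]
    makes the constant positive. *)
Lemma contact_spread : exists2 C : R, 0 < C &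
  forall (K : set V) (l om s0 : R) (x x' : V), 0 < s0 -> 0 <= om -> K `<=` w1 ->
  (forall y y' i, K y -> K y' -> `|y 0 i - y' 0 i| <= l) ->
  (forall y i s, K y -> `|s| <= s0 -> w1 (y + s *: evec i)) ->
  (forall i, exists gam : R, forall y s, K y -> `|s| <= s0 ->
    `|w (y + s *: evec i) - w y - s * gam| <= `|s| * om) ->
  contact w0 w1 Phi 0 K x -> contact w0 w1 Phi 0 K x' ->
  forall i, `|x 0 i - x' 0 i| <= l + C * om.
Proof.
have [B hB] : exists B, forall z, (w0 `*` w1) z -> enorm (z.2 - z.1) <= B.
  have cW : compact (w0 `*` w1) by exact: compact_setX.
  have /compact_bounded[B [_ hB]] :=
    continuous_compact (continuous_subspaceT enorm_sub_continuous) cW.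
  exists (`|B| + 1) => z Wz; apply: (le_trans (ler_norm _)); apply: (hB (`|B| + 1)).
    by rewrite (le_lt_trans (ler_norm _))// ltrDl.
  by exists z.
have B0 : 0 <= `|B| by [].
set L := `|B| `^ (2 - g) * (1 + (g - 1)^-1).
have L0 : 0 <= L by rewrite mulr_ge0 ?powR_ge0// addr_ge0// invr_ge0 subr_ge0 ltW.
have ia : 0 <= alpha^-1 by rewrite invr_ge0 ltW.
exists (L * (2 / alpha * n%:R) + 1); first by rewrite ltr_wpDl//; apply: mulr_ge0 => //; rewrite !mulr_ge0.
move=> K l om s0 x x' s00 om0 Kw Kl Ks aff cx cx' i.
have /choice[gam hgam] := aff.
have P y : contact w0 w1 Phi 0 K y -> exists xi, [/\ K xi, enorm (xi - y) <= `|B| &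
    forall j, `|gam j + alpha * power_grad g (xi - y) j| <= om].
  move=> [[y1 xi] [[/= wy Kxi] h] /= ey]; rewrite {y1}ey in wy h.
  exists xi; split => //.
    by apply: (le_trans (hB (y, xi) _)); [split => //=; exact: Kw|exact: ler_norm].
  move=> j; apply: (power_first_order g12 a0 s00) => s ss0.
  have := h _ (Ks xi j s Kxi ss0); rewrite /Phi /power_cost /= addr0.
  rewrite -addrA (addrC (s *: _)) addrA.
  have := hgam j xi s Kxi ss0; rewrite ler_norml => /andP[_].
  rewrite mulrBr.
  have aux (a b c d e f : R) : a - b - c <= d -> b + e <= a + f -> 0 <= c + d + (f - e).
    by move=> *; lra.
  exact: aux.
have [xi [Kxi nxi hxi]] := P x cx; have [xi' [Kxi' nxi' hxi']] := P x' cx'.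
have := power_grad_inj i g12 nxi nxi'; rewrite -/L => h.
have hs : \sum_(j < n) `|power_grad g (xi - x) j - power_grad g (xi' - x') j| <=
    2 / alpha * n%:R * om.
  apply: (@le_trans _ _ (\sum_(j < n) (2 / alpha * om))).
    apply: ler_sum => j _; have h1 := hxi j; have h2 := hxi' j.
    rewrite -(ler_pM2l a0) -{1}(gtr0_norm a0) -normrM.
    have -> : alpha * (2 / alpha * om) = om + om by field; rewrite gt_eqF.
    have -> : alpha * (power_grad g (xi - x) j - power_grad g (xi' - x') j) =
      (gam j + alpha * power_grad g (xi - x) j) - (gam j + alpha * power_grad g (xi' - x') j).
      by rewrite mulrBr; ring.
    by apply: (le_trans (ler_normB _ _)); exact: lerD.
  by rewrite sumr_const card_ord -mulr_natr le_eqVlt; apply/orP; left; apply/eqP; ring.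
have {}h := le_trans h (ler_wpM2l L0 hs).
have -> : x 0 i - x' 0 i = (xi 0 i - xi' 0 i) - ((xi - x) 0 i - (xi' - x') 0 i).
  by rewrite !mxE; ring.
apply: (le_trans (ler_normB _ _)); apply: lerD; first exact: Kl.
apply: (le_trans h).
have -> : (L * (2 / alpha * n%:R) + 1) * om = L * (2 / alpha * n%:R * om) + om.
  by move: (L) (2 / alpha * n%:R) => x1 x2; ring.
by rewrite lerDl.
Qed.

(** The margin [t] lets a minimizer of the small cube move along the axes inside [w1], and Morrey's
    estimate is taken on the enlarged cube. The bounded density of [u0] then converts the extent of
    the contact set into mass. *)
Lemma contact_cube_le : forall s : R, n%:R < s -> exists2 C : R, 0 < C &
  forall (D : set V) (f : 'I_n -> V -> R) (h : 'I_n -> 'I_n -> V -> R) (a : V) (l t I : R),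
  open D -> D `<=` w1 -> (forall i, weak_partial D [:: i] w (f i)) ->
  (forall i j, weak_partial D [:: j] (f i) (h i j)) -> 0 < l -> 0 < t -> 0 < I ->
  ccube (a - const_mx t) (l + 2 * t) `<=` D ->
  (forall i j, (\int[mu]_(y in ccube (a - const_mx t) (l + 2 * t))
     (`|h i j y| `^ s)%:E <= I%:E)%E) ->
  (m (ccube a l) <=
    (M * (C * (l + 2 * t + I `^ s^-1 * (l + 2 * t) `^ (1 - n%:R / s))) ^+ n)%:E)%E.
Proof.
move=> s ns; have [Cm Cm0 morrey] := morrey_affine n0 ns; have [C C0 spread] := contact_spread.
exists (2 * (1 + C * Cm)); first by rewrite mulr_gt0// addr_gt0// mulr_gt0.
move=> D f h a l t I oD Dw wf wh l0 t0 I0 QD hI.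
set l' := l + 2 * t; set a' := a - const_mx t.
have l'0 : 0 < l' by rewrite addr_gt0// mulr_gt0.
have QQ : ccube a l `<=` ccube a' l'.
  move=> y yQ i; have := yQ i; rewrite /= !in_itv/= /a' /l' !mxE => /andP[y1 y2].
  by apply/andP; split; lra.
have Qs y i s' : ccube a l y -> `|s'| <= t -> ccube a' l' (y + s' *: evec i).
  move=> yQ st j; have := yQ j; rewrite /= !in_itv/= /a' /l' !mxE => /andP[y1 y2].
  move: st; rewrite ler_norml => /andP[s1 s2].
  rewrite eqxx /=; case: (j == i) => /=; rewrite ?mulr1 ?mulr0; apply/andP; split; lra.
set om := Cm * I `^ s^-1 * l' `^ (1 - n%:R / s).
have om0 : 0 <= om by rewrite !mulr_ge0 ?powR_ge0 ?(ltW Cm0).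
have Kw : ccube a l `<=` w1 by apply: subset_trans QQ (subset_trans QD Dw).
have Kl y y' i : ccube a l y -> ccube a l y' -> `|y 0 i - y' 0 i| <= l.
  move=> /(_ i) + /(_ i); rewrite /= !in_itv/= => /andP[y1 y2] /andP[y3 y4].
  by rewrite ler_norml; apply/andP; split; lra.
have Ks y i s' : ccube a l y -> `|s'| <= t -> w1 (y + s' *: evec i).
  by move=> yQ st; apply: Dw; apply: QD; exact: Qs.
have aff i : exists gam : R, forall y s', ccube a l y -> `|s'| <= t ->
    `|w (y + s' *: evec i) - w y - s' * gam| <= `|s'| * om.
  have [gam hgam] := morrey D w f h a' l' I oD cw wf wh l'0 QD I0 hI i.
  by exists gam => y s' yQ st; apply: hgam; [exact: QQ|exact: Qs].
have cc := spread (ccube a l) l om t _ _ t0 om0 Kw Kl Ks aff.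
have XX := contact0_le (K := ccube a l) (@compact_ccube _ _ _ _) Kw.
apply: (le_trans XX).
set A := contact _ _ _ _ _; set L := l + C * om.
have L0 : 0 < L by rewrite ltr_pwDl// mulr_ge0// ltW.
have X : 0 <= I `^ s^-1 * l' `^ (1 - n%:R / s) by rewrite mulr_ge0 ?powR_ge0.
have LE : 2 * L <= 2 * (1 + C * Cm) * (l' + I `^ s^-1 * l' `^ (1 - n%:R / s)).
  have aux (x c y z : R) : 0 <= c -> 0 <= y -> x <= z -> 0 <= z ->
      x + c * y <= (1 + c) * (z + y).
    move=> c0 y0 xz z0; have := mulr_ge0 c0 z0.
    by rewrite mulrDl mul1r mulrDr; move: (c * y) (c * z) => *; lra.
  have omE : C * om = C * Cm * (I `^ s^-1 * l' `^ (1 - n%:R / s)) by rewrite /om !mulrA.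
  rewrite -mulrA ler_pM2l// /L omE; apply: aux => //.
  - by rewrite mulr_ge0 ?(ltW C0) ?(ltW Cm0).
  - by rewrite lerDl mulr_ge0// ltW.
  - exact: ltW.
have [[x Ax]|A0] := pselect (A !=set0); last first.
  have -> : A = set0 by apply: contrapT => /eqP/set0P.
  by rewrite measure0 lee_fin mulr_ge0// exprn_ge0// !mulr_ge0// addr_ge0// ?mulr_ge0 ?(ltW C0) ?(ltW Cm0) ?(ltW l'0).
(* A set whose coordinates vary by at most [L] lies in the cube of side [2 * L] centred at any of
   its points. *)
have AQ : A `<=` ccube (x - const_mx L) (2 * L).
  move=> y Ay i; have := cc _ _ Ax Ay i; rewrite -/L /= in_itv/= !mxE ler_norml => /andP[h1 h2].
  by apply/andP; split; lra.
have mA : measurable A by exact: (measurable_contact _ cw0 _ cPhi (@compact_ccube _ _ _ _)).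
apply: (le_trans (u0M mA)); rewrite EFinM; apply: lee_wpmul2l; first by rewrite lee_fin.
have mQ : measurable (ccube (x - const_mx L) (2 * L)) by exact: measurable_rV_box.
apply: (@le_trans _ _ (mu (ccube (x - const_mx L) (2 * L)))).
  by apply: le_measure; rewrite ?inE.
rewrite lebesgue_ccube ?mulr_ge0 ?(ltW L0)// lee_fin.
have L2 : 0 <= 2 * L by rewrite mulr_ge0// ltW.
apply: lerXn2r (LE); rewrite nnegrE; [exact: L2|exact: le_trans L2 LE].
Qed.

End contact_cubes.

(** * From cubes to Borel sets *)

Section borel_bound.
Context {R : realType} {n : nat}.
Local Notation V := 'rV[R]_n.
Local Notation mu := (lebesgue_rV R n).
Implicit Types (D A : set V) (H : V -> R) (a : V) (l t b s I : R).

(* Weighted AM-GM, in the form obtained by comparing [I] with [b ^ s * l ^ n]. *)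
Lemma morrey_interpolation b l I s : (0 < n)%N -> n%:R < s -> 1 <= b -> 0 < l -> 0 < I ->
  (l + I `^ s^-1 * l `^ (1 - n%:R / s)) ^+ n <=
  2 ^+ n * (b ^+ n * l ^+ n + b `^ (n%:R - s) * I).
Proof.
move=> n0 ns b1 l0 I0; have s0 : 0 < s by rewrite (le_lt_trans _ ns).
have b0 : 0 < b by rewrite (lt_le_trans _ b1).
set Y := I `^ s^-1 * l `^ (1 - n%:R / s).
have Y0 : 0 <= Y by rewrite mulr_ge0 ?powR_ge0.
have bs : 0 < b `^ s by rewrite powR_gt0.
have k0 : 0 <= 1 - n%:R / s by rewrite subr_ge0 ler_pdivrMr// mul1r ltW.
have mx (c z : R) : 0 <= z -> l <= z -> Y <= z -> z ^+ n <= c ->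
    (l + Y) ^+ n <= 2 ^+ n * c.
  move=> z0 lz Yz zc; apply: (@le_trans _ _ ((2 * z) ^+ n)).
    apply: lerXn2r; rewrite ?nnegrE ?addr_ge0 ?(ltW l0)// ?mulr_ge0//.
    by rewrite mulrDl !mul1r lerD.
  by rewrite exprMn ler_pM2l// exprn_gt0.
have t1 : 0 <= b ^+ n * l ^+ n by rewrite mulr_ge0// exprn_ge0// ltW.
have t2 : 0 <= b `^ (n%:R - s) * I by rewrite mulr_ge0 ?powR_ge0// ltW.
(* If I <= b^s l^n, both summands are at most b l; otherwise both are at most the n-th root of
   b^(n-s) I. *)
have [h|h] := leP I (b `^ s * l ^+ n).
  apply: (mx _ (b * l)); rewrite ?mulr_ge0 ?(ltW b0) ?(ltW l0)//.
  - by rewrite ler_peMl// ltW.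
  - rewrite /Y; apply: (@le_trans _ _ ((b `^ s * l ^+ n) `^ s^-1 * l `^ (1 - n%:R / s))).
      rewrite ler_wpM2r ?powR_ge0//; apply: ge0_ler_powR => //.
      + by rewrite invr_ge0 ltW.
      + by rewrite nnegrE ltW.
      + by rewrite nnegrE mulr_ge0 ?powR_ge0// exprn_ge0// ltW.
    rewrite powRM ?powR_ge0 ?exprn_ge0 ?(ltW l0)// -powRrM divff ?gt_eqF// powRr1 ?(ltW b0)//.
    rewrite -powR_mulrn ?(ltW l0)// -powRrM -mulrA -powRD; last by rewrite (gt_eqF l0) implybT.
    by rewrite addrC subrK powRr1// ltW.
  - by rewrite exprMn lerDl.
have Z0 : 0 <= I * b `^ (- s) by rewrite mulr_ge0 ?powR_ge0// ltW.
have ln : l ^+ n <= I * b `^ (- s).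
  by rewrite powRN ler_pdivlMr// mulrC ltW.
have key : (l + Y) ^+ n <= 2 ^+ n * (b `^ (n%:R - s) * I).
  have n0' : 0 < n%:R :> R by rewrite ltr0n.
  have Q0 : 0 <= b `^ (n%:R - s) * I by [].
  have E : ((b `^ (n%:R - s) * I) `^ n%:R^-1) ^+ n = b `^ (n%:R - s) * I.
    by rewrite -powR_mulrn ?powR_ge0// -powRrM mulVf ?gt_eqF// powRr1.
  have Ix (x : R) : 0 <= x -> x ^+ n <= b `^ (n%:R - s) * I ->
      x <= (b `^ (n%:R - s) * I) `^ n%:R^-1.
    by move=> x0; rewrite -{1}E ler_pXn2r// nnegrE powR_ge0.
  apply: (mx _ ((b `^ (n%:R - s) * I) `^ n%:R^-1)); rewrite ?powR_ge0 ?E//.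
    apply: Ix; first exact: ltW.
    apply: (le_trans ln); rewrite mulrC ler_wpM2r ?(ltW I0)//.
    by rewrite ler_powR// lerDr ler0n.
  apply: Ix => //; rewrite /Y exprMn -!powR_mulrn ?powR_ge0// -!powRrM.
  have -> : (1 - n%:R / s) * n%:R = n%:R * (1 - n%:R / s) by rewrite mulrC.
  rewrite [l `^ _]powRrM powR_mulrn ?(ltW l0)//.
  apply: (@le_trans _ _ (I `^ (s^-1 * n%:R) * (I * b `^ (- s)) `^ (1 - n%:R / s))).
    rewrite ler_wpM2l ?powR_ge0//; apply: ge0_ler_powR => //.
    by rewrite nnegrE exprn_ge0// ltW.
  rewrite powRM ?powR_ge0 ?(ltW I0)// mulrA -powRD; last by rewrite (gt_eqF I0) implybT.
  have -> : s^-1 * n%:R + (1 - n%:R / s) = 1 by rewrite mulrC addrC subrK.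
  rewrite powRr1 ?(ltW I0)// -powRrM mulrC.
  have -> : - s * (1 - n%:R / s) = n%:R - s by field; rewrite gt_eqF.
  by [].
apply: (le_trans key); rewrite ler_pM2l ?exprn_gt0//.
by rewrite lerDr.
Qed.

(** Compactness of the cube makes the distance to the complement of [D] uniform; a point of the
    enlarged cube is then compared with its nearest point in the cube. *)
Lemma ccube_enlarge D a l : open D -> 0 < l -> ccube a l `<=` D ->
  \forall t \near 0^'+, ccube (a - const_mx t) (l + 2 * t) `<=` D.
Proof.
move=> oD l0 aD.
have /compact_near_coveringP/(_ R 0^'+
  (fun t y => forall z, ccube (z - const_mx t) (2 * t) y -> D z)) := @compact_ccube R n a l.
move=> h; have {}h : \forall t \near 0^'+,
    ccube a l `<=` [set y | forall z, ccube (z - const_mx t) (2 * t) y -> D z].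
  apply: h => y yQ; have Dy := aD y yQ.
  have /nbhs_ballP[e /= e0 he] : nbhs y D by exact: open_nbhs_nbhs.
  have e2 : 0 < e / 2 by rewrite divr_gt0.
  exists (ball y (e / 2), [set t | t < e / 2]) => /=.
    by split; [exact: nbhsx_ballx|exact: nbhs_right_lt].
  move=> [y' t] /= [yy' te] z zy; apply: he; apply/ball_rV => // i.
  have := (ball_rV _ _ e2).1 yy' i; have := zy i.
  rewrite /= in_itv/= !mxE => /andP[z1 z2]; rewrite !ltr_norml => /andP[y1 y2].
  by apply/andP; split; lra.
have t0 : \forall t \near (0 : R)^'+, 0 < t by exact: nbhs_right_gt.
apply: filterS2 h t0 => t ht t0 z zQ.
(* Projection of [z] onto the cube, obtained by clamping each coordinate. *)
pose y : V := \row_i Num.max (a 0 i) (Num.min (z 0 i) (a 0 i + l)).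
have yQ : ccube a l y.
  move=> i; rewrite /= in_itv/= mxE le_max lexx/= ge_max lerDl (ltW l0)/=.
  by rewrite ge_min lexx orbT.
apply: (ht y yQ) => i; have := zQ i; rewrite /= !in_itv/= !mxE => /andP[z1 z2].
case: (leP (z 0 i) (a 0 i + l)) => h1.
  by case: (leP (a 0 i) (z 0 i)) => h2; apply/andP; split; lra.
by case: (leP (a 0 i) (a 0 i + l)) => h2; apply/andP; split; lra.
Qed.

End borel_bound.

Section cube_to_borel.
Context {R : realType} {n : nat}.
Local Notation V := 'rV[R]_n.
Local Notation mu := (lebesgue_rV R n).
Variables (m : {finite_measure set V -> \bar R}) (D : set V) (H : V -> R) (s M C : R).
Hypotheses (n0 : (0 < n)%N) (ns : n%:R < s) (oD : open D) (fD : (mu D < +oo)%E).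
Hypotheses (mH : measurable_fun D H) (H1 : forall x, 1 <= H x) (M0 : 0 <= M) (C0 : 0 <= C).
Hypothesis HI : (\int[mu]_(x in D) (H x `^ s)%:E < +oo)%E.
Hypothesis cube_le : forall (a : V) (l t I : R), 0 < l -> 0 < t -> 0 < I ->
  ccube (a - const_mx t) (l + 2 * t) `<=` D ->
  (\int[mu]_(y in ccube (a - const_mx t) (l + 2 * t)) (H y `^ s)%:E <= I%:E)%E ->
  (m (ccube a l) <=
    (M * (C * (l + 2 * t + I `^ s^-1 * (l + 2 * t) `^ (1 - n%:R / s))) ^+ n)%:E)%E.

Let mD : measurable D. Proof. exact: measurable_openV. Qed.

Let s0 : 0 < s. Proof. by rewrite (le_lt_trans _ ns). Qed.

(** The right-hand side is a finite measure [nu]. The comparison with an enlarged cube passes to the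
    closed cube by continuity from above, to the half-open cube by continuity from below, and then
    to Borel sets. *)
Lemma borel_le_density (b : R) (A : set V) : 1 <= b -> measurable A -> A `<=` D ->
  (m A <= \int[mu]_(x in A)
    (M * (2 * C) ^+ n * (b ^+ n + b `^ (n%:R - s) * H x `^ s))%:E)%E.
Proof.
move=> b1 mA AD; have b0 : 0 < b by rewrite (lt_le_trans _ b1).
(* [C ^+ n] comes from the estimate on cubes, [2 ^+ n] from [morrey_interpolation]. *)
set K := M * (2 * C) ^+ n.
have K0 : 0 <= K by rewrite mulr_ge0// exprn_ge0// mulr_ge0.
pose F x := K * (b ^+ n + b `^ (n%:R - s) * H x `^ s).
have F0 x : 0 <= F x by rewrite mulr_ge0// addr_ge0 ?mulr_ge0 ?powR_ge0// exprn_ge0// ltW.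
have mHs : measurable_fun D (fun x => H x `^ s).
  exact: measurableT_comp (measurable_powR s) mH.
have mF : measurable_fun D F.
  apply: measurable_funM; first exact: measurable_cst.
  apply: measurable_funD; first exact: measurable_cst.
  by apply: measurable_funM => //; exact: measurable_cst.
have mFD : measurable_fun setT (EFin \o F \_ D).
  by apply/measurable_EFinP; exact/(measurable_restrictT F mD).
have FD0 x : (0 <= (EFin \o F \_ D) x)%E.
  by rewrite /= restrictE; case: ifP => // _; rewrite lee_fin.
have [nu nuE] := @density_measureP _ _ _ mu _ mFD FD0.
have nuI B : measurable B -> B `<=` D -> nu B = (\int[mu]_(x in B) (F x)%:E)%E.
  move=> mB BD; rewrite nuE; apply: eq_integral => x /set_mem Bx.
  by rewrite /= restrictE mem_set//; exact: BD.
have split_int B : measurable B -> B `<=` D -> (\int[mu]_(x in B) (F x)%:E =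
    K%:E * ((b ^+ n)%:E * mu B + (b `^ (n%:R - s))%:E * \int[mu]_(x in B) (H x `^ s)%:E))%E.
  move=> mB BD; have mHB := measurable_funS mD BD mHs.
  rewrite -ge0_integralZl//; first last.
  - by rewrite lee_fin powR_ge0.
  - by move=> x _; rewrite lee_fin powR_ge0.
  - exact/measurable_EFinP.
  rewrite -(integral_cst mu mB) -ge0_integralD//; first last.
  - by apply/measurable_EFinP; apply: measurable_funM => //; exact: measurable_cst.
  - by move=> x _; rewrite -EFinM lee_fin mulr_ge0 ?powR_ge0.
  - by move=> x _; rewrite lee_fin exprn_ge0// ltW.
  rewrite -ge0_integralZl//; first last.
  - move=> x _; rewrite -EFinM -EFinD lee_fin addr_ge0 ?mulr_ge0 ?powR_ge0//.
    by rewrite exprn_ge0// ltW.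
  - apply/measurable_EFinP; apply: measurable_funD; first exact: measurable_cst.
    by apply: measurable_funM => //; exact: measurable_cst.
have fin_int B : measurable B -> B `<=` D -> (\int[mu]_(x in B) (H x `^ s)%:E < +oo)%E.
  move=> mB BD; apply: le_lt_trans HI; apply: ge0_subset_integral => //.
    exact/measurable_EFinP.
  by move=> x _; rewrite lee_fin powR_ge0.
have nuD : (nu D < +oo)%E.
  rewrite nuI// split_int// lte_mul_pinfty ?lee_fin//.
  have h1 := fin_int D mD (@subset_refl _ D).
  rewrite lte_add_pinfty// lte_mul_pinfty ?lee_fin ?exprn_ge0 ?powR_ge0 ?(ltW b0)//.
have enl (a : V) l t : 0 < l -> 0 < t -> ccube (a - const_mx t) (l + 2 * t) `<=` D ->
    (m (ccube a l) <= nu (ccube (a - const_mx t) (l + 2 * t)))%E.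
  move=> l0 t0 QD; set Q := ccube (a - const_mx t) (l + 2 * t).
  have l'0 : 0 < l + 2 * t by rewrite addr_gt0// mulr_gt0.
  have mQ : measurable Q by exact: measurable_rV_box.
  have iQ := fin_int Q mQ QD.
  set I := fine (\int[mu]_(y in Q) (H y `^ s)%:E).
  have muQ : mu Q = ((l + 2 * t) ^+ n)%:E by rewrite lebesgue_ccube// ltW.
  (* Since H >= 1 the integral is at least the volume of the cube, hence a positive and admissible
     value for [I]. *)
  have iQ0 : (((l + 2 * t) ^+ n)%:E <= \int[mu]_(y in Q) (H y `^ s)%:E)%E.
    rewrite -muQ -[X in (X <= _)%E]mul1e -integral_cst//; apply: ge0_le_integral => //.
      by apply/measurable_EFinP; exact: measurable_funS mD QD mHs.
    move=> x _; rewrite lee_fin; have -> : 1 = 1 `^ s :> R by rewrite powR1.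
    by apply: ge0_ler_powR; rewrite ?nnegrE ?(ltW s0)//; exact: le_trans (H1 x).
  have IE : (\int[mu]_(y in Q) (H y `^ s)%:E = I%:E)%E.
    rewrite fineK// ge0_fin_numE//; apply: integral_ge0 => y _.
    by rewrite lee_fin powR_ge0.
  have I0 : 0 < I by rewrite -lte_fin -IE (lt_le_trans _ iQ0)// lte_fin exprn_gt0.
  apply: (le_trans (cube_le l0 t0 I0 QD _)); first by rewrite -IE.
  rewrite (nuI Q mQ QD) (split_int Q mQ QD) IE muQ.
  have := morrey_interpolation n0 ns b1 l'0 I0.
  set Y := _ + _; set Z := _ + _ => YZ.
  have : M * (C * Y) ^+ n <= K * Z.
    rewrite /K !exprMn (mulrC (2 ^+ n)) -!mulrA ler_wpM2l// ler_wpM2l//.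
    exact: exprn_ge0.
  by rewrite -lee_fin.
have closed_le (a : V) l : 0 < l -> ccube a l `<=` D -> (m (ccube a l) <= nu (ccube a l))%E.
  move=> l0 QD.
  have h := ccube_enlarge oD l0 QD.
  have [t t0 tQ] : exists2 t : R, 0 < t & forall t', 0 < t' <= t ->
      ccube (a - const_mx t') (l + 2 * t') `<=` D.
    move: h; rewrite near_withinE => /nbhs_ballP[e /= e0 he].
    exists (e / 2); first by rewrite divr_gt0.
    move=> t' /andP[t'0 t'e]; apply: he => //.
    by rewrite /ball/= sub0r normrN gtr0_norm//; lra.
  pose tk (k : nat) := t / k.+1%:R.
  have tk0 k : 0 < tk k by rewrite divr_gt0.
  have tkt k : tk k <= t by rewrite ler_pdivrMr// ler_peMr ?ler1n// ltW.
  pose Fk k := ccube (a - const_mx (tk k)) (l + 2 * tk k).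
  have mFk k : measurable (Fk k) by exact: measurable_rV_box.
  have FkD k : Fk k `<=` D by apply: tQ; rewrite tk0 tkt.
  have capF : \bigcap_k Fk k = ccube a l.
    apply/seteqP; split => [x Fx i|x xQ k _ i]; last first.
      have := xQ i; have := tk0 k; rewrite /= !in_itv/= !mxE => t1 /andP[x1 x2].
      by apply/andP; split; lra.
    have small e : 0 < e -> exists k, tk k < e.
      move=> e0; have e1 : 0 < e / t by rewrite divr_gt0.
      have [k _ /(_ k (leqnn k)) hk] : \forall j \near \oo, (j.+1%:R^-1 : R) < e / t.
        exact: near_infty_natSinv_lt (PosNum e1).
      by exists k; rewrite /tk mulrC -ltr_pdivlMr.
    rewrite /= in_itv/=; apply/andP; split; apply/ler_addgt0Pl => e /small[k te].
      have := Fx k I i; rewrite /= in_itv/= !mxE => /andP[x1 x2].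
      by move: x1 x2 te; move: (tk k) => *; lra.
    have := Fx k I i; rewrite /= in_itv/= !mxE => /andP[x1 x2].
    by move: x1 x2 te; move: (tk k) => *; lra.
  have nF : {homo Fk : i j / (i <= j)%N >-> (j <= i)%O}.
    move=> i j ij; have tt : tk j <= tk i.
      by rewrite /tk ler_pM2l// lef_pV2 ?posrE// ler_nat.
    apply/subsetPset => x xQ k; have := xQ k; rewrite /= !in_itv/= !mxE => /andP[x1 x2].
    by move: tt x1 x2; move: (tk i) (tk j) => *; apply/andP; split; lra.
  have lim : (nu \o Fk) x @[x --> \oo] --> nu (ccube a l).
    rewrite -capF; apply: nonincreasing_cvg_mu => //.
      by apply: le_lt_trans nuD; apply: le_measure; rewrite ?inE.
    by rewrite capF; exact: measurable_rV_box.
  rewrite -(cvg_lim _ lim)//; apply: lime_ge; first by apply/cvg_ex; eexists; exact: lim.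
  by apply: nearW => k; exact: (enl a l (tk k) l0 (tk0 k) (FkD k)).
have half_le (a : V) l : 0 < l -> ccube a l `<=` D -> (m (hcube a l) <= nu (hcube a l))%E.
  (* With k+2 in the denominator the first cube already has a positive side. *)
  move=> l0 QD; pose lk (k : nat) := l - l / k.+2%:R.
  have lk0 k : 0 < lk k.
    by rewrite subr_gt0 ltr_pdivrMr// ltr_pMr// ltr1n.
  have lkl k : lk k < l by rewrite ltrBlDr ltrDl divr_gt0.
  pose Fk k := ccube a (lk k).
  have mFk k : measurable (Fk k) by exact: measurable_rV_box.
  have FkQ k : Fk k `<=` ccube a l.
    move=> x xQ i; have := xQ i; have := lkl k; rewrite /= !in_itv/= => t1 /andP[x1 x2].
    by apply/andP; split; lra.
  have cupF : \bigcup_k Fk k = hcube a l.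
    apply/seteqP; split => [x [k _ xQ] i|x xQ].
      by have := xQ i; have := lkl k; rewrite /= in_itv/= => t1 /andP[x1 x2]; apply/andP; split; lra.
    have near i : \forall k \near \oo, x 0 i <= a 0 i + lk k.
      have e0 : 0 < (a 0 i + l - x 0 i) / l.
        by have /andP[_ x2] := xQ i; rewrite divr_gt0// subr_gt0.
      have : \forall j \near \oo, (j.+1%:R^-1 : R) < (a 0 i + l - x 0 i) / l.
        exact: near_infty_natSinv_lt (PosNum e0).
      apply: filterS => k; rewrite ltr_pdivlMr// mulrC => hk.
      have : l / k.+2%:R <= l / k.+1%:R by rewrite ler_pM2l// lef_pV2 ?posrE// ler_nat.
      by rewrite /lk; move: hk; move: (l / k.+1%:R) (l / k.+2%:R) => *; lra.
    have [k _ /(_ k (leqnn k)) hk] := filter_forall _ near.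
    exists k => // i; rewrite /= in_itv/= hk andbT.
    by have /andP[] := xQ i.
  have nF : {homo Fk : i j / (i <= j)%N >-> (i <= j)%O}.
    move=> i j ij; have tt : lk i <= lk j.
      by rewrite /lk lerD2l lerN2 ler_pM2l// lef_pV2 ?posrE// ler_nat.
    apply/subsetPset => x xQ k; have := xQ k; rewrite /= !in_itv/= => /andP[x1 x2].
    by move: tt x1 x2; move: (lk i) (lk j) => *; apply/andP; split; lra.
  have mh : measurable (hcube a l) by exact: measurable_hcube.
  have lim : (m \o Fk) x @[x --> \oo] --> m (hcube a l).
    by rewrite -cupF; apply: nondecreasing_cvg_mu => //; rewrite cupF.
  rewrite -(cvg_lim _ lim)//; apply: lime_le; first by apply/cvg_ex; eexists; exact: lim.
  apply: nearW => k; apply: (le_trans (closed_le a (lk k) (lk0 k) (subset_trans (FkQ k) QD))).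
  have sub : Fk k `<=` hcube a l by rewrite -cupF => x xQ; exists k.
  by apply: le_measure; [rewrite inE; exact: (mFk k)|rewrite inE; exact: mh|exact: sub].
rewrite -[X in (_ <= X)%E](nuI A mA AD).
exact: (borel_measure_le half_le oD nuD mA AD).
Qed.

End cube_to_borel.

(** * Densities *)

Section Lp_exponents.
Context {R : realType} {n : nat}.
Local Notation V := 'rV[R]_n.
Local Notation mu := (lebesgue_rV R n).
Implicit Types (D K A : set V) (f h : V -> R).

(** The norm of exponent [+oo] unfolds to an essential supremum when the whole space has positive
    measure. *)
Lemma lebesgue_setT_gt0 : (0 < mu setT)%E.
Proof.
apply: (@lt_le_trans _ _ (mu (ccube (0 : V) 1))).
  by rewrite lebesgue_ccube// expr1n lte_fin.
by apply: le_measure; rewrite ?inE//; exact: measurable_rV_box.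
Qed.

Lemma LpyP D f : Lp +oo%E D f <-> measurable_fun D f /\
  exists2 B : R, 0 <= B & {ae mu, forall x, D x -> `|f x| <= B}.
Proof.
rewrite /Lp unlock /= lebesgue_setT_gt0; split => -[mf].
  move=> h; split => //.
  have s0 := ess_sup_ge mu (abse \o (EFin \o f \_ D)).
  have [B EB] : exists B : R, (ess_sup mu (abse \o (EFin \o f \_ D)) <= B%:E)%E.
    move: h; case: (ess_sup _ _) => [B _| //|_]; first by exists B.
    by exists 0; rewrite leNye.
  exists `|B| => //; apply: filterS s0 => x hx Dx.
  have := le_trans hx EB; rewrite /= restrictE mem_set// lee_fin => h'.
  exact: (le_trans h' (ler_norm _)).
move=> [B B0 hB]; split => //; apply: (@le_lt_trans _ _ B%:E); last exact: ltry.
apply/ess_supP; apply: filterS hB => x hx; rewrite /= restrictE lee_fin.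
by case: ifPn => [/set_mem/hx//|_]; rewrite normr0.
Qed.

Lemma Lp_subset (p : \bar R) D K f : (0 < p)%E -> measurable D -> measurable K ->
  K `<=` D -> Lp p D f -> Lp p K f.
Proof.
case: p => [p| |]// p0 mD mK KD.
  rewrite lte_fin in p0; move=> /(LpP _ _ p0)[mf If]; apply/(LpP _ _ p0).
  split; first exact: measurable_funS mD KD mf.
  apply: le_lt_trans If; apply: ge0_subset_integral => //.
  exact: measurable_powR_norm.
move=> /LpyP[mf [B B0 hB]]; apply/LpyP; split; first exact: measurable_funS mD KD mf.
by exists B => //; apply: filterS hB => x hx /KD.
Qed.

(** On sets of finite measure the exponent [+oo] is replaced by n+1, a finite exponent that still
    exceeds the dimension. *)
Definition finite_exponent (p : \bar R) : R := if p is s%:E then s else n.+1%:R.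

Lemma finite_exponent_gt p : (n%:R%:E < p)%E -> n%:R < finite_exponent p.
Proof. by case: p => [s| |]//=; rewrite ?lte_fin// ltr_nat. Qed.

Lemma Lp_finite_exponent p D f : (n%:R%:E < p)%E -> measurable D -> (mu D < +oo)%E ->
  Lp p D f -> Lp (finite_exponent p)%:E D f.
Proof.
case: p => [s| |]//= _ mD fD /LpyP[mf [B B0 hB]]; apply/LpP => //; split => //.
apply: (@le_lt_trans _ _ (\int[mu]_(x in D) (B `^ n.+1%:R)%:E)%E); last first.
  by rewrite integral_cst// lte_mul_pinfty// lee_fin powR_ge0.
apply: ae_ge0_le_integral => //.
- exact: measurable_powR_norm.
- by move=> x _; rewrite lee_fin powR_ge0.
by apply: filterS hB => x hx /hx h; rewrite lee_fin; apply: ge0_ler_powR; rewrite ?nnegrE.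
Qed.

Lemma Lp_sum (I : Type) (l : seq I) (r : R) D (F : I -> V -> R) : 1 <= r -> measurable D ->
  Lp r%:E D (cst 0) -> (forall i, Lp r%:E D (F i)) ->
  Lp r%:E D (fun x => \sum_(i <- l) F i x).
Proof.
move=> r1 mD l0 lF; elim: l => [|i l ih].
  by rewrite [X in Lp _ _ X](_ : _ = cst 0)//; apply/funext => x; rewrite big_nil.
rewrite [X in Lp _ _ X](_ : _ = (fun x => 1 * F i x + \sum_(j <- l) F j x)).
  exact: Lp_lin.
by apply/funext => x; rewrite big_cons mul1r.
Qed.

Lemma Lp_normr (r : R) D f : 0 < r -> Lp r%:E D f -> Lp r%:E D (fun x => `|f x|).
Proof.
move=> r0 /LpP[]// mf If; apply/LpP => //; split; first exact: measurableT_comp.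
by under eq_integral do rewrite normr_id.
Qed.

Lemma density_bound (u : {finite_measure set V -> \bar R}) w U : compact w ->
  concentrated_on u w -> is_density u w U -> Lp +oo%E w U ->
  exists2 M : R, 0 <= M & forall A, measurable A -> (u A <= M%:E * mu A)%E.
Proof.
move=> cw uw [iU hU] /LpyP[mU [M M0 hM]]; exists M => // A mA.
have mw := measurable_compactV cw.
have mAw : measurable (A `&` w) by exact: measurableI.
have -> : u A = u (A `&` w).
  rewrite -[in LHS](setUIDK A w) measureU//; last 2 first.
  - exact: measurableD.
  - by rewrite setIDA setIAC setDE -setIA setIC; apply/seteqP; split => x// [[]].
  rewrite [X in (_ + X)%E]uw ?adde0//; first exact: measurableD.
  by rewrite setDE -setIA setICl setI0.
rewrite hU//; apply: (@le_trans _ _ (M%:E * mu (A `&` w))%E); last first.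
  by apply: lee_wpmul2l; [rewrite lee_fin|apply: le_measure; rewrite ?inE].
rewrite -integral_cst//.
have iAw : mu.-integrable (A `&` w) (EFin \o U) by exact: integrableS iU.
apply: (le_trans (lee_abs _)); apply: (le_trans (le_abse_integral _ mAw (measurable_int _ iAw))).
apply: ae_ge0_le_integral => //.
  by apply: measurableT_comp => //; exact: measurable_int iAw.
by apply: filterS hM => x hx [_ wx]; rewrite /= lee_fin hx.
Qed.

End Lp_exponents.

(** * From the family of domination inequalities to a pointwise bound *)

Section density_inequality.
Context {R : realType} {n : nat}.
Local Notation V := 'rV[R]_n.
Local Notation mu := (lebesgue_rV R n).
Variables (m : {finite_measure set V -> \bar R}) (D : set V) (H U : V -> R) (s K : R).
Hypotheses (oD : open D) (fD : (mu D < +oo)%E) (mH : measurable_fun D H).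
Hypotheses (H1 : forall x, 1 <= H x) (K0 : 0 <= K) (ns : n%:R < s).
Hypothesis mle : forall (b : R) (A : set V), 1 <= b -> measurable A -> A `<=` D ->
  (m A <= \int[mu]_(x in A) (K * (b ^+ n + b `^ (n%:R - s) * H x `^ s))%:E)%E.

Let mD : measurable D. Proof. exact: measurable_openV. Qed.

(** The single value b = 1 of the parameter already dominates [m] by an integral for the Lebesgue
    measure. *)
Lemma density_null A : measurable A -> A `<=` D -> mu A = 0%E -> m A = 0%E.
Proof.
move=> mA AD A0; apply/eqP; rewrite eq_le measure_ge0 andbT.
apply: (le_trans (mle (lexx 1) mA AD)); rewrite null_set_integral//.
apply/measurable_EFinP; apply: measurable_funM; first exact: measurable_cst.
apply: measurable_funD; first exact: measurable_cst.
apply: measurable_funM; first exact: measurable_cst.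
exact: (measurableT_comp (measurable_powR s) (measurable_funS mD AD mH)).
Qed.

(* On {H <= b} the two terms of the bound are at most K b ^ n each; b is then
   the integer just above H x. *)
Lemma density_le : (forall x, 0 <= U x) -> mu.-integrable D (EFin \o U) ->
  (forall A, measurable A -> A `<=` D -> m A = (\int[mu]_(x in A) (U x)%:E)%E) ->
  {ae mu, forall x, D x -> U x <= 2 * K * 2 ^+ n * H x ^+ n}.
Proof.
move=> U0 iU mU; have mUD : measurable_fun D U.
  by apply/measurable_EFinP; exact: measurable_int iU.
have s0 : 0 < s by rewrite (le_lt_trans _ ns).
have step (b : nat) : (1 <= b)%N -> {ae mu, forall x, D x -> H x <= b%:R ->
    U x <= 2 * K * b%:R ^+ n}.
  move=> b1; have b1' : 1 <= b%:R :> R by rewrite ler1n.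
  have b0 : 0 < b%:R :> R by rewrite ltr0n.
  set c := 2 * K * b%:R ^+ n.
  have c0 : 0 <= c by rewrite !mulr_ge0// exprn_ge0.
  (* On this set U > c, yet the integral of U is at most that of c; so U = c almost everywhere there
     and the set is null. *)
  pose N := D `&` [set x | H x <= b%:R /\ c < U x].
  have mN : measurable N.
    rewrite (_ : N = (D `&` H @^-1` `]-oo, b%:R]) `&` (D `&` U @^-1` `]c, +oo[)); last first.
      apply/seteqP; split => x; rewrite /N /= !in_itv/= ?andbT; first by move=> [? []].
      by move=> [[? ?] [? ?]].
    by apply: measurableI; [exact: mH|exact: mUD].
  have ND : N `<=` D by move=> x [].
  have fN : (mu N < +oo)%E.
    by apply: le_lt_trans fD; apply: le_measure; rewrite ?inE.
  have iN : mu.-integrable N (EFin \o U) by exact: integrableS iU.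
  have icN : mu.-integrable N (EFin \o cst c).
    apply: (@bounded_finite_integrable _ _ _ _ _ (cst c) c) => //.
    by move=> x _; rewrite ger0_norm.
  have le1 : (\int[mu]_(x in N) (U x)%:E <= \int[mu]_(x in N) c%:E)%E.
    rewrite -mU//; apply: (le_trans (mle b1' mN ND)); apply: ge0_le_integral => //.
    - move=> x _; rewrite lee_fin mulr_ge0// addr_ge0 ?exprn_ge0 ?mulr_ge0 ?powR_ge0//.
    - apply/measurable_EFinP; apply: measurable_funM; first exact: measurable_cst.
      apply: measurable_funD; first exact: measurable_cst.
      apply: measurable_funM; first exact: measurable_cst.
      exact: (measurableT_comp (measurable_powR s) (measurable_funS mD ND mH)).
    move=> x [_ [Hb _]]; rewrite lee_fin /c -mulrA mulrCA ler_wpM2l//.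
    rewrite mulrDl !mul1r lerD2l.
    apply: (@le_trans _ _ (b%:R `^ (n%:R - s) * b%:R `^ s)).
      rewrite ler_wpM2l ?powR_ge0//; apply: ge0_ler_powR; rewrite ?nnegrE ?(ltW s0)//.
      exact: le_trans (H1 x).
    by rewrite -powRD ?subrK ?powR_mulrn// (gt_eqF b0) implybT.
  have iUc : mu.-integrable N (EFin \o (fun x => U x - c)).
    by have := integrableB mN iN icN; apply: eq_integrable => // x _ /=; rewrite EFinB.
  have z : (\int[mu]_(x in N) `|(EFin \o (fun x => (U x - c)%R)) x| = 0)%E.
    apply/eqP; rewrite eq_le integral_ge0 ?andbT//.
    rewrite (eq_integral (fun x => (U x)%:E - c%:E)%E); last first.
      move=> x /set_mem[_ [_ cU]]; rewrite /= gtr0_norm ?EFinB//.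
      by rewrite subr_gt0.
    rewrite (integralB mN iN icN) sube_le0//.
  have := (ae_eq_integral_abs _ mN (measurable_int _ iUc)).1 z.
  apply: filterS => x hx Dx Hb; rewrite leNgt; apply/negP => cU.
  have : N x by [].
  by move/hx => /= [] /eqP; rewrite subr_eq0 gt_eqF.
have all : {ae mu, forall x, forall b : nat, (1 <= b)%N -> D x -> H x <= b%:R ->
    U x <= 2 * K * b%:R ^+ n}.
  apply/ae_foralln => b; have [b1|b0] := leqP 1 b; last by apply: aeW => x.
  by apply: filterS (step b b1) => x hx _.
apply: filterS all => x hx Dx.
(* This integer exceeds H x and is at most H x + 1 <= 2 H x, which is the origin of [2 ^+ n]. *)
pose b := (Num.truncn (H x)).+1.
have H0 : 0 <= H x by apply: le_trans (H1 x).
have /andP[b1 b2] := truncn_itv H0.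
apply: (le_trans (hx b isT Dx (ltW b2))).
rewrite -!mulrA ler_wpM2l// ler_wpM2l// -exprMn; apply: lerXn2r; rewrite ?nnegrE ?mulr_ge0//.
rewrite /b -natr1 mulrDl mul1r lerD//; exact: H1.
Qed.

End density_inequality.

(** * Geometry of the domain, exhaustion by compact sets, size of the Hessian *)

Section domains.
Context {R : realType} {n : nat}.
Local Notation V := 'rV[R]_n.
Local Notation mu := (lebesgue_rV R n).
Implicit Types (D K O w : set V) (f p : V -> R).

Lemma dotp_mx (x y : V) : dotp x y = (x *m y^T) 0 0.
Proof. by rewrite mxE; apply: eq_bigr => i _; rewrite mxE. Qed.

Lemma enorm_orthogonal (Q : 'M[R]_n) (x : V) : Q *m Q^T = 1%:M -> enorm (x *m Q) = enorm x.
Proof.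
by move=> QQ; rewrite /enorm !dotp_mx trmx_mul mulmxA -(mulmxA x) QQ mulmx1.
Qed.

Lemma near_enorm (z : V) (e : R) : 0 < e -> \forall y \near z, enorm (y - z) < e.
Proof.
move=> e0; have c0 : {for z, continuous (fun y : V => y - z)}.
  by apply: (@continuousB _ _ _ id (cst z) z); [exact: cvg_id|exact: cst_continuous].
have := continuous_comp c0 (@enorm_continuous R n (z - z)).
move=> /(@cvgrPdist_lt _ _ _ (nbhs z))/(_ e e0); apply: filterS => y /=.
have -> : enorm (z - z : V) = 0 by rewrite subrr -(scale0r (0 : V)) enormZ normr0 mul0r.
by rewrite sub0r normrN ger0_norm// enorm_ge0.
Qed.

(* Below a boundary point, in the chart direction, there is an open set that
   misses D; hence the interior of the closure of D is D itself. *)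
Lemma lipschitz_interior D w : open D -> lipschitz_boundary D -> w `<=` closure D ->
  w° `<=` D.
Proof.
move=> oD lip wD x wx; apply: contrapT => nDx.
have cx : closure D x by apply: wD; exact: interior_subset.
have bx : (closure D `\` D°) x by split => // /interior_subset.
have [Q [i [phi [L [r [QQ r0 hphi hD]]]]]] := lip x bx.
have QQ' : Q^T *m Q = 1%:M by exact: mulmx1C.
(* The chart axis in the original coordinates. *)
pose v : V := evec i *m Q^T.
have nv : enorm v = 1.
  rewrite enorm_orthogonal ?trmxK//.
  by rewrite /enorm dotp_evec evecE eqxx sqrtr1.
have /nbhs_ballP[rho /= rho0 hrho] : nbhs x w by [].
pose t := Num.min (rho / 2) (r / 2).
have t0 : 0 < t by rewrite lt_min !divr_gt0.
have trho : t < rho by rewrite gt_min; apply/orP; left; lra.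
have tr : t <= r / 2 by rewrite ge_min lexx orbT.
(* A move below the graph that stays in [w], hence in the closure of [D]: some point of [D] lies
   within [dl] of [z]. *)
pose z := x - t *: v.
have zw : w z.
  apply: hrho; apply/ball_rV => // j.
  have -> : x 0 j - z 0 j = t * v 0 j by rewrite !mxE opprB addrC subrK.
  rewrite normrM.
  rewrite gtr0_norm//; apply: le_lt_trans trho; rewrite ger_pMr//.
  by have := coord_le_enorm v j; rewrite nv.
have C0 : 0 < 1 + `|L| * n%:R by rewrite ltr_pwDl// mulr_ge0.
(* A point of [D] this close to [z] would have a height below its own graph value: the graph varies
   by at most |L| n dl, and dl (1 + |L| n) <= t. *)
pose dl := Num.min (r / 2) (t / (1 + `|L| * n%:R)).
have dl0 : 0 < dl by rewrite lt_min !divr_gt0.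
have dlr : dl <= r / 2 by rewrite ge_min lexx.
have dlt : dl * (1 + `|L| * n%:R) <= t by rewrite -ler_pdivlMr// ge_min lexx orbT.
have [y [Dy hy]] := wD z zw _ (near_enorm z dl0).
have xr : enorm (x - x) < r.
  by rewrite subrr -(scale0r (0 : V)) enormZ normr0 mul0r.
have yr : enorm (y - x) < r.
  have -> : y - x = (y - z) + - t *: v
    by rewrite /z opprB scaleNr -addrA [t *: v - x - _]addrAC subrr sub0r.
  apply: (le_lt_trans (enorm_triangle _ _)); rewrite enormZ nv mulr1 normrN gtr0_norm//; lra.
have hx : (x *m Q) 0 i <= phi (col' i (x *m Q)).
  by rewrite leNgt; apply/negP => /(hD x xr).
have := (hD y yr).1 Dy.
have zQ : z *m Q = x *m Q - t *: evec i.
  by rewrite mulmxBl -scalemxAl -mulmxA QQ' mulmx1.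
have yz j : `|(y *m Q) 0 j - (z *m Q) 0 j| < dl.
  apply: le_lt_trans hy; rewrite -(enorm_orthogonal (y - z) QQ).
  have E (A B : V) : A 0 j - B 0 j = (A - B) 0 j by rewrite !mxE.
  rewrite E -mulmxBl.
  exact: coord_le_enorm.
have cz : col' i (z *m Q) = col' i (x *m Q).
  apply/rowP => j; rewrite zQ !mxE /=.
  by rewrite eq_sym (negbTE (neq_lift _ _)) mulr0 subr0.
have h1 := hphi (col' i (x *m Q)) (col' i (y *m Q)).
have h2 : enorm (col' i (x *m Q) - col' i (y *m Q)) <= n%:R * dl.
  rewrite -cz; apply: (le_trans (enorm_le_sum _)).
  apply: (@le_trans _ _ (\sum_(j < n.-1) dl)).
    by apply: ler_sum => j _; rewrite !mxE distrC ltW// (le_lt_trans _ (yz (lift i j)))// !mxE.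
  rewrite sumr_const card_ord -(mulr_natl dl); apply: ler_wpM2r; first exact: ltW.
  by rewrite ler_nat leq_pred.
have h3 : L * enorm (col' i (x *m Q) - col' i (y *m Q)) <= `|L| * (n%:R * dl).
  apply: (@le_trans _ _ (`|L| * enorm (col' i (x *m Q) - col' i (y *m Q)))).
    by rewrite ler_wpM2r ?enorm_ge0// ler_norm.
  by rewrite ler_wpM2l.
have h4 := le_trans h1 h3.
have zi : (z *m Q) 0 i = (x *m Q) 0 i - t.
  by rewrite zQ !mxE /= eqxx mulr1.
have := yz i; rewrite zi; move: h4 hx dlt; rewrite mulrDr mulr1 (mulrCA dl) (mulrC dl).
move: ((y *m Q) 0 i) ((x *m Q) 0 i) (phi (col' i (x *m Q))) (phi (col' i (y *m Q))).
move: (`|L| * _) => c yi xi px py.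
rewrite ler_norml => /andP[a1 a2] a3 a4; rewrite ltr_norml => /andP[a5 a6]; lra.
Qed.

(** [sobolev_loc] speaks of relatively compact open sets and [Lp_loc] of compact sets; a finite
    union of boxes mediates between them. *)
Lemma relatively_compact_open O K : open O -> compact K -> K `<=` O ->
  exists D, [/\ open D, compact (closure D), closure D `<=` O & K `<=` D].
Proof.
move=> oO cK KO; have [c [r [r0 cO Oc]]] := open_cover_boxes oO.
have [On0|O0] := pselect (O !=set0); last first.
  exists set0; rewrite closure0; split => //; [exact: compact0|].
  by move=> x /KO Ox; apply: O0; exists x.
have := cK; rewrite {1}compact_cover => /(_ nat setT (fun k => obox (c k) (r k))).
move=> [k _|x Kx|s _ hs]; first exact: open_obox.
  by have [k _ hk] := Oc x (KO x Kx); exists k.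
pose l : seq nat := finmap.enum_fset s.
exists (\bigcup_(k in [set k | k \in l]) obox (c k) (r k)).
pose B (l' : seq nat) := \bigcup_(k in [set k | k \in l']) cbox (c k) (r k).
have cB l' : compact (B l').
  elim: l' => [|k l' ih].
    by rewrite /B (_ : [set k | k \in [::]] = set0) ?bigcup_set0; [exact: compact0|apply/seteqP; split].
  rewrite (_ : B (k :: l') = cbox (c k) (r k) `|` B l').
    by apply: compactU => //; exact: compact_rV_box.
  apply/seteqP; split => [x [k' /=]|x [hx|[k' /= kl hx]]].
  - by rewrite inE => /orP[/eqP ->|kl] hx; [left|right; exists k'].
  - by exists k => //=; rewrite mem_head.
  - by exists k' => //=; rewrite inE kl orbT.
have sub : closure (\bigcup_(k in [set k | k \in l]) obox (c k) (r k)) `<=` B l.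
  rewrite closureE; apply: smallest_sub; first exact: compact_closed.
  move=> x [k sk hk]; exists k => //; apply/cboxP => i; exact: ltW (hk i).
split.
- by apply: bigcup_open => k _; exact: open_obox.
- by apply: (subclosed_compact _ (cB l) sub); exact: closed_closure.
- by apply: subset_trans sub _ => x [k _]; exact: cO.
- by move=> x /hs[k sk hk]; exists k.
Qed.

Lemma compact_lebesgue_fin K : compact K -> (mu K < +oo)%E.
Proof.
move=> cK.
have := continuous_integrable_compact cK (@cst_continuous _ _ (1 : R)).
move=> /integrableP[_]; under eq_integral do rewrite /= normr1.
by rewrite integral_cst ?mul1e//; exact: measurable_compactV.
Qed.

Lemma sobolev_hessian (r : \bar R) D p : open D -> sobolev 2 r D p ->
  exists (f : 'I_n -> V -> R) (h : 'I_n -> 'I_n -> V -> R),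
  [/\ forall i, weak_partial D [:: i] p (f i),
      forall i j, weak_partial D [:: j] (f i) (h i j) & forall i j, Lp r D (h i j)].
Proof.
move=> oD sp.
have /choice[f hf] : forall i, exists f, weak_partial D [:: i] p f.
  by move=> i; have [f _ wf] := sp [:: i] isT; exists f.
have /choice[h hh] : forall ij : 'I_n * 'I_n, exists h,
    Lp r D h /\ weak_partial D [:: ij.1; ij.2] p h.
  by move=> [i j]; have [h l wh] := sp [:: i; j] isT; exists h.
exists f, (fun i j => h (i, j)); split => // i j; last by have [] := hh (i, j).
by apply: (weak_partial_split (hf i)); have [] := hh (i, j).
Qed.

(** The function h of the final bound. The summand 1 keeps integrals over cubes positive and makes H
    + 1 <= 2 H. *)
Definition hessian_size (h : 'I_n -> 'I_n -> V -> R) (x : V) : R :=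
  1 + \sum_(i < n) \sum_(j < n) `|h i j x|.

Lemma hessian_size_ge1 h x : 1 <= hessian_size h x.
Proof. by rewrite lerDl; apply: sumr_ge0 => i _; apply: sumr_ge0 => j _. Qed.

Lemma hessian_size_ge h i j x : `|h i j x| <= hessian_size h x.
Proof.
apply: (@le_trans _ _ (\sum_(j < n) `|h i j x|)).
  by rewrite (bigD1 j)//= lerDl sumr_ge0.
apply: (@le_trans _ _ (\sum_(i < n) \sum_(j < n) `|h i j x|)); last by rewrite lerDr.
by rewrite [leRHS](bigD1 i)//= lerDl sumr_ge0// => k _; exact: sumr_ge0.
Qed.

Lemma Lp_hessian_size (r : \bar R) D h : (n%:R%:E < r)%E -> (0 < n)%N -> measurable D ->
  (mu D < +oo)%E -> (forall i j, Lp r D (h i j)) -> Lp r D (hessian_size h).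
Proof.
move=> nr n0 mD fD; case: r nr => [r| |]// nr lh.
  rewrite lte_fin in nr; have r1 : 1 <= r by rewrite (le_trans _ (ltW nr))// ler1n.
  have r0 : 0 < r by rewrite (lt_le_trans _ r1).
  have lc (a : R) : Lp r%:E D (cst a).
    apply/LpP => //; split; first exact: measurable_cst.
    rewrite (eq_integral (cst (`|a| `^ r)%:E))// integral_cst//.
    by rewrite lte_mul_pinfty// lee_fin powR_ge0.
  have l2 : Lp r%:E D (fun x => \sum_(i < n) \sum_(j < n) `|h i j x|).
    by apply: Lp_sum => // i; apply: Lp_sum => // j; apply: Lp_normr.
  have := Lp_lin 1 r1 mD (lc 1) l2; congr (Lp _ _ _).
  by apply/funext => x; rewrite mul1r.
have /choice[B hB] : forall ij : 'I_n * 'I_n, exists B : R,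
    {ae mu, forall x, D x -> `|h ij.1 ij.2 x| <= B}.
  by move=> [i j]; have /LpyP[_ [B _ hB]] := lh i j; exists B.
apply/LpyP; split.
  apply: measurable_funD; first exact: measurable_cst.
  apply: measurable_sum => i; apply: measurable_sum => j.
  by apply: measurableT_comp => //; have [] := lh i j.
exists (1 + \sum_(i < n) \sum_(j < n) `|B (i, j)|).
  by rewrite addr_ge0//; apply: sumr_ge0 => i _; apply: sumr_ge0.
have := @filter_forall _ _ _ _ (ae_filter_ringOfSetsType mu) hB.
apply: filterS => x hx Dx; rewrite ger0_norm; last by apply: le_trans (hessian_size_ge1 h x).
rewrite lerD2l; apply: ler_sum => i _; apply: ler_sum => j _.
exact: (le_trans (hx (i, j) Dx) (ler_norm _)).
Qed.

End domains.

(** * Radon-Nikodym density and its integrability *)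

Section local_density.
Context {R : realType} {n : nat}.
Local Notation V := 'rV[R]_n.
Local Notation mu := (lebesgue_rV R n).

Lemma density_exists (m : {finite_measure set V -> \bar R}) (O : set V) : measurable O ->
  (forall A, measurable A -> A `<=` O -> mu A = 0%E -> m A = 0%E) ->
  exists U : V -> R, [/\ forall x, 0 <= U x, mu.-integrable O (EFin \o U) &
    forall A, measurable A -> m (A `&` O) = (\int[mu]_(x in A `&` O) (U x)%:E)%E].
Proof.
move=> mO m0.
have [|m' m'E] := @finite_measureP _ _ _ (mrestr m mO).
  apply: le_lt_trans (finite_measure_fin m); apply: le_measure; rewrite ?inE//.
  exact: measurableI.
pose la : {sigma_finite_measure set V -> \bar R} := @leb R n.
have ac : m' `<< la.
  move=> A A0 B mB BA; rewrite m'E /mrestr; apply: m0; first exact: measurableI.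
    exact: subIsetr.
  by apply: A0; [exact: measurableI|move=> x [/BA]].
have f0 := Radon_Nikodym_SigmaFinite.f_ge0 ac.
have ff := Radon_Nikodym_SigmaFinite.f_fin_num ac.
have fE x : (fine (Radon_Nikodym_SigmaFinite.f m' la x))%:E =
  Radon_Nikodym_SigmaFinite.f m' la x by rewrite fineK.
exists (fun x => fine (Radon_Nikodym_SigmaFinite.f m' la x)); split.
- by move=> x; exact: fine_ge0.
- apply: (@integrableS _ _ _ mu setT) => //.
  by rewrite (_ : _ \o _ = Radon_Nikodym_SigmaFinite.f m' la);
    [exact: (Radon_Nikodym_SigmaFinite.f_integrable ac)|apply/funext => x; exact: fE].
- move=> A mA; have mAO : measurable (A `&` O) by exact: measurableI.
  have := Radon_Nikodym_SigmaFinite.f_integral ac mAO.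
  have -> : m' (A `&` O) = m (A `&` O `&` O) by exact: m'E.
  rewrite -setIA setIid => ->.
  by apply: eq_integral => x _; rewrite fE.
Qed.

(** (H^n)^(r/n) = H^r, so the bound U <= C H^n turns exponent r for H into r/n for U; an infinite
    exponent is treated apart with essential bounds. *)
Lemma Lp_density (r : \bar R) (D K : set V) (H U : V -> R) (C : R) :
  (0 < n)%N -> (n%:R%:E < r)%E -> measurable D -> measurable K -> K `<=` D ->
  measurable_fun D U -> (forall x, 0 <= U x) -> 0 <= C -> (forall x, 1 <= H x) ->
  Lp r D H -> {ae mu, forall x, D x -> U x <= C * H x ^+ n} ->
  Lp (r * (n%:R^-1)%:E)%E K U.
Proof.
move=> n0 nr mD mK KD mU U0 C0 H1 lH hU.
have n0' : 0 < n%:R :> R by rewrite ltr0n.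
have H0 x : 0 <= H x by apply: le_trans (H1 x).
case: r nr lH => [r| |]// nr lH.
- rewrite lte_fin in nr; have r0 : 0 < r by rewrite (lt_trans n0').
  rewrite -EFinM; have rn0 : 0 < r * n%:R^-1 by rewrite divr_gt0.
  apply: (@Lp_subset _ _ _ D) => //; apply/LpP => //; split => //.
  have [mH IH] := (LpP _ _ r0).1 lH.
  apply: (@le_lt_trans _ _ (\int[mu]_(x in D) ((C `^ (r / n%:R))%:E * (`|H x| `^ r)%:E))%E).
    apply: ae_ge0_le_integral => //.
    - exact: measurable_powR_norm.
    - by move=> x _; rewrite -EFinM lee_fin mulr_ge0 ?powR_ge0.
    - by apply: emeasurable_funM; [exact: measurable_cst|exact: measurable_powR_norm].
    apply: filterS hU => x hx Dx; rewrite -EFinM lee_fin (ger0_norm (U0 x)) (ger0_norm (H0 x)).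
    apply: (@le_trans _ _ ((C * H x ^+ n) `^ (r / n%:R))).
      by apply: ge0_ler_powR; rewrite ?nnegrE ?(ltW rn0)// ?mulr_ge0 ?exprn_ge0//; exact: hx.
    rewrite powRM ?exprn_ge0// -powR_mulrn// -powRrM mulrCA divff ?gt_eqF// mulr1.
    by [].
  rewrite ge0_integralZl//; first by rewrite lte_mul_pinfty// lee_fin powR_ge0.
  - exact: measurable_powR_norm.
  - by rewrite lee_fin powR_ge0.
- rewrite gt0_mulye ?lte_fin ?invr_gt0//; apply: (@Lp_subset _ _ _ D) => //.
  have /LpyP[mH [B B0 hB]] := lH; apply/LpyP; split => //.
  exists (C * B ^+ n); first by rewrite mulr_ge0// exprn_ge0.
  apply: filterS2 hU hB => x h1 h2 Dx; rewrite (ger0_norm (U0 x)).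
  apply: (le_trans (h1 Dx)); rewrite ler_wpM2l//; apply: lerXn2r; rewrite ?nnegrE//.
  exact: le_trans (ler_norm _) (h2 Dx).
Qed.

Variables (w0 w1 : set V) (u0 m : {finite_measure set V -> \bar R}) (w p : V -> R).
Variables (alpha g M : R).
Hypotheses (n0 : (0 < n)%N) (cw0 : compact w0) (cw1 : compact w1) (cw : continuous w).
Hypotheses (a0 : 0 < alpha) (g12 : 1 < g <= 2) (M0 : 0 <= M).
Hypothesis u0M : forall A, measurable A -> (u0 A <= M%:E * mu A)%E.
Hypothesis mK : forall (K : set V) (e : R), compact K -> K `<=` w1 -> 0 < e ->
  (m K <= u0 (contact w0 w1 (fun x y => (w y + alpha * power_cost g x y)%R) e K))%E.
Hypothesis pw : ae_eq mu w1° p w.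

(** The inequality uses a finite exponent, while [H] keeps its integrability of exponent [r]. The
    pointwise bound drawn from it involves only H^n, so r = +oo still gives a bounded density. *)
Lemma local_domination (r : \bar R) (D : set V) : (n%:R%:E < r)%E -> open D -> D `<=` w1 ->
  sobolev 2 r D p -> exists (H : V -> R) (K : R),
  [/\ forall x, 1 <= H x, 0 <= K, Lp r D H & forall (b : R) (A : set V),
    1 <= b -> measurable A -> A `<=` D ->
    (m A <= \int[mu]_(x in A) (K * (b ^+ n +
       b `^ (n%:R - finite_exponent r (n := n)) * H x `^ finite_exponent r (n := n)))%:E)%E].
Proof.
move=> nr oD Dw sp; have mD := measurable_openV oD.
have Dw' : D `<=` w1° by move=> x Dx; apply: (filterS Dw); exact: open_nbhs_nbhs.
have fD : (mu D < +oo)%E.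
  apply: le_lt_trans (compact_lebesgue_fin cw1); apply: le_measure => //; rewrite inE//.
  exact: measurable_compactV.
have [f [h [pf fh lh]]] := sobolev_hessian oD sp.
set s := finite_exponent r; have ns : n%:R < s by exact: finite_exponent_gt.
have s0 : 0 < s by rewrite (le_lt_trans _ ns).
have lH := Lp_hessian_size nr n0 mD fD lh.
have [mH IH] := (LpP _ _ s0).1 (Lp_finite_exponent nr mD fD lH).
have pwD : ae_eq mu D p w by apply: filterS pw => x hx /Dw'.
(* The weak derivatives of [p] are those of its continuous representative [w], to which the
   minimization refers. *)
have wf i : weak_partial D [:: i] w (f i).
  have [_ lf _] := pf i; apply: (weak_partial_ae oD pwD _ _ lf (pf i)).
    exact: ae_eq_refl.
  exact: Lp_loc1_continuous.
have [C C0 hC] := contact_cube_le n0 cw0 cw1 cw a0 g12 M0 u0M mK ns.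
exists (hessian_size h), (M * (2 * C) ^+ n); split.
- exact: hessian_size_ge1.
- by rewrite mulr_ge0// exprn_ge0// mulr_ge0// ltW.
- exact: lH.
have Hs x : `|hessian_size h x| = hessian_size h x.
  by rewrite ger0_norm// (le_trans _ (hessian_size_ge1 h x)).
move=> b A b1 mA AD; apply: (borel_le_density n0 ns oD fD mH (hessian_size_ge1 h) M0 (ltW C0)) => //.
  by apply: le_lt_trans IH; under [X in (_ <= X)%E]eq_integral do rewrite Hs.
move=> a l t I l0 t0 I0 QD QI.
apply: (hC D f h a l t I) => // i j; apply: le_trans QI.
have mQ : measurable (ccube (a - const_mx t) (l + 2 * t)) by exact: measurable_rV_box.
apply: ge0_le_integral => //.
- have [mh _] := lh i j; apply: measurable_powR_norm; exact: measurable_funS mD QD mh.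
- apply/measurable_EFinP.
  exact: (measurableT_comp (measurable_powR s) (measurable_funS mD QD mH)).
move=> x _; rewrite lee_fin; apply: ge0_ler_powR; rewrite ?nnegrE ?(ltW s0)//.
  by apply: le_trans (hessian_size_ge1 h x).
exact: hessian_size_ge.
Qed.

Lemma local_density (r : \bar R) (D K : set V) (U : V -> R) : (n%:R%:E < r)%E -> open D ->
  D `<=` w1 -> sobolev 2 r D p -> (forall x, 0 <= U x) -> mu.-integrable D (EFin \o U) ->
  (forall A, measurable A -> A `<=` D -> m A = (\int[mu]_(x in A) (U x)%:E)%E) ->
  measurable K -> K `<=` D -> Lp (r * (n%:R^-1)%:E)%E K U.
Proof.
move=> nr oD Dw sp U0 iU mU mK' KD; have mD := measurable_openV oD.
have fD : (mu D < +oo)%E.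
  apply: le_lt_trans (compact_lebesgue_fin cw1); apply: le_measure => //; rewrite inE//.
  exact: measurable_compactV.
have [H [C [H1 C0 lH hC]]] := local_domination nr oD Dw sp.
have [mH _] := lH.
have mUD : measurable_fun D U by apply/measurable_EFinP; exact: measurable_int iU.
apply: (Lp_density (C := 2 * C * 2 ^+ n) n0 nr mD mK' KD mUD U0 _ H1 lH).
  by rewrite !mulr_ge0// exprn_ge0.
exact: (density_le oD fD mH H1 C0 (finite_exponent_gt nr) hC U0 iU mU).
Qed.

Lemma local_null (r : \bar R) (D A : set V) : (n%:R%:E < r)%E -> open D -> D `<=` w1 ->
  sobolev 2 r D p -> measurable A -> A `<=` D -> mu A = 0%E -> m A = 0%E.
Proof.
move=> nr oD Dw sp mA AD A0.
have [H [C [H1 C0 [mH _] hC]]] := local_domination nr oD Dw sp.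
exact: (density_null oD mH hC mA AD A0).
Qed.

(** The constants depend on the subdomain, but null sets are countably stable: local regularity on
    boxes with closure in the interior suffices. *)
Lemma interior_null (r : \bar R) (A : set V) : (n%:R%:E < r)%E -> sobolev_loc 2 r w1° p ->
  measurable A -> A `<=` w1° -> mu A = 0%E -> m A = 0%E.
Proof.
move=> nr sp mA AO A0; have oO : open w1° by exact: open_interior.
have [On0|O0] := pselect (w1° !=set0); last first.
  rewrite (_ : A = set0) ?measure0//; apply/seteqP; split => // x /AO Ox.
  by apply: O0; exists x.
have [c [r' [r0 cO Oc]]] := open_cover_boxes oO.
have Ak k : m (A `&` obox (c k) (r' k)) = 0%E.
  have oB : open (obox (c k) (r' k)) by exact: open_obox.
  have mAB : measurable (A `&` obox (c k) (r' k)).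
    by apply: measurableI => //; exact: measurable_openV.
  have cB : compact (cbox (c k) (r' k)) by exact: compact_rV_box.
  have sub : closure (obox (c k) (r' k)) `<=` cbox (c k) (r' k).
    rewrite closureE; apply: smallest_sub; first exact: compact_closed.
    by move=> x hx; apply/cboxP => i; exact: ltW (hx i).
  apply: (@local_null r _ _ nr oB _ _ mAB (@subIsetr _ _ _) _).
  - move=> x /(@subset_closure _ _ x)/sub/(cO k On0); exact: interior_subset.
  - apply: sp => //; last exact: subset_trans sub (cO k On0).
    by apply: subclosed_compact sub; [exact: closed_closure|exact: cB].
  - apply/eqP; rewrite eq_le measure_ge0 andbT -A0.
    by apply: le_measure; [rewrite inE; exact: mAB|rewrite inE; exact: mA|exact: subIsetl].
have AE : A = \bigcup_k (A `&` obox (c k) (r' k)).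
  by rewrite -setI_bigcupr; apply/esym/setIidl => x /AO/Oc.
have mAk k : measurable (A `&` obox (c k) (r' k)).
  by apply: measurableI => //; apply: measurable_openV; exact: open_obox.
have : m.-negligible A.
  rewrite AE; apply: negligible_bigcup => k.
  by exists (A `&` obox (c k) (r' k)); split; [exact: mAk|exact: Ak|].
by move/(negligibleP _ mA).
Qed.

End local_density.

Theorem theorem7p2 (R : realType) (d : nat) (d23 : d = 2%N \/ d = 3%N)
    (Omega : set 'rV[R]_d) (Omega_dom : bounded_lipschitz_domain Omega)
    (omega0 omega1 : set 'rV[R]_d)
    (omega0_neq0 : omega0 !=set0) (omega0_compact : compact omega0)
    (omega1_neq0 : omega1 !=set0) (omega1_compact : compact omega1)
    (omega1_sub : omega1 `<=` closure Omega)
    (alpha : R) (alpha_gt0 : 0 < alpha)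
    (pOmega : \bar R) (pOmega_gt : (d%:R%:E < pOmega)%E)
    (pOmega_solv : forall s : \bar R,
       (hoelder_conjugate pOmega < s < pOmega)%E ->
       poisson_uniquely_solvable s Omega)
    (q : R) (q_gt1 : 1 < q)
    (q_conj : (d%:R%:E < hoelder_conjugate q%:E < pOmega)%E)
    (q_conj3 : d = 3%N -> (hoelder_conjugate q%:E < 6%:R%:E)%E)
    (J : ('rV[R]_d -> R) -> R) (J_cont : W10_continuous q%:E Omega J)
    (J_diff : gateaux_differentiable q%:E Omega J)
    (u0 : {finite_measure set 'rV[R]_d -> \bar R})
    (u0_on : concentrated_on u0 omega0)
    (u0_ac : u0 `<< lebesgue_rV R d)
    (U0 : 'rV[R]_d -> R) (U0_density : is_density u0 omega0 U0)
    (U0_bounded : Lp +oo%E omega0 U0)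
    (gamma : R) (gamma_range : 1 < gamma <= 2)
    (ubar : {charge set 'rV[R]_d -> \bar R})
    (ubar_opt : optimal_control Omega omega0 omega1 q%:E J alpha
                  (power_cost gamma) u0 ubar)
    (p : 'rV[R]_d -> R) (p_adj : adjoint_state Omega omega1 q%:E J ubar p)
    (r : \bar R) (r_gt : (d%:R%:E < r)%E)
    (p_reg : sobolev_loc 2 r omega1° p) :
  (fun A => ubar (A `&` omega1°)) `<< lebesgue_rV R d /\
  exists U : 'rV[R]_d -> R,
    [/\ is_density ubar omega1° U,
        Lp_loc (r * (d%:R^-1)%:E)%E omega1° U &
        cone_condition omega1° ->
        forall s : \bar R, (d%:R%:E < s)%E -> sobolev 2 s omega1° p ->
          Lp (s * (d%:R^-1)%:E)%E omega1° U].
Proof.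
have n0 : (0 < d)%N by case: d23 => ->.
have dq : (2 <= d)%N by case: d23 => ->.
have [_ oO _ bO lipO] := Omega_dom.
have q0 : 0 < q by rewrite (lt_trans _ q_gt1).
have q1' : 0 < q - 1 by rewrite subr_gt0.
(* The conjugate exponent of q, that of the adjoint state; it exceeds the dimension, so Morrey's
   embedding applies to [p]. *)
set s := q / (q - 1).
have s0 : 0 < s by rewrite divr_gt0.
have qs : q^-1 + s^-1 = 1 by rewrite /s invf_div; field; rewrite gt_eqF.
have cq : hoelder_conjugate q%:E = s%:E by exact: hoelder_conjugate_fin.
have cs : hoelder_conjugate s%:E = q%:E by rewrite -cq hoelder_conjugateK.
have /andP[ns sp] := q_conj; rewrite cq lte_fin in ns; rewrite cq in sp.
have s2 : 2 < s by apply: le_lt_trans ns; rewrite ler_nat.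
have q2 : q < 2.
  by move: s2; rewrite /s ltr_pdivlMr//; lra.
(* The exponent q lies in the range of solvability: q < 2 <= d < [pOmega], and the conjugate of q is
   below [pOmega]. *)
have solvable : poisson_uniquely_solvable q%:E Omega.
  apply: pOmega_solv; apply/andP; split; last first.
    by apply: lt_trans pOmega_gt; rewrite lte_fin (lt_le_trans q2)// ler_nat.
  case: (pOmega) sp => [P|_|]; [|by rewrite hoelder_conjugatey lte_fin|by rewrite ltNge leNye].
  rewrite lte_fin => sP; have P1 : 1 < P by lra.
  have P1' : 0 < P - 1 by rewrite subr_gt0.
  have P0 : 0 < P by lra.
  rewrite (@hoelder_conjugate_fin _ P (P / (P - 1)))//; last by rewrite divr_gt0.
    rewrite lte_fin ltr_pdivrMr//.
    move: sP; rewrite /s ltr_pdivrMr//; lra.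
  by rewrite invf_div; field; rewrite gt_eqF.
have Wp : W10 s%:E Omega p by case: p_adj; rewrite cq.
have [_ _ /(_ p Wp)[w [cw w0 pw _]]] := W10_continuous_representative n0 ns oO bO.
have rw : C0_representative Omega p w := C0_continuous cw w0 pw.
have /andP[g1 g2] := gamma_range.
have [m [um mK]] := optimal_contact n0 ns q_gt1 qs oO bO omega0_compact omega1_compact
  omega1_sub omega1_neq0 u0_on alpha_gt0 solvable J_cont J_diff
  (power_cost_continuous g1) (measurable_power_cost gamma)
  (fun x y => power_cost_ge0 x y (lt_trans ltr01 g1)) ubar_opt p_adj cw rw.
have [M M0 u0M] := density_bound omega0_compact u0_on U0_density U0_bounded.
(* Points of the interior lie in Omega itself, so there [p] and [w] coincide almost everywhere. *)
have sub : omega1° `<=` Omega := lipschitz_interior oO lipO omega1_sub.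
have pw1 : ae_eq (lebesgue_rV R d) omega1° p w by apply: filterS pw => x hx /sub.
have oi : open omega1° by exact: open_interior.
have mi : measurable omega1° by exact: measurable_openV.
have iw : omega1° `<=` omega1 by exact: interior_subset.
have m0 A : measurable A -> A `<=` omega1° -> lebesgue_rV R d A = 0%E -> m A = 0%E.
  exact: (interior_null n0 omega0_compact omega1_compact cw alpha_gt0 gamma_range M0 u0M mK
    pw1 r_gt p_reg).
split.
  move=> A A0 B mB BA; rewrite um; last exact: measurableI.
  apply: m0; [exact: measurableI|exact: subIsetr|].
  by apply: A0; [exact: measurableI|move=> x [/BA]].
(* One density on the whole interior; the local and the global claims are integrability statements
   about it. *)
have [U [U0' iU mU]] := density_exists mi m0.
have mU' A : measurable A -> A `<=` omega1° ->
    m A = (\int[lebesgue_rV R d]_(x in A) (U x)%:E)%E.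
  by move=> mA Ai; have := mU A mA; rewrite (setIidl Ai).
have loc := @local_density R d omega0 omega1 u0 m w p alpha gamma M n0 omega0_compact
  omega1_compact cw alpha_gt0 gamma_range M0 u0M mK pw1.
exists U; split.
- split => // A mA; rewrite um; first exact: mU.
  exact: measurableI.
- move=> K cK Ki; have mKK := measurable_compactV cK.
  (* An intermediate open set on which the local regularity of [p] becomes global. *)
  have [D [oD cD Di KD]] := relatively_compact_open oi cK Ki.
  have Di' : D `<=` omega1° by apply: subset_trans Di; exact: subset_closure.
  apply: (loc r D K U r_gt oD) => //.
  + exact: subset_trans Di' iw.
  + exact: p_reg.
  + by apply: integrableS iU => //; exact: measurable_openV.
  + by move=> A mA AD; apply: mU' => //; exact: subset_trans AD Di'.
- move=> _ s' s'_gt p_reg'.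
  exact: (loc s' omega1° omega1° U s'_gt oi iw p_reg' U0' iU mU' mi).
Qed.
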